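(* (Riemann–Hurwitz formula for formal orbifolds) Let $f:(Y,Q)\to (X,P)$ be a morphism of formal orbifolds of degree $d$. Then $$2g(Y,Q)-2=d\,(2g(X,P)-2)+\deg(D),$$ where $D$ is the ramification divisor of $f$.
   Context: Let $k$ be an algebraically closed field of arbitrary characteristic; all curves are over $k$, and coverings of curves are finite and generically étale (separable), so that the differents below are defined. For a smooth projective curve $X$ and a closed point $x\in X$, $\mathcal{K}_{X,x}$ denotes the fraction field of the completed local ring $\widehat{\mathcal O}_{X,x}$. If $f:Y\to X$ is a covering and $y\in Y$ is a closed point, then $\mathcal K_{Y,y}$ is a finite extension of $\mathcal K_{X,f(y)}$. A branch data on $X$ is a function $P$ assigning to each closed point $x\in X$ a finite Galois extension $P(x)$ of $\mathcal K_{X,x}$ (in a fixed algebraic closure of $\mathcal K_{X,x}$) such that the support $\mathrm{Supp}(P)=\{x: P(x)\ne \mathcal K_{X,x}\}$ is finite. A formal orbifold is a pair $(X,P)$ with $X$ a smooth projective curve and $P$ a branch data on $X$; since fiber products are not connected in general, formal orbifolds are allowed to be disconnected. A morphism of formal orbifolds $f:(Y,Q)\to(X,P)$ is a covering $f:Y\to X$ such that for every closed point $y\in Y$ the extension $Q(y)/\mathcal K_{X,f(y)}$ contains the extension $P(f(y))/\mathcal K_{X,f(y)}$; its degree is the degree of $f:Y\to X$. For a finite extension $L/K$ of local fields with residue field $k$ (such as $L/k((t))$), let $\mathrm{dr}(L/K)=v_L(\mathcal D(L/K))$, where $\mathcal D(L/K)$ is the different and $v_L$ is the valuation of $L$ normalized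 so that a uniformizer has value $1$. The genus of $(X,P)$ is $$g(X,P)=g(X)+\frac12\sum_{x\in \mathrm{Supp}(P)}\frac{\mathrm{dr}(P(x)/\mathcal K_{X,x})}{[P(x):\mathcal K_{X,x}]},$$ where $g(X)$ is the genus of the curve $X$ (so $2g(X)-2$ is the degree of the canonical divisor). The ramification divisor of $f:(Y,Q)\to(X,P)$ is the $\mathbb Q$-divisor $$D=\sum_{y\in Y}\frac{\mathrm{dr}(Q(y)/P(f(y)))}{[Q(y):\mathcal K_{Y,y}]}\,y .$$ *)

(* Defs.v *)
From HB Require Import structures.
From mathcomp Require Import all_boot all_order all_algebra all_field.
From mathcomp Require Import boolp classical_sets cardinality fsbigop.

Set Implicit Arguments.
Unset Strict Implicit.
Unset Printing Implicit Defensive.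

Import Order.TTheory GRing.Theory Num.Theory.
Local Open Scope classical_set_scope.
Local Open Scope ring_scope.

(** * Field extensions given by a morphism of fields *)

Section FieldExtensions.
Variables (K L : fieldType) (j : {rmorphism K -> L}).

Definition is_ext_basis n (b : 'I_n -> L) : Prop :=
  forall y, exists! c : 'rV[K]_n, y = \sum_i j (c 0 i) * b i.

Definition ext_has_degree (n : nat) : Prop :=
  exists b : 'I_n -> L, is_ext_basis b.

Definition finite_ext : Prop := exists n, ext_has_degree n.

(* [L : K], for a finite extension (0 otherwise) *)
Definition ext_degree : nat := xget 0%N [set n | ext_has_degree n].

Definition separable_ext : Prop :=
  forall y : L, exists2 p : {poly K},
    separable_poly p & root (map_poly j p) y.

(* t is the trace of the K-linear endomorphism x |-> a * x of L *)
Definition is_ext_trace (a : L) (t : K) : Prop :=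
  exists n (b : 'I_n -> L) (A : 'M[K]_n),
    [/\ is_ext_basis b,
        forall i, a * b i = \sum_l j (A i l) * b l
      & t = \tr A].

Definition ext_trace (a : L) : K := xget 0 [set t | is_ext_trace a t].

End FieldExtensions.

(** * Discrete valuations *)

(* Normalized discrete valuations. Only the values at nonzero elements are
   meaningful; the value at 0 is fixed to 0 so that two valuations are equal
   as functions exactly when they are equal as valuations. *)
Definition is_dval (F : fieldType) (v : F -> int) : Prop :=
  [/\ v 0 = 0,
      forall x y, x != 0 -> y != 0 -> v (x * y) = v x + v y,
      forall x y, x != 0 -> y != 0 -> x + y != 0 ->
        Num.min (v x) (v y) <= v (x + y)
    & exists2 x, x != 0 & v x = 1].

(* v x >= m, where 0 has valuation +oo *)
Definition val_ge (F : fieldType) (v : F -> int) (m : int) (x : F) : Prop :=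
  x = 0 \/ m <= v x.

Definition is_complete (F : fieldType) (v : F -> int) : Prop :=
  forall u : nat -> F,
    (forall m : int, exists n0, forall i l, (n0 <= i)%N -> (n0 <= l)%N ->
       val_ge v m (u i - u l)) ->
    exists a, forall m : int, exists n0, forall i, (n0 <= i)%N ->
       val_ge v m (u i - a).

(* w extends v along j, both being normalized; e is the ramification index *)
Definition val_ext (K L : fieldType) (v : K -> int) (w : L -> int)
    (j : {rmorphism K -> L}) : Prop :=
  exists2 e : nat, (0 < e)%N & forall a, w (j a) = v a *+ e.

Section Different.
Variables (K L : fieldType) (v : K -> int) (w : L -> int).
Variable j : {rmorphism K -> L}.

(* the complementary module {x | Tr (x O_L) is contained in O_K} *)
Definition codifferent : set L :=
  [set x | forall z, val_ge w 0 z -> val_ge v 0 (ext_trace j (x * z))].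

(* its inverse fractional ideal (O_L : codifferent) *)
Definition different : set L :=
  [set z | forall x, codifferent x -> val_ge w 0 (z * x)].

(* the valuation v_L of the different, seen as a fractional ideal of L *)
Definition dr : int :=
  xget 0 [set n : int | (exists z, [/\ different z, z != 0 & w z = n]) /\
                        (forall z, different z -> val_ge w n z)].

End Different.

(** * Function fields, closed points, canonical divisors *)

(* Connected smooth projective curves over k are represented by their function
   fields, i.e. the finite extensions of the rational function field k(t); the
   two categories are (anti)equivalent, with coverings corresponding to finite
   separable extensions. *)
Record funField (k : closedFieldType) := FunField {
  ff_sort :> fieldType;
  ff_cst : {rmorphism k -> ff_sort};
  ff_finite : exists j : {rmorphism {fraction {poly k}} -> ff_sort},
    (forall c : k, j (tofrac c%:P) = ff_cst c) /\ finite_ext j }.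

(* The closed points of a connected smooth projective curve are the discrete
   valuation rings of its function field that contain k. *)
Record point (k : closedFieldType) (F : funField k) := Point {
  pt_val :> F -> int;
  pt_dval : is_dval pt_val;
  pt_cst : forall c : k, pt_val (ff_cst F c) = 0 }.

HB.instance Definition _ (k : closedFieldType) (F : funField k) :=
  gen_eqMixin (point F).
HB.instance Definition _ (k : closedFieldType) (F : funField k) :=
  gen_choiceMixin (point F).

Section CanonicalDivisor.
Variables (k : closedFieldType) (F : funField k).

Definition is_derivation (D : F -> F) : Prop :=
  [/\ forall x y, D (x + y) = D x + D y,
      forall x y, D (x * y) = x * D y + y * D x
    & forall c : k, D (ff_cst F c) = 0].

(* The equality f dx = g dt in the Kaehler differentials of F over k. These
   form a finite-dimensional F-vector space whose dual is the space of
   k-derivations of F, so equality can be tested against derivations. *)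
Definition eq_diff (f x g t : F) : Prop :=
  forall D, is_derivation D -> f * D x = g * D t.

(* the order of dx at p: the valuation of g, where dx = g dt and t is a
   uniformizer at p *)
Definition ord_diff (x : F) (p : point F) : int :=
  xget 0 [set n | exists g t : F, [/\ p t = 1, eq_diff 1 x g t & p g = n]].

(* Some x in F such that dx is nonzero; it exists because k is perfect. The
   class, hence the degree, of the divisor of dx does not depend on it. *)
Definition sep_elt : F := xget 0 [set x : F | ~ eq_diff 1 x 0 0].

Definition canonical_divisor : point F -> int := ord_diff sep_elt.

Definition canonical_degree : int :=
  \sum_(p \in [set: point F]) canonical_divisor p.

End CanonicalDivisor.

(** * Completed local fields *)

Record localField := LocalField {
  lf_sort :> fieldType;
  lf_val : lf_sort -> int;
  lf_dval : is_dval lf_val;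
  lf_complete : is_complete lf_val }.

(* A model of the fraction field of the completed local ring at p, i.e. of the
   completion of F at p; it is unique up to a unique isomorphism. *)
Record completion (k : closedFieldType) (F : funField k) (p : point F) :=
  Completion {
    cp_field :> localField;
    cp_in : {rmorphism F -> cp_field};
    cp_val : forall a, lf_val (cp_in a) = p a;
    cp_dense : forall (z : cp_field) (m : int),
      exists a : F, val_ge (@lf_val cp_field) m (z - cp_in a) }.

(* Finite Galois extensions of a local field, with their normalized valuation
   (which is determined by the extension). Extensions inside a fixed algebraic
   closure are replaced by abstract ones: for Galois extensions, being
   contained in one another amounts to being embeddable in one another. *)
Record galoisExt (K : localField) := GaloisExt {
  ge_sort :> splittingFieldType K;
  ge_galois : galois 1%AS {:ge_sort}%AS;
  ge_val : ge_sort -> int;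
  ge_dval : is_dval ge_val;
  ge_ext : val_ext (@lf_val K) ge_val (in_alg ge_sort) }.

Definition ge_degree (K : localField) (L : galoisExt K) : nat :=
  \dim {:ge_sort L}.

(** * Curves, coverings and formal orbifolds *)

(* a possibly disconnected smooth projective curve, as the family of its
   connected components, with a model of each completed local field *)
Record curve (k : closedFieldType) := Curve {
  components : finType;
  funfield : components -> funField k;
  local_at : forall i (p : point (funfield i)), completion p }.
Arguments funfield {k} c i.
Arguments local_at {k} c {i} p.

(* 2 g(X) - 2 is the degree of the canonical divisor: the usual genus if X is
   connected, and 1 + \sum_i (g(X_i) - 1) if X has the components X_i *)
Definition genus (k : closedFieldType) (X : curve k) : rat :=
  1 + (\sum_(i : components X) canonical_degree (funfield X i))%:~R / 2%:R.

Record covering (k : closedFieldType) (Y X : curve k) := Covering {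
  cov_comp : components Y -> components X;
  cov_surj : forall i, exists j, cov_comp j = i;
  cov_fun : forall j, {rmorphism funfield X (cov_comp j) -> funfield Y j};
  cov_cst : forall j (c : k), cov_fun j (ff_cst _ c) = ff_cst _ c;
  cov_finite : forall j, finite_ext (cov_fun j);
  cov_separable : forall j, separable_ext (cov_fun j);
  (* the induced map on closed points *)
  cov_point : forall j, point (funfield Y j) ->
                        point (funfield X (cov_comp j));
  cov_pointP : forall j (y : point (funfield Y j)),
    val_ext (cov_point y) y (cov_fun j);
  (* the induced extensions of completed local fields *)
  cov_local : forall j (y : point (funfield Y j)),
    {rmorphism local_at X (cov_point y) -> local_at Y y};
  cov_local_in : forall j (y : point (funfield Y j)) a,
    cov_local y (cp_in _ a) = cp_in _ (cov_fun j a);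
  cov_local_val : forall j (y : point (funfield Y j)),
    val_ext (@lf_val _) (@lf_val _) (cov_local y) }.

Definition covering_of_degree (k : closedFieldType) (Y X : curve k)
    (f : covering Y X) (d : nat) : Prop :=
  forall i : components X, (\sum_(j | cov_comp f j == i) ext_degree (cov_fun f j))%N
                     = d.

(* The sum over an infinite support is 0 by convention; the divisors
   considered here all have finite support. *)
Definition div_degree (k : closedFieldType) (X : curve k)
    (D : forall i, point (funfield X i) -> rat) : rat :=
  \sum_(i : components X) \sum_(p \in [set: point (funfield X i)]) D i p.

Definition branch_support (k : closedFieldType) (X : curve k)
    (P : forall i (p : point (funfield X i)), galoisExt (local_at X p))
    (i : components X) : set (point (funfield X i)) :=
  [set p | ge_degree (P i p) <> 1%N].
Arguments branch_support {k X} P i _.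

Record formalOrbifold (k : closedFieldType) := FormalOrbifold {
  orb_curve :> curve k;
  branch : forall i (p : point (funfield orb_curve i)),
    galoisExt (local_at orb_curve p);
  branch_finite : forall i, finite_set (branch_support branch i) }.
Arguments branch {k} f {i} p.

Definition orb_genus (k : closedFieldType) (X : formalOrbifold k) : rat :=
  genus X +
  1 / 2%:R * \sum_(i : components X)
    \sum_(p \in branch_support (@branch _ X) i)
      ((dr (@lf_val (local_at X p)) (@ge_val _ (branch X p))
           (in_alg (branch X p)))%:~R
       / (ge_degree (branch X p))%:R : rat).

Record orbMorphism (k : closedFieldType) (Y X : formalOrbifold k) :=
  OrbMorphism {
    orb_cov :> covering Y X;
    (* the inclusion of P (f y) in Q y over the completed local field at f y *)
    orb_emb : forall j (y : point (funfield Y j)),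
      {rmorphism branch X (cov_point orb_cov y) -> branch Y y};
    orb_embP : forall j (y : point (funfield Y j)) a,
      orb_emb y (in_alg _ a) = in_alg _ (cov_local orb_cov y a) }.

Definition ramification_divisor (k : closedFieldType) (Y X : formalOrbifold k)
    (f : orbMorphism Y X) (j : components Y) (y : point (funfield Y j)) : rat :=
  (dr (@ge_val _ (branch X (cov_point f y))) (@ge_val _ (branch Y y))
      (orb_emb f y))%:~R
  / (ge_degree (branch Y y))%:R.

(* Main.v *)
From HB Require Import structures.
From mathcomp Require Import all_boot all_order all_algebra all_field.
From mathcomp Require Import finmap boolp classical_sets cardinality fsbigop.
From mathcomp Require Import zify ring.
Require Import Defs.

Set Implicit Arguments.
Unset Strict Implicit.
Unset Printing Implicit Defensive.

Import Order.TTheory GRing.Theory Num.Theory.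
Local Open Scope classical_set_scope.
Local Open Scope ring_scope.

(** Let [t] be a uniformizer at [x] and [pi] one at [y] over [x]. For a finite
    separable extension of complete discretely valued fields with residue field
    [k], which is totally ramified, Euler's trace formula identifies the
    exponent of the different with the valuation of [dt/dpi]. Multiplicativity
    of differents is therefore the chain rule, and it reduces the theorem to the
    formula [canonical_degree F = n * canonical_degree E + \sum_y y(dt/dpi)]
    for an extension [F / E] of function fields of degree [n], that is, to
    comparing the divisor of a differential of [E] on [E] and on [F].

    This needs that principal divisors have degree 0 and that fibers have
    degree [n]. Both follow by comparing, for a function [h], the families that
    are independent over [k[h]] with the spaces of functions with bounded poles:
    weak approximation bounds the former below by the zeros of [h], counting
    principal parts bounds the latter above by the poles of [h]. The one
    existence statement involved, that a nonconstant function has a pole, comes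
    from Zorn's lemma. *)

(** * Discrete valuations *)

(** Because of wild ramification no formula in the ramification indices alone can hold; every
    exponent is read off from a derivation d/dpi, uniformly in the characteristic. This derivation
    is built on the completion, where elements are series in pi. The canonical divisor only sees
    derivations of the function field F, and that d/dpi maps F into F is not clear. It follows from
    a relation R(t, a) = 0 over k whose partial derivative in a does not vanish at (t, a): implicit
    differentiation expresses da/dt by a function. Perfectness of k provides such a relation. Sums
    over infinite supports are 0 by convention, so the degree of a divisor can be split only after
    its support is shown to be finite. For differentials this means that t - c is a uniformizer at
    almost all points, c being the residue of t; it holds because k(t) is dense in F at almost all
    points, by Newton's method. A morphism of orbifolds embeds P(f(y)) in Q(y) merely as a field;
    the compatibility of the valuations is deduced from completeness. *)

Section Valuation.
Variables (F : fieldType) (v : F -> int).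
Hypothesis vP : is_dval v.

Lemma dval0 : v 0 = 0.
Proof. by case: vP. Qed.

Lemma dvalM x y : x != 0 -> y != 0 -> v (x * y) = v x + v y.
Proof. by case: vP => _ + _ _; apply. Qed.

Lemma dval1 : v 1 = 0.
Proof. by have := dvalM (oner_neq0 F) (oner_neq0 F); rewrite mulr1; move: (v 1); lia. Qed.

Lemma dvalN x : v (- x) = v x.
Proof.
have [->|x0] := eqVneq x 0; first by rewrite oppr0.
have n1 : (-1 : F) != 0 by rewrite oppr_eq0 oner_eq0.
have := dvalM n1 n1; rewrite mulrNN mulr1 dval1 => v1.
by rewrite -mulN1r dvalM //; move: v1; move: (v (-1)) (v x); lia.
Qed.

Lemma dvalV x : v x^-1 = - v x.
Proof.
have [->|x0] := eqVneq x 0; first by rewrite invr0 dval0.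
have x'0 : x^-1 != 0 by rewrite invr_eq0.
have := dvalM x0 x'0; rewrite divff // dval1; lia.
Qed.

Lemma dvalX x n : x != 0 -> v (x ^+ n) = v x *+ n.
Proof.
move=> x0; elim: n => [|n IH]; first by rewrite expr0 dval1.
by rewrite exprS dvalM ?expf_neq0 // IH mulrS.
Qed.

Lemma dval_neq0 x : v x != 0 -> x != 0.
Proof. by apply: contra => /eqP ->; rewrite dval0. Qed.

Lemma dval_unif : exists2 t, t != 0 & v t = 1.
Proof. by case: vP. Qed.

Lemma dval_surj m : exists2 x, x != 0 & v x = m.
Proof.
have [t t0 vt] := dval_unif.
have [|n|n] := intP m.
- by exists 1; rewrite ?oner_neq0 ?dval1.
- exists (t ^+ n.+1); first by rewrite expf_neq0.
  by rewrite dvalX // vt -mulr_natr mul1r natz.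
exists (t ^- n.+1); first by rewrite invr_neq0 ?expf_neq0.
by rewrite dvalV dvalX // vt -mulr_natr mul1r natz.
Qed.

Lemma val_ge0 m : val_ge v m 0.
Proof. by left. Qed.

Lemma val_gexx x : val_ge v (v x) x.
Proof. by right. Qed.

Lemma val_geE m x : x != 0 -> val_ge v m x <-> m <= v x.
Proof. by move=> x0; split=> [[/eqP|//]|]; [rewrite (negPf x0)|right]. Qed.

Lemma val_ge_le m n x : n <= m -> val_ge v m x -> val_ge v n x.
Proof. by move=> nm [->|mx]; [left|right; lia]. Qed.

Lemma val_geD m x y : val_ge v m x -> val_ge v m y -> val_ge v m (x + y).
Proof.
move=> [->|mx]; first by rewrite add0r.
move=> [->|my]; first by rewrite addr0; right.
have [->|x0] := eqVneq x 0; first by rewrite add0r; right.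
have [->|y0] := eqVneq y 0; first by rewrite addr0; right.
have [xy0|xy0] := eqVneq (x + y) 0; [by left|right].
case: vP => _ _ /(_ _ _ x0 y0 xy0) h _.
by apply: le_trans h; rewrite le_min mx my.
Qed.

Lemma val_geN m x : val_ge v m x -> val_ge v m (- x).
Proof. by move=> [->|mx]; [left; rewrite oppr0|right; rewrite dvalN]. Qed.

Lemma val_geB m x y : val_ge v m x -> val_ge v m y -> val_ge v m (x - y).
Proof. by move=> hx hy; apply: val_geD => //; apply: val_geN. Qed.

Lemma val_geM m n x y : val_ge v m x -> val_ge v n y -> val_ge v (m + n) (x * y).
Proof.
move=> [->|mx]; first by rewrite mul0r; left.
move=> [->|my]; first by rewrite mulr0; left.
have [->|x0] := eqVneq x 0; first by rewrite mul0r; left.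
have [->|y0] := eqVneq y 0; first by rewrite mulr0; left.
by right; rewrite dvalM //; lia.
Qed.

Lemma val_ge0M m x y : val_ge v 0 x -> val_ge v m y -> val_ge v m (x * y).
Proof. by move=> hx hy; rewrite -[m]add0r; apply: val_geM. Qed.

Lemma val_geM0 m x y : val_ge v m x -> val_ge v 0 y -> val_ge v m (x * y).
Proof. by move=> hx hy; rewrite -[m]addr0; apply: val_geM. Qed.

Lemma val_geX m n x : val_ge v m x -> val_ge v (m *+ n) (x ^+ n).
Proof.
move=> hx; elim: n => [|n IH]; first by rewrite expr0; right; rewrite dval1.
by rewrite exprS mulrS; apply: val_geM.
Qed.

Lemma val_ge0X n x : val_ge v 0 x -> val_ge v 0 (x ^+ n).
Proof. by move=> /(val_geX n); rewrite mul0rn. Qed.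

Lemma val_ge_sum (I : Type) (r : seq I) (P : pred I) (f : I -> F) m :
  (forall i, P i -> val_ge v m (f i)) -> val_ge v m (\sum_(i <- r | P i) f i).
Proof.
move=> h; apply: big_ind => //; first exact: val_ge0.
exact: val_geD.
Qed.

Lemma val_ge_MnatR m x n : val_ge v m x -> val_ge v m (x *+ n).
Proof.
move=> h; elim: n => [|n IH]; first by rewrite mulr0n; left.
by rewrite mulrS; apply: val_geD.
Qed.

Lemma val_ge_all_eq0 x : (forall n : nat, val_ge v n%:Z x) -> x = 0.
Proof. by move=> /(_ (absz (v x)).+1) [//|]; lia. Qed.

Lemma val_ge_ball_eq0 x m : (forall n : nat, val_ge v (m + n%:Z) x) -> x = 0.
Proof.
move=> h; apply: val_ge_all_eq0 => n; apply: val_ge_le (h (n + absz m)%N); lia.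
Qed.

Lemma val_gt_add x y : x != 0 -> val_ge v (v x + 1) y -> x + y != 0 /\ v (x + y) = v x.
Proof.
move=> x0 hy.
have nge z : z != 0 -> z = x + y -> v z <= v x.
  move=> z0 zE; rewrite leNgt; apply/negP => lt.
  have hz : val_ge v (v x + 1) z by right; lia.
  have := val_geB hz hy; rewrite zE addrK.
  by case=> [/eqP|]; [rewrite (negPf x0)|lia].
have xy0 : x + y != 0.
  apply/eqP => /eqP; rewrite addr_eq0 => /eqP xE.
  move: (val_geN hy); rewrite -xE.
  by case=> [/eqP|]; [rewrite (negPf x0)|lia].
split=> //; apply/le_anti; rewrite nge //=.
have : val_ge v (v x) (x + y).
  by apply: val_geD; [exact: val_gexx|apply: val_ge_le hy; lia].
by case=> [/eqP|//]; rewrite (negPf xy0).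
Qed.

Lemma val_gt_sub x y : x != 0 -> val_ge v (v x + 1) (x - y) -> y != 0 /\ v y = v x.
Proof.
move=> x0 /val_geN /(val_gt_add x0).
by rewrite opprB addrC subrK.
Qed.

Lemma val_ge_div m x y : y != 0 -> val_ge v (m + v y) x <-> val_ge v m (x / y).
Proof.
move=> y0; have [->|x0] := eqVneq x 0.
  by rewrite mul0r; split=> _; left.
have xy0 : x / y != 0 by rewrite mulf_neq0 ?invr_eq0.
rewrite !val_geE // dvalM ?invr_eq0 // dvalV; lia.
Qed.

Lemma val_ge_mulr m x y : y != 0 -> val_ge v m x <-> val_ge v (m + v y) (x * y).
Proof.
move=> y0; split=> h; first by apply: val_geM => //; exact: val_gexx.
by rewrite -(mulfK y0 x); apply/val_ge_div.
Qed.

End Valuation.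

(** * Polynomials in an element, and expansions in a uniformizer *)

Definition pev (k F : fieldType) (f : {rmorphism k -> F}) (t : F) (q : {poly k}) : F :=
  (map_poly f q).[t].

Section PolyEval.
Variables (k F : fieldType) (f : {rmorphism k -> F}) (t : F).

Fact pev_zmod_morphism : zmod_morphism (pev f t).
Proof. by move=> p q; rewrite /pev rmorphB hornerD hornerN. Qed.

Fact pev_monoid_morphism : monoid_morphism (pev f t).
Proof. by split=> [|p q]; rewrite /pev ?rmorph1 ?hornerC // rmorphM hornerM. Qed.

HB.instance Definition _ :=
  GRing.isZmodMorphism.Build {poly k} F (pev f t) pev_zmod_morphism.
HB.instance Definition _ :=
  GRing.isMonoidMorphism.Build {poly k} F (pev f t) pev_monoid_morphism.

Lemma pevC c : pev f t c%:P = f c.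
Proof. by rewrite /pev map_polyC hornerC. Qed.

Lemma pevX : pev f t 'X = t.
Proof. by rewrite /pev map_polyX hornerX. Qed.

Lemma pevXn n : pev f t 'X^n = t ^+ n.
Proof. by rewrite rmorphXn /= pevX. Qed.

Lemma pevZ c q : pev f t (c *: q) = f c * pev f t q.
Proof. by rewrite -mul_polyC rmorphM /= pevC. Qed.

Lemma pevE n (q : {poly k}) : (size q <= n)%N -> pev f t q = \sum_(i < n) f q`_i * t ^+ i.
Proof.
move=> qn; rewrite /pev (@horner_coef_wide _ n) ?size_map_poly //.
by apply: eq_bigr => i _; rewrite coef_map.
Qed.

End PolyEval.

(** The residue field is [k], phrased without forming a quotient. Algebraic extensions inherit this
    property, so finite extensions of complete fields are totally ramified here. *)
Definition residue_cst (k F : fieldType) (v : F -> int) (f : {rmorphism k -> F}) :=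
  forall z, val_ge v 0 z -> exists c, val_ge v 1 (z - f c).

Section ConstantValuation.
Variables (k F : fieldType) (v : F -> int) (f : {rmorphism k -> F}).
Hypotheses (vP : is_dval v) (vf : forall c, v (f c) = 0).

Lemma val_ge_cst c : val_ge v 0 (f c).
Proof. by right; rewrite vf. Qed.

Lemma val_ge_cst_eq0 c m : 0 < m -> val_ge v m (f c) -> c = 0.
Proof. by move=> m0 [/eqP|]; [rewrite fmorph_eq0 => /eqP|rewrite vf; lia]. Qed.

Lemma pev_ge0 t q : val_ge v 0 t -> val_ge v 0 (pev f t q).
Proof.
move=> ht; elim/poly_ind: q => [|q c IH]; first by rewrite rmorph0; left.
rewrite rmorphD rmorphM /= pevX pevC; apply: val_geD => //.
  exact: val_ge0M.
exact: val_ge_cst.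
Qed.

Lemma pev_coef0 t (q : {poly k}) m : 0 <= m -> val_ge v m t -> val_ge v m (pev f t q - f q`_0).
Proof.
move=> m0 ht; elim/poly_ind: q => [|q c _].
  by rewrite rmorph0 coef0 rmorph0 subr0; left.
rewrite rmorphD rmorphM /= pevX pevC coefD coefMX coefC /= add0r addrK.
by apply: val_ge0M => //; apply: pev_ge0; apply: val_ge_le ht.
Qed.

Lemma poly_order0 (q : {poly k}) : q != 0 -> exists n (q1 : {poly k}), q = q1 * 'X^n /\ q1`_0 != 0.
Proof.
move=> q0; have [n [q1]] := multiplicity_XsubC q 0.
by rewrite q0 /= subr0 /root horner_coef0 => *; exists n, q1.
Qed.

Lemma pev_coef0_val t (q : {poly k}) : 0 < v t -> q`_0 != 0 -> pev f t q != 0 /\ v (pev f t q) = 0.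
Proof.
move=> vt q0; have fq0 : f q`_0 != 0 by rewrite fmorph_eq0.
have h : val_ge v (v t) (pev f t q - f q`_0).
  by apply: pev_coef0; [lia|exact: val_gexx].
have := @val_gt_add _ _ vP (f q`_0) (pev f t q - f q`_0) fq0.
rewrite [f _ + _]addrC subrK vf; apply; apply: val_ge_le h; lia.
Qed.

(** Factoring out the largest power of ['X] leaves a polynomial with nonzero constant term, whose
    value is a unit. *)
Lemma pev_val t q : 0 < v t -> q != 0 ->
  pev f t q != 0 /\ exists n, v (pev f t q) = v t *+ n.
Proof.
move=> vt q0; have [n [q1 [-> q10]]] := poly_order0 q0.
have t0 : t != 0 by apply: (dval_neq0 vP); lia.
rewrite rmorphM /= pevXn; have [p0 vp] := pev_coef0_val vt q10.
rewrite mulf_neq0 ?expf_neq0 //; split=> //; exists n.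
by rewrite (dvalM vP) ?expf_neq0 // vp (dvalX vP) ?add0r.
Qed.

Lemma val_ge_pev t q n : v t = 1 -> val_ge v n%:Z (pev f t q) -> exists q1, q = q1 * 'X^n.
Proof.
move=> vt; have [->|q0] := eqVneq q 0; first by exists 0; rewrite mul0r.
have [m [q1 [-> q10]]] := poly_order0 q0.
have t0 : t != 0 by apply: (dval_neq0 vP); lia.
rewrite rmorphM /= pevXn; have [|p0 vp] := @pev_coef0_val t _ _ q10; first by rewrite vt.
rewrite val_geE ?mulf_neq0 ?expf_neq0 // (dvalM vP) ?expf_neq0 // vp (dvalX vP) // vt.
move=> nm; exists (q1 * 'X^(m - n)); rewrite -mulrA -exprD subnK //; lia.
Qed.

Lemma val_ge_pev_deriv t q n : v t = 1 -> val_ge v n.+1%:Z (pev f t q) ->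
  val_ge v n%:Z (pev f t q^`()).
Proof.
move=> vt /(val_ge_pev vt) [q1 ->]; rewrite derivM derivXn /= rmorphD !rmorphM rmorphMn /=.
have ht : val_ge v 1 t by right; rewrite vt.
have ht0 : val_ge v 0 t by apply: val_ge_le ht.
rewrite !pevXn; apply: (val_geD vP).
  apply: (val_ge0M vP); first exact: pev_ge0.
  have := val_geX vP n.+1 ht; apply: val_ge_le; lia.
apply: (val_ge0M vP); first exact: pev_ge0.
apply: (val_ge_MnatR vP).
have := val_geX vP n ht; apply: val_ge_le; lia.
Qed.

(** Truncated power series: each step reads off the residue of the remainder divided by [t ^+ n] as
    the next coefficient. *)
Lemma pev_approx t z n : residue_cst v f -> v t = 1 -> val_ge v 0 z ->
  exists2 q : {poly k}, (size q <= n)%N & val_ge v n%:Z (z - pev f t q).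
Proof.
move=> res vt hz; elim: n => [|n [q qn hq]].
  by exists 0; [rewrite size_poly0|rewrite (rmorph0 (pev f t)) subr0].
have t0 : t != 0 by apply: (dval_neq0 vP); lia.
have tn0 : t ^+ n != 0 by rewrite expf_neq0.
have vtn : v (t ^+ n) = n%:Z by rewrite (dvalX vP) // vt -mulr_natr mul1r natz.
have := res ((z - pev f t q) / t ^+ n); case.
  by apply/(val_ge_div vP) => //; rewrite vtn add0r.
move=> c hc; exists (q + c *: 'X^n).
  rewrite (leq_trans (size_polyD _ _)) // geq_max (leq_trans qn) //.
  by rewrite (leq_trans (size_scale_leq _ _)) ?size_polyXn.
have := (val_ge_mulr vP 1 (_ - f c) tn0).1 hc.
rewrite mulrBl divfK // vtn rmorphD /= pevZ pevXn opprD addrA.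
by apply: val_ge_le; lia.
Qed.

End ConstantValuation.

(** * Derivations *)

Section Derivations.
Variables (k K M : fieldType) (f : {rmorphism k -> K}) (i : {rmorphism K -> M}).

(** The target is a field over [K] through [i], so that derivations can be restricted to subfields.
    Taking for [f] the inclusion of the base of an extension expresses linearity over that base. *)
Definition is_der (D : K -> M) : Prop :=
  [/\ forall x y, D (x + y) = D x + D y,
      forall x y, D (x * y) = i x * D y + i y * D x
    & forall c, D (f c) = 0].

Variable D : K -> M.
Hypothesis DP : is_der D.

Lemma derD x y : D (x + y) = D x + D y. Proof. by case: DP. Qed.
Lemma derM x y : D (x * y) = i x * D y + i y * D x. Proof. by case: DP. Qed.
Lemma der_cst c : D (f c) = 0. Proof. by case: DP. Qed.
Lemma der0 : D 0 = 0. Proof. by rewrite -(rmorph0 f) der_cst. Qed.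
Lemma der1 : D 1 = 0. Proof. by rewrite -(rmorph1 f) der_cst. Qed.

Lemma derN x : D (- x) = - D x.
Proof. by apply/eqP; rewrite -addr_eq0 -derD addNr der0. Qed.

Lemma derB x y : D (x - y) = D x - D y.
Proof. by rewrite derD derN. Qed.

Lemma der_sum (I : Type) (r : seq I) (P : pred I) (F : I -> K) :
  D (\sum_(x <- r | P x) F x) = \sum_(x <- r | P x) D (F x).
Proof. by apply: (big_morph D derD der0). Qed.

Lemma der_pev t q : D (pev f t q) = i (pev f t q^`()) * D t.
Proof.
elim/poly_ind: q => [|q c IH]; first by rewrite deriv0 !rmorph0 der0 mul0r.
rewrite !rmorphD !rmorphM /= pevX pevC derD derM der_cst addr0 IH.
rewrite derivD derivC addr0 derivM derivX mulr1 rmorphD !rmorphM /= pevX.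
by rewrite rmorphD rmorphM /=; ring.
Qed.

Lemma derXn t n : D (t ^+ n) = i (t ^+ n.-1) * D t *+ n.
Proof. by rewrite -(pevXn f) der_pev derivXn rmorphMn /= pevXn rmorphMn /= mulrnAl. Qed.

End Derivations.

Lemma der_comp (k K L : fieldType) (f : {rmorphism k -> K}) (j : {rmorphism K -> L})
    (D : L -> L) : is_der (j \o f) idfun D -> is_der f j (D \o j).
Proof.
move=> DP; split=> [x y|x y|c] /=; first by rewrite rmorphD (derD DP).
  by rewrite rmorphM (derM DP).
exact: (der_cst DP).
Qed.

Section ContinuousDerivations.
Variables (k K M : fieldType) (f : {rmorphism k -> K}) (i : {rmorphism K -> M}).
Variables (v : K -> int) (w : M -> int) (e : nat).
Hypotheses (vP : is_dval v) (wP : is_dval w).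
Hypothesis res : residue_cst v f.
Hypothesis vf : forall c, v (f c) = 0.
Hypothesis e0 : (0 < e)%N.

(* A derivation killing a uniformizer kills the polynomials in it, which are
   dense in the valuation ring. *)
Lemma continuous_der_eq0 (D : K -> M) (B : int) (t : K) :
  is_der f i D ->
  (forall a m, val_ge v m a -> val_ge w (m *+ e - B) (D a)) ->
  v t = 1 -> D t = 0 -> forall a, D a = 0.
Proof.
move=> DP Dc vt Dt a.
have t0 : t != 0 by apply: (dval_neq0 vP); lia.
have DO b : val_ge v 0 b -> D b = 0.
  move=> hb; apply: (@val_ge_ball_eq0 _ w _ (- B)) => n.
  have [q _ hq] := pev_approx vP n res vt hb.
  have -> : D b = D (b - pev f t q).
    by rewrite (derB DP) (der_pev DP) Dt mulr0 subr0.
  apply: val_ge_le (Dc _ _ hq); rewrite -mulr_natr; nia.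
(* A power of [t], which [D] kills, moves [a] into the valuation ring. *)
have tm0 : t ^+ absz (v a) != 0 by rewrite expf_neq0.
have : D (t ^+ absz (v a) * a) = 0.
  apply: DO; have [->|a0] := eqVneq a 0; first by rewrite mulr0; left.
  by right; rewrite (dvalM vP) // (dvalX vP) // vt -mulr_natr; lia.
rewrite (derM DP) (derXn DP) Dt mulr0 mul0rn mulr0 addr0 => /eqP.
by rewrite mulf_eq0 fmorph_eq0 (negPf tm0) => /eqP.
Qed.

End ContinuousDerivations.

(** * The derivation d/dt of a complete field *)

Section ExistenceDerivation.
Variables (k K : fieldType) (f : {rmorphism k -> K}) (v : K -> int) (t : K).
Hypotheses (vP : is_dval v) (vK : is_complete v) (res : residue_cst v f).
Hypotheses (vf : forall c, v (f c) = 0) (vt : v t = 1).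

Let t0 : t != 0. Proof. by apply: (dval_neq0 vP); rewrite vt. Qed.
Let ht : val_ge v 0 t. Proof. by right; rewrite vt. Qed.

Let euler (q : {poly k}) : {poly k} := 'X * q^`().

Let eulerB p q : euler (p - q) = euler p - euler q.
Proof. by rewrite /euler derivB mulrBr. Qed.

Let eulerD p q : euler (p + q) = euler p + euler q.
Proof. by rewrite /euler derivD mulrDr. Qed.

(** Differentiation lowers the order by at most one, also when the characteristic divides an
    exponent, and the factor ['X] restores it. *)
Let euler_ge q n : val_ge v n%:Z (pev f t q) -> val_ge v n%:Z (pev f t (euler q)).
Proof.
case: n => [|n] h; first exact: pev_ge0.
rewrite rmorphM /= pevX -[X in val_ge _ X%:Z _]add1n PoszD.
by apply: val_geM => //; [right; rewrite vt|apply: val_ge_pev_deriv].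
Qed.

(* [eulerO a l]: the integral element [l] is the image of [a] under
   [t d/dt]; the Euler operator is used because it preserves the valuation and
   satisfies [t d/dt (t^m) = m t^m]. *)
Let eulerO (a l : K) := forall n : nat, exists q,
  val_ge v n%:Z (a - pev f t q) /\ val_ge v n%:Z (l - pev f t (euler q)).

Let eulerO_uniq a l l' : eulerO a l -> eulerO a l' -> l = l'.
Proof.
move=> h h'; apply/eqP; rewrite -subr_eq0; apply/eqP.
apply: (@val_ge_all_eq0 _ v) => n.
have [q [aq lq]] := h n; have [q' [aq' lq']] := h' n.
have /euler_ge : val_ge v n%:Z (pev f t (q - q')).
  have := val_geB vP aq' aq; rewrite rmorphB /=.
  by rewrite opprB addrC addrA subrK.
move/(val_geD vP (val_geB vP lq lq')).
rewrite eulerB rmorphB /=; congr val_ge; ring.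
Qed.

(** Polynomials approaching [a] have images under [euler] that form a Cauchy sequence, by
    [euler_ge]; its limit is the image of [a]. *)
Let eulerO_ex a : val_ge v 0 a -> exists l, eulerO a l.
Proof.
move=> ha; have /choice [q hq] : forall n : nat, exists q, val_ge v n%:Z (a - pev f t q).
  by move=> n; have [q _] := pev_approx vP n res vt ha; exists q.
have [l hl] : exists l, forall m : int, exists n0, forall i, (n0 <= i)%N ->
    val_ge v m (pev f t (euler (q i)) - l).
  apply: vK => m; exists (absz m) => i j mi mj.
  rewrite -rmorphB -eulerB.
  apply: (@val_ge_le _ _ (absz m)); first lia.
  apply: euler_ge; rewrite rmorphB /=.
  have -> : pev f t (q i) - pev f t (q j) = (a - pev f t (q j)) - (a - pev f t (q i)) by ring.
  by apply: (val_geB vP); [apply: val_ge_le (hq j)|apply: val_ge_le (hq i)]; lia.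
exists l => n; have [n0 h] := hl n%:Z; exists (q (maxn n n0)); split.
  by apply: val_ge_le (hq _); lia.
by rewrite -opprB; apply: (val_geN vP); apply: h; lia.
Qed.

Let eulerO_ge a l : eulerO a l -> val_ge v 0 a /\ val_ge v 0 l.
Proof.
move=> /(_ 0%N) [q [aq lq]].
by split; [rewrite -(subrK (pev f t q) a)|rewrite -(subrK (pev f t (euler q)) l)];
   apply: (val_geD vP) => //; apply: pev_ge0.
Qed.

Let eulerOD a l b m : eulerO a l -> eulerO b m -> eulerO (a + b) (l + m).
Proof.
move=> ha hb n; have [q [aq lq]] := ha n; have [r [br mr]] := hb n.
exists (q + r); rewrite eulerD !rmorphD /=; split.
  by have := val_geD vP aq br; congr val_ge; ring.
by have := val_geD vP lq mr; congr val_ge; ring.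
Qed.

Let eulerOM a l b m : eulerO a l -> eulerO b m -> eulerO (a * b) (a * m + b * l).
Proof.
move=> ha hb n; have [q [aq lq]] := ha n; have [r [br mr]] := hb n.
have [a0 l0] := eulerO_ge ha; have [b0 m0] := eulerO_ge hb.
have P0 := @pev_ge0 _ _ _ _ vP vf t _ ht.
exists (q * r); split.
  have -> : a * b - pev f t (q * r) = a * (b - pev f t r) + pev f t r * (a - pev f t q).
    by rewrite rmorphM /=; ring.
  by apply: (val_geD vP); apply: (val_ge0M vP).
have -> : a * m + b * l - pev f t (euler (q * r)) =
  a * (m - pev f t (euler r)) + pev f t (euler r) * (a - pev f t q)
  + (b * (l - pev f t (euler q)) + pev f t (euler q) * (b - pev f t r)).
  by rewrite /euler derivM mulrDr !rmorphD !rmorphM /= !pevX; ring.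
by apply: (val_geD vP); apply: (val_geD vP); apply: (val_ge0M vP).
Qed.

Let eulerO_cst c : eulerO (f c) 0.
Proof.
move=> n; exists c%:P; rewrite /euler derivC mulr0 pevC subrr (rmorph0 (pev f t)) subr0.
by split; left.
Qed.

Let eulerO_t : eulerO t t.
Proof.
by move=> n; exists 'X; rewrite /euler derivX mulr1 pevX subrr; split; left.
Qed.

Let eulerO_shift r a l : eulerO a l -> eulerO (t ^+ r * a) (t ^+ r * (l + a *+ r)).
Proof.
move=> h; elim: r => [|r IH]; first by rewrite !expr0 !mul1r mulr0n addr0.
have := eulerOM eulerO_t IH; rewrite mulrA -exprS.
by rewrite mulrS exprS; move: (t ^+ r) (a *+ r) => X Y; congr eulerO; ring.
Qed.

(** Extension to elements with a pole: [t ^+ m] clears the pole, and the Leibniz rule prescribes the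
    image of [t ^+ m * a]. *)
Let eulerK (a l : K) := exists m, eulerO (t ^+ m * a) (t ^+ m * (l + a *+ m)).

Let eulerK_shift a l m r : eulerO (t ^+ m * a) (t ^+ m * (l + a *+ m)) ->
  eulerO (t ^+ (r + m) * a) (t ^+ (r + m) * (l + a *+ (r + m))).
Proof.
move=> /(eulerO_shift r); rewrite mulrA -exprD.
rewrite exprD mulrnDr -(mulrnAr _ a r).
by move: (t ^+ m) (t ^+ r) (a *+ m) (a *+ r) => X Y M N; congr eulerO; ring.
Qed.

Let eulerK_uniq a l l' : eulerK a l -> eulerK a l' -> l = l'.
Proof.
move=> [m hm] [m' hm'].
have := eulerO_uniq (eulerK_shift m' hm).
rewrite addnC => /(_ _ (eulerK_shift m hm')) /mulfI.
by move=> /(_ (expf_neq0 _ t0)) /addIr.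
Qed.

Let eulerK_ex a : exists l, eulerK a l.
Proof.
have [l hl] : exists l, eulerO (t ^+ absz (v a) * a) l.
  apply: eulerO_ex; have [->|a0] := eqVneq a 0; first by rewrite mulr0; left.
  by right; rewrite (dvalM vP) ?expf_neq0 // (dvalX vP) // vt -mulr_natr; lia.
set m := absz (v a) in hl *; exists (l / t ^+ m - a *+ m), m.
by rewrite subrK [_ * (l / _)]mulrC divfK ?expf_neq0.
Qed.

Lemma exists_der_unif : exists D : K -> K,
  [/\ is_der f idfun D, D t = 1
    & forall a m, val_ge v m a -> val_ge v (m - 1) (D a)].
Proof.
have /choice [D hD] := eulerK_ex.
have DE a l : eulerK a l -> D a = l by apply: eulerK_uniq.
have DO a l : eulerO a l -> D a = l.
  by move=> h; apply: DE; exists 0%N; rewrite expr0 !mul1r mulr0n addr0.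
have DD a b : D (a + b) = D a + D b.
  apply: DE; have [m hm] := hD a; have [r hr] := hD b; exists (r + m)%N.
  have := eulerOD (eulerK_shift r hm) (eulerK_shift m hr).
  by rewrite [(m + r)%N]addnC -!mulrDr mulrnDl; congr eulerO; ring.
have DM a b : D (a * b) = a * D b + b * D a.
  apply: DE; have [m hm] := hD a; have [r hr] := hD b; exists (r + m)%N.
  have := eulerOM hm hr; rewrite exprD mulrnDr -(mulrnAr a b r) -(mulrnAl a b m).
  by move: (t ^+ m) (t ^+ r) (a *+ m) (b *+ r) => X Y M N; congr eulerO; ring.
have Dge a m : val_ge v m a -> val_ge v m (D a).
  move=> [->|ma]; first by rewrite -[X in D X](rmorph0 f) (DO _ _ (eulerO_cst 0)); left.
  have [n mn] : exists n : nat, m = n%:Z \/ m = - n%:Z by exists (absz m); lia.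
  have tn0 : t ^+ n != 0 by rewrite expf_neq0.
  have vtn : v (t ^+ n) = n%:Z by rewrite (dvalX vP) // vt -mulr_natr mul1r natz.
  case: mn => mE.
    have hb : val_ge v 0 (a / t ^+ n).
      by apply/(val_ge_div vP) => //; rewrite vtn add0r -mE; right.
    have [l hl] := eulerO_ex hb; have [_ l0] := eulerO_ge hl.
    have := eulerO_shift n hl; rewrite mulrC divfK // => /DO ->.
    rewrite -[m]addr0; apply: (val_geM vP); first by right; rewrite vtn mE.
    by apply: (val_geD vP) => //; apply: (val_ge_MnatR vP).
  have hb : val_ge v 0 (t ^+ n * a).
    rewrite mulrC; have := (val_ge_mulr vP m a tn0).1 (or_intror ma).
    by rewrite vtn mE addrC subrr.
  have [l hl] := eulerO_ex hb; have [_ l0] := eulerO_ge hl.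
  have := DO _ _ hl; rewrite DM.
  have -> : D (t ^+ n) = t ^+ n *+ n.
    apply: DO; have := eulerO_shift n (eulerO_cst 1).
    by rewrite rmorph1 mulr1 add0r mulr_natr.
  move=> Dl; have -> : D a = l / t ^+ n - a *+ n.
    by apply: (mulfI tn0); rewrite -Dl mulrBr [X in _ = X - _]mulrC divfK // !mulrnAr [a * _]mulrC addrK.
  apply: (val_geB vP); last by apply: (val_ge_MnatR vP); right.
  by apply/(val_ge_div vP) => //; rewrite vtn mE addrC subrr.
(* Dividing t d/dt by [t] gives d/dt; this accounts for the loss of one in the continuity bound. *)
exists (fun a => D a / t); split.
- split=> [x y|x y|c]; first by rewrite DD mulrDl.
    by rewrite DM mulrDl !mulrA.
  by rewrite (DO _ _ (eulerO_cst c)) mul0r.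
- by rewrite (DO _ _ eulerO_t) divff.
by move=> a m /Dge h; apply/(val_ge_div vP) => //; rewrite vt subrK.
Qed.

End ExistenceDerivation.

(** * Finite extensions of complete fields *)

(** The term of least valuation is unique, so it alone decides the valuation of the sum; a lower
    bound for the sum then bounds every term. *)
Lemma val_ge_sum_distinct (F : fieldType) (v : F -> int) (I : finType)
    (x : I -> F) (m : int) : is_dval v ->
  (forall i i', x i != 0 -> x i' != 0 -> v (x i) = v (x i') -> i = i') ->
  val_ge v m (\sum_i x i) -> forall i, val_ge v m (x i).
Proof.
move=> vP xI hs i; have [->|xi0] := eqVneq (x i) 0; first by left.
pose i1 := [arg min_(l < i | x l != 0) v (x l)]%O.
have [x10 xmin] : x i1 != 0 /\ forall l, x l != 0 -> v (x i1) <= v (x l).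
  by rewrite /i1; case: arg_minP => // l l0 lmin.
rewrite val_geE //; apply: le_trans (xmin _ xi0); move: hs.
rewrite (bigD1 i1) //=.
have [|s0 vs] := @val_gt_add _ _ vP (x i1) (\sum_(l | l != i1) x l) x10.
  apply: val_ge_sum => // l li; have [->|xl0] := eqVneq (x l) 0; first by left.
  right; have := xmin _ xl0; have : v (x i1) <> v (x l).
    by move=> /(xI _ _ x10 xl0) /esym /eqP; rewrite (negPf li).
  by lia.
by rewrite val_geE // vs.
Qed.

Lemma divz_rem_inj (a b : int) (i l e : nat) : (i < e)%N -> (l < e)%N ->
  a * e%:Z + i%:Z = b * e%:Z + l%:Z -> i = l.
Proof.
move=> ie le h; have [ab|ba|ab] := ltgtP a b; last by move: h; rewrite ab; lia.
  have : (a + 1) * e%:Z <= b * e%:Z by rewrite ler_wpM2r //; lia.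
  by rewrite mulrDl; lia.
have : (b + 1) * e%:Z <= a * e%:Z by rewrite ler_wpM2r //; lia.
by rewrite mulrDl; lia.
Qed.

Lemma divz_rem_le (a b : int) (i e : nat) : (i < e)%N ->
  a * e%:Z <= b * e%:Z + i%:Z -> a <= b.
Proof.
move=> ie h; rewrite leNgt; apply/negP => ba.
have : (b + 1) * e%:Z <= a * e%:Z by rewrite ler_wpM2r //; lia.
by rewrite mulrDl; lia.
Qed.

Lemma val_ge_ext (K L : fieldType) (j : {rmorphism K -> L}) (v : K -> int)
    (w : L -> int) (e : nat) (m : int) (a : K) :
  (forall a, w (j a) = v a *+ e) -> val_ge v m a -> val_ge w (m * e%:Z) (j a).
Proof.
move=> wj [->|h]; first by rewrite rmorph0; left.
by right; rewrite wj -mulr_natr natz ler_wpM2r.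
Qed.

(** * Power bases of totally ramified extensions *)

Section LocalExtension.
Variables (k K L : fieldType) (f : {rmorphism k -> K}) (j : {rmorphism K -> L}).
Variables (v : K -> int) (w : L -> int) (e : nat) (pi : L).
Hypotheses (vP : is_dval v) (wP : is_dval w) (vK : is_complete v).
Hypotheses (vf : forall c, v (f c) = 0) (e0 : (0 < e)%N).
Hypotheses (wj : forall a, w (j a) = v a *+ e).
Hypotheses (res : residue_cst w (j \o f)) (wpi : w pi = 1).

Let wjE a : w (j a) = v a * e%:Z. Proof. by rewrite wj -mulr_natr natz. Qed.
Let pi0 : pi != 0. Proof. by apply: (dval_neq0 wP); rewrite wpi. Qed.
Let pin0 i : pi ^+ i != 0. Proof. by rewrite expf_neq0. Qed.
Let wpin i : w (pi ^+ i) = i%:Z.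
Proof. by rewrite (dvalX wP) // wpi -mulr_natr mul1r natz. Qed.
Let wjpi a i : a != 0 -> w (j a * pi ^+ i) = v a * e%:Z + i%:Z.
Proof. by move=> a0; rewrite (dvalM wP) ?fmorph_eq0 // wjE wpin. Qed.

(** The nonzero terms have pairwise distinct valuations, as these are congruent to [i] modulo
    [e]. *)
Lemma ext_coord_ge (c : 'I_e -> K) (m : int) :
  val_ge w m (\sum_i j (c i) * pi ^+ i) -> forall i, val_ge w m (j (c i) * pi ^+ i).
Proof.
apply: val_ge_sum_distinct => // i i'.
rewrite !mulf_eq0 !negb_or !fmorph_eq0 => /andP[ci _] /andP[ci' _].
rewrite !wjpi // => h; apply: val_inj => /=.
exact: divz_rem_inj h.
Qed.

Lemma ext_coord_val (c : 'I_e -> K) (m : int) :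
  val_ge w (m * e%:Z) (\sum_i j (c i) * pi ^+ i) -> forall i, val_ge v m (c i).
Proof.
move=> h i; have [->|ci0] := eqVneq (c i) 0; first by left.
have := ext_coord_ge h i; rewrite val_geE ?mulf_neq0 ?fmorph_eq0 // wjpi //.
by move=> h'; right; apply: divz_rem_le h'.
Qed.

Lemma ext_coord_ge0 (c : 'I_e -> K) :
  val_ge w 0 (\sum_i j (c i) * pi ^+ i) -> forall i, val_ge v 0 (c i).
Proof. by move=> h; apply: ext_coord_val; rewrite mul0r. Qed.

Lemma ext_coord_eq0 (c : 'I_e -> K) :
  \sum_i j (c i) * pi ^+ i = 0 -> forall i, c i = 0.
Proof.
move=> h i; apply: (@val_ge_all_eq0 _ v) => n.
by apply: ext_coord_val; rewrite h; left.
Qed.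

(** The remainder is divided by [t ^+ n] and expanded up to [pi ^+ e]; the [e] coefficients found
    are the next [t]-adic digits of the [e] coordinates. *)
Let ext_approx z (n : nat) : val_ge w 0 z ->
  exists c : 'I_e -> K, val_ge w (n%:Z * e%:Z) (z - \sum_i j (c i) * pi ^+ i).
Proof.
move=> hz; have [t t0 vt] := dval_unif vP.
elim: n => [|n [c hc]].
  exists (fun _ => 0); rewrite mul0r big1 ?subr0 // => i _.
  by rewrite rmorph0 mul0r.
have jt0 : j (t ^+ n) != 0 by rewrite fmorph_eq0 expf_neq0.
have wtn : w (j (t ^+ n)) = n%:Z * e%:Z.
  by rewrite wjE (dvalX vP) // vt -mulr_natr mul1r natz.
have [|q qe hq] := @pev_approx _ _ w (j \o f) wP pi
    ((z - \sum_i j (c i) * pi ^+ i) / j (t ^+ n)) e res wpi.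
  by apply/(val_ge_div wP) => //; rewrite wtn add0r.
exists (fun i => c i + t ^+ n * f q`_i).
have := (val_ge_mulr wP e%:Z (_ - pev (j \o f) pi q) jt0).1 hq.
rewrite mulrBl divfK // (pevE _ _ qe) wtn.
rewrite -addrA -opprD mulr_suml -big_split /=.
congr val_ge.
congr (_ - _); apply: eq_bigr => i _; rewrite rmorphD rmorphM /=; ring.
Qed.

(** By [ext_coord_val] the coordinates of the approximations are Cauchy sequences in the complete
    field [K]; their limits are the coordinates of [z]. *)
Lemma ext_span z : exists c : 'I_e -> K, z = \sum_i j (c i) * pi ^+ i.
Proof.
have [t t0 vt] := dval_unif vP.
suff int_span y : val_ge w 0 y -> exists c : 'I_e -> K, y = \sum_i j (c i) * pi ^+ i.
  pose n := absz (w z); have tn0 : t ^+ n != 0 by rewrite expf_neq0.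
  have [|c hc] := int_span (j (t ^+ n) * z).
    have [->|z0] := eqVneq z 0; first by rewrite mulr0; left.
    right; rewrite (dvalM wP) ?fmorph_eq0 // wjE (dvalX vP) // vt -mulr_natr mul1r natz.
    by rewrite /n; nia.
  exists (fun i => c i / t ^+ n); have jtn0 : j (t ^+ n) != 0 by rewrite fmorph_eq0.
  apply: (mulfI jtn0); rewrite hc mulr_sumr; apply: eq_bigr => i _.
  by rewrite mulrA -rmorphM mulrC /= mulrCA divff // mulr1 mulrC.
move=> hy; have /choice [c hc] := fun n => ext_approx n hy.
have cv i : exists a, forall m : int, exists n0, forall n, (n0 <= n)%N ->
    val_ge v m (c n i - a).
  apply: vK => m; exists (absz m) => n n' mn mn'.
  apply: (@val_ge_le _ _ (absz m)%:Z); first lia.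
  apply: (@ext_coord_val (fun i => c n i - c n' i)).
  have -> : \sum_i j (c n i - c n' i) * pi ^+ i =
    (y - \sum_i j (c n' i) * pi ^+ i) - (y - \sum_i j (c n i) * pi ^+ i).
    rewrite opprB addrC addrA subrK -sumrB; apply: eq_bigr => l _.
    by rewrite rmorphB /= mulrBl.
  by apply: (val_geB wP); [apply: val_ge_le (hc n')|apply: val_ge_le (hc n)]; nia.
have [a ha] := choice cv; exists a; apply/eqP; rewrite -subr_eq0; apply/eqP.
apply: (@val_ge_all_eq0 _ w) => m.
have [n0 hn0] := choice (fun i => ha i m%:Z).
pose n := (m + \sum_i n0 i)%N.
have -> : y - \sum_i j (a i) * pi ^+ i =
   (y - \sum_i j (c n i) * pi ^+ i) + \sum_i j (c n i - a i) * pi ^+ i.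
  under [X in _ = _ + X]eq_bigr do rewrite rmorphB mulrBl /=.
  by rewrite sumrB addrA subrK.
apply: (val_geD wP); first by apply: val_ge_le (hc n); rewrite /n; nia.
apply: (val_ge_sum wP) => i _; apply: (val_geM0 wP); last by right; rewrite wpin.
have h : (n0 i <= n)%N by rewrite /n (bigD1 i) //=; lia.
by apply: val_ge_le (val_ge_ext wj (hn0 i n h)); nia.
Qed.

Lemma ext_basis : is_ext_basis j (fun i : 'I_e => pi ^+ i).
Proof.
move=> y; have [c ->] := ext_span y; exists (\row_i c i); split.
  by apply: eq_bigr => i _; rewrite mxE.
move=> c' h; apply/rowP => i; rewrite mxE.
apply/eqP; rewrite -subr_eq0; apply/eqP.
apply: (@ext_coord_eq0 (fun i => c i - c' 0 i)).
under eq_bigr do rewrite rmorphB mulrBl /=.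
by rewrite sumrB h subrr.
Qed.

Lemma ext_complete : is_complete w.
Proof.
move=> u hu; have [c hc] := choice (fun n => ext_span (u n)).
have cv i : exists a, forall m : int, exists n0, forall n, (n0 <= n)%N ->
    val_ge v m (c n i - a).
  apply: vK => m; have [n0 hn0] := hu (m * e%:Z); exists n0 => n n' hn hn'.
  apply: (@ext_coord_val (fun i => c n i - c n' i)).
  have := hn0 n n' hn hn'; rewrite (hc n) (hc n') -sumrB.
  by congr val_ge; apply: eq_bigr => l _; rewrite rmorphB /= mulrBl.
have [a ha] := choice cv; exists (\sum_i j (a i) * pi ^+ i) => m.
have [n0 hn0] := choice (fun i => ha i (absz m)%:Z).
exists (\sum_i n0 i)%N => n hn; rewrite (hc n) -sumrB.
apply: (val_ge_sum wP) => i _; rewrite -mulrBl -rmorphB.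
apply: (val_geM0 wP); last by right; rewrite wpin.
have h : (n0 i <= n)%N by apply: leq_trans hn; rewrite (bigD1 i) //=; lia.
by apply: val_ge_le (val_ge_ext wj (hn0 i n h)); nia.
Qed.

End LocalExtension.

(** * Residue fields of algebraic extensions *)

Section ResidueExtension.
Variables (k : closedFieldType).

(** The polynomial splits over [k]; a product of integral factors z - c has positive valuation only
    if one of them does. *)
Lemma residue_root (L : fieldType) (g : {rmorphism k -> L}) (w : L -> int) (z : L)
    (q : {poly k}) : is_dval w -> (forall c, w (g c) = 0) -> val_ge w 0 z ->
  q != 0 -> val_ge w 1 (pev g z q) -> exists c, val_ge w 1 (z - g c).
Proof.
move=> wP wg hz q0; have [r ->] := closed_field_poly_normal q.
rewrite pevZ => h; have {h} : val_ge w 1 (pev g z (\prod_(c <- r) ('X - c%:P))).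
  have l0 : g (lead_coef q) != 0 by rewrite fmorph_eq0 lead_coef_eq0.
  by apply/(val_ge_mulr wP 1 _ l0); rewrite wg addr0 mulrC.
elim: r => [|c r IH].
  rewrite big_nil rmorph1; case=> [/eqP|]; first by rewrite oner_eq0.
  by rewrite (dval1 wP).
rewrite big_cons rmorphM rmorphB /= pevX pevC.
have hzc : val_ge w 0 (z - g c) by apply: (val_geB wP) => //; right; rewrite wg.
have [z1|z1] := pselect (val_ge w 1 (z - g c)); first by exists c.
have zc0 : z - g c != 0 by apply/eqP => z0; apply: z1; left.
have wzc : w (z - g c) = 0.
  move: hzc; rewrite val_geE // => h0.
  have : ~ (1 <= w (z - g c)) by move=> h1; apply: z1; right.
  by lia.
by move=> h; apply: IH; apply/(val_ge_mulr wP 1 _ zc0); rewrite wzc addr0 mulrC.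
Qed.

(** The equation of [z] is divided by a coefficient of least valuation. Its coefficients then have
    residues in [k], one of them nonzero, and the reduced polynomial takes a value of positive
    valuation at [z]. *)
Lemma residue_algebraic (K L : fieldType) (f : {rmorphism k -> K}) (j : {rmorphism K -> L})
    (v : K -> int) (w : L -> int) : is_dval v -> is_dval w -> val_ext v w j ->
  (forall c, v (f c) = 0) -> residue_cst v f ->
  (forall z, exists2 p : {poly K}, p != 0 & root (map_poly j p) z) ->
  residue_cst w (j \o f).
Proof.
move=> vP wP [e e0 wj] vf res alg z hz.
have [p p0 rp] := alg z.
have wjf c : w ((j \o f) c) = 0 by rewrite /= wj vf mul0rn.
have n0 : ((size p).-1 < size p)%N by rewrite prednK // size_poly_gt0.
pose i1 := [arg min_(i < Ordinal n0 | p`_i != 0) v p`_i]%O.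
have [pi0 pmin] : p`_i1 != 0 /\ forall i : 'I_(size p), p`_i != 0 -> v p`_i1 <= v p`_i.
  by rewrite /i1; case: arg_minP => [|i i0 imin]; first by rewrite -lead_coefE lead_coef_eq0.
have /choice [c hc] : forall i : 'I_(size p), exists c, val_ge v 1 (p`_i / p`_i1 - f c).
  move=> i; apply: res; apply/(val_ge_div vP) => //; rewrite add0r.
  have [->|/pmin] := eqVneq p`_i 0; [by left|by right].
have c1 : c i1 != 0.
  apply/eqP => c0; have := hc i1; rewrite c0 rmorph0 subr0 divff //.
  by case=> [/eqP|]; rewrite ?oner_eq0 ?(dval1 vP).
pose c' (l : nat) := if insub l is Some i then c i else 0.
have c'E (i : 'I_(size p)) : c' i = c i by rewrite /c' valK.
apply: (@residue_root _ _ _ _ (\poly_(l < size p) c' l)) => //.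
  apply/eqP => /polyP /(_ i1); rewrite coef_poly ltn_ord c'E coef0.
  by apply/eqP.
rewrite (pevE _ _ (size_poly _ _)).
have -> : \sum_(i < size p) (j \o f) (\poly_(l < size p) c' l)`_i * z ^+ i =
  - \sum_(i < size p) j (p`_i / p`_i1 - f (c i)) * z ^+ i.
  have : \sum_(i < size p) j (p`_i / p`_i1) * z ^+ i = 0.
    move: rp; rewrite /root -/(pev j z p) (pevE _ _ (leqnn _)) => /eqP h.
    apply: (@mulfI _ (j p`_i1)); first by rewrite fmorph_eq0.
    rewrite mulr0 -[RHS]h mulr_sumr; apply: eq_bigr => i _.
    by rewrite mulrA -rmorphM mulrC /= mulrC mulrCA divff // mulr1.
  move=> h; apply/eqP; rewrite -addr_eq0; apply/eqP; rewrite -[RHS]h -big_split.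
  by apply: eq_bigr => i _; rewrite coef_poly ltn_ord c'E /= rmorphB /=; ring.
apply: (val_geN wP); apply: (val_ge_sum wP) => i _.
apply: (val_geM0 wP); last exact: val_ge0X.
apply: val_ge_le (val_ge_ext wj (hc i)); lia.
Qed.

End ResidueExtension.

(** * Traces and differents *)

Section BaseChange.
Variables (K L : fieldType) (j : {rmorphism K -> L}).

Lemma ext_basis_inj n m (b : 'I_n -> L) (A B : 'M[K]_(m, n)) : is_ext_basis j b ->
  (forall i, \sum_l j (A i l) * b l = \sum_l j (B i l) * b l) -> A = B.
Proof.
move=> bP AB; apply/row_matrixP => i; have [c [_ cu]] := bP (\sum_l j (A i l) * b l).
rewrite -(cu (row i A)); last by apply: eq_bigr => l _; rewrite mxE.
rewrite -(cu (row i B)) // AB; by apply: eq_bigr => l _; rewrite mxE.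
Qed.

Lemma ext_basis_coord n (b : 'I_n -> L) m (y : 'I_m -> L) : is_ext_basis j b ->
  exists P : 'M[K]_(m, n), forall i, y i = \sum_l j (P i l) * b l.
Proof.
move=> bP; have /choice [c hc] : forall i, exists c : 'rV_n, y i = \sum_l j (c 0 l) * b l.
  by move=> i; have [c [h _]] := bP (y i); exists c.
exists (\matrix_i c i) => i; rewrite {1}hc.
by apply: eq_bigr => l _; rewrite mxE.
Qed.

Lemma ext_comb_mulmx m n p (b : 'I_n -> L) (y : 'I_p -> L) (P : 'M[K]_(p, n))
    (A : 'M[K]_(m, p)) i : (forall i, y i = \sum_l j (P i l) * b l) ->
  \sum_l j (A i l) * y l = \sum_l j ((A *m P) i l) * b l.
Proof.
move=> yE; under eq_bigr do rewrite yE mulr_sumr.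
rewrite exchange_big /=; apply: eq_bigr => l _.
by rewrite mxE rmorph_sum mulr_suml; apply: eq_bigr => l' _; rewrite rmorphM mulrA.
Qed.

Lemma ext_comb1 n (b : 'I_n -> L) i : \sum_l j ((1%:M : 'M[K]_n) i l) * b l = b i.
Proof.
rewrite (bigD1 i) //= mxE eqxx rmorph1 mul1r big1 ?addr0 // => l li.
by rewrite mxE eq_sym (negPf li) rmorph0 mul0r.
Qed.

Lemma ext_basis_change n m (b : 'I_n -> L) (b' : 'I_m -> L) (P : 'M[K]_(n, m))
    (Q : 'M[K]_(m, n)) : is_ext_basis j b ->
  (forall i, b i = \sum_l j (P i l) * b' l) ->
  (forall i, b' i = \sum_l j (Q i l) * b l) -> P *m Q = 1%:M.
Proof.
move=> bP PE QE; apply: (ext_basis_inj bP) => i.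
by rewrite ext_comb1 -(ext_comb_mulmx _ _ QE) -PE.
Qed.

(** The matrices expressing two bases in each other satisfy P Q = 1, which forces one inequality;
    symmetry gives the other. The chosen value [ext_degree] is thus well defined. *)
Lemma ext_has_degree_uniq n m : ext_has_degree j n -> ext_has_degree j m -> n = m.
Proof.
have le p q : ext_has_degree j p -> ext_has_degree j q -> (p <= q)%N.
  move=> [b bP] [b' b'P].
  have [P PE] := ext_basis_coord b b'P; have [Q QE] := ext_basis_coord b' bP.
  exact: mulmx1_min (ext_basis_change bP PE QE).
by move=> hn hm; apply/eqP; rewrite eqn_leq !le.
Qed.

Lemma ext_degreeE n : ext_has_degree j n -> ext_degree j = n.
Proof.
move=> h; apply: (@ext_has_degree_uniq _ n) => //.
by rewrite /ext_degree; apply: xgetPex; exists n.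
Qed.

(** The matrices of multiplication by [a] in two bases are related by A' = Q A P with P Q = 1, so
    their traces agree. *)
Lemma is_ext_trace_uniq a t t' : is_ext_trace j a t -> is_ext_trace j a t' -> t = t'.
Proof.
move=> [n [b [A [bP AE ->]]]] [m [b' [A' [b'P A'E ->]]]].
have [P PE] := ext_basis_coord b b'P; have [Q QE] := ext_basis_coord b' bP.
have PQ := ext_basis_change bP PE QE.
have -> : A' = Q *m A *m P.
  apply: (ext_basis_inj b'P) => i; rewrite -A'E QE mulr_sumr.
  rewrite -(ext_comb_mulmx _ _ PE) -(@ext_comb_mulmx _ _ _ _ (fun i => a * b i)) //.
  by apply: eq_bigr => l _; rewrite mulrCA.
by rewrite mxtrace_mulC mulmxA PQ mul1mx.
Qed.

Lemma ext_traceE a t : is_ext_trace j a t -> ext_trace j a = t.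
Proof.
move=> h; apply: (@is_ext_trace_uniq a) => //.
by rewrite /ext_trace; apply: xgetPex; exists t.
Qed.

End BaseChange.

(* Euler's formula: the trace is [x |-> lambda (phi'(pi) * x)], where [lambda]
   is the coordinate on the last power of [pi]; the dual basis of the powers of
   [pi] for [lambda (x * y)] consists of the coefficients of
   [phi(X) / (X - pi)]. *)
Section EulerTrace.
Variables (K L : fieldType) (j : {rmorphism K -> L}) (e : nat) (pi : L).
Hypotheses (e0 : (0 < e)%N) (bP : is_ext_basis j (fun i : 'I_e => pi ^+ i)).
Variables (phi : {poly K}).
Hypotheses (sphi : size phi = e.+1) (mphi : phi \is monic) (rphi : pev j pi phi = 0).

Lemma power_basis_inj (q : {poly K}) : (size q <= e)%N -> pev j pi q = 0 -> q = 0.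
Proof.
move=> qe q0; have [c [_ cu]] := bP 0.
apply/polyP => i; rewrite coef0; have [ie|ie] := ltnP i e; last first.
  by rewrite nth_default // (leq_trans qe).
have c0 : c = 0 by apply: cu; rewrite big1 // => l _; rewrite mxE rmorph0 mul0r.
have : c = \row_(l < e) q`_l.
  by apply: cu; rewrite -[LHS]q0 (pevE _ _ qe); apply: eq_bigr => l _; rewrite mxE.
by rewrite c0 => /rowP /(_ (Ordinal ie)); rewrite !mxE => <-.
Qed.

Lemma power_basis_coord : exists cp : L -> {poly K},
  forall z, (size (cp z) <= e)%N /\ pev j pi (cp z) = z.
Proof.
suff /choice [cp cpP] : forall z, exists q : {poly K}, (size q <= e)%N /\ pev j pi q = z.
  by exists cp.
move=> z; have [c [-> _]] := bP z; exists (\poly_(i < e) (if insub i is Some l then c 0 l else 0)).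
split; first exact: size_poly.
rewrite (pevE _ _ (size_poly _ _)); apply: eq_bigr => i _.
by rewrite coef_poly ltn_ord valK.
Qed.

Variable cp : L -> {poly K}.
Hypothesis cpP : forall z, (size (cp z) <= e)%N /\ pev j pi (cp z) = z.

Let cp_size z : (size (cp z) <= e)%N. Proof. by case: (cpP z). Qed.
Let cpE z : pev j pi (cp z) = z. Proof. by case: (cpP z). Qed.

Lemma cp_pev (q : {poly K}) : (size q <= e)%N -> cp (pev j pi q) = q.
Proof.
move=> qe; apply/eqP; rewrite -subr_eq0; apply/eqP/power_basis_inj.
  by rewrite (leq_trans (size_polyD _ _)) // size_polyN geq_max cp_size.
by rewrite rmorphB /= cpE subrr.
Qed.

Lemma cpD x y : cp (x + y) = cp x + cp y.
Proof.
rewrite -{1}(cpE x) -{1}(cpE y) -rmorphD cp_pev //.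
by rewrite (leq_trans (size_polyD _ _)) // geq_max !cp_size.
Qed.

Lemma cpZ a x : cp (j a * x) = a *: cp x.
Proof.
rewrite -{1}(cpE x) -pevZ cp_pev //.
by rewrite (leq_trans (size_scale_leq _ _)).
Qed.

Let lam z := (cp z)`_e.-1.

Let lamD x y : lam (x + y) = lam x + lam y.
Proof. by rewrite /lam cpD coefD. Qed.
Let lamZ a x : lam (j a * x) = a * lam x.
Proof. by rewrite /lam cpZ coefZ. Qed.
Let lam0 : lam 0 = 0.
Proof. by rewrite -(mul0r 0) -(rmorph0 j) lamZ mul0r. Qed.
Let lam_sum (I : Type) (r : seq I) (P : pred I) (F : I -> L) :
  lam (\sum_(x <- r | P x) F x) = \sum_(x <- r | P x) lam (F x).
Proof. exact: (big_morph lam lamD lam0). Qed.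

Definition euler_dual l := pev j pi (drop_poly l.+1 phi).

Lemma euler_dualP i l : (i < e)%N -> (l < e)%N ->
  lam (pi ^+ i * euler_dual l) = (i == l)%:R.
Proof.
move=> ie le; have [il|li] := leqP i l.
  rewrite /euler_dual -(pevXn j) -rmorphM /lam cp_pev; last first.
    rewrite (leq_trans (size_polyMleq _ _)) // size_polyXn size_drop_poly sphi; lia.
  rewrite coefXnM ltnNge -ltnS prednK // ie /= coef_drop_poly.
  have [->|ne] := eqVneq i l.
    have -> : (e.-1 - l + l.+1)%N = e by lia.
    by move: mphi; rewrite monicE lead_coefE sphi => /eqP.
  by rewrite nth_default // sphi; move: ne; lia.
(* For i > l the product has too high a degree in [pi]; the equation phi(pi) = 0 replaces the upper
   part of [phi] by minus its lower part, which leaves degree at most i - 1 < e - 1. *)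
have -> : pi ^+ i * euler_dual l = pev j pi (- ('X^(i - l.+1) * take_poly l.+1 phi)).
  rewrite rmorphN rmorphM /= pevXn.
  have := rphi; rewrite -{1}(poly_take_drop l.+1 phi) rmorphD rmorphM /= pevXn.
  move=> /eqP; rewrite addr_eq0 => /eqP ->; rewrite mulrN opprK mulrCA -exprD.
  by rewrite subnK // mulrC.
rewrite /lam cp_pev; last first.
  rewrite size_polyN (leq_trans (size_polyMleq _ _)) // size_polyXn.
  have := size_take_poly l.+1 phi; move: (size (take_poly l.+1 phi)) => s; lia.
rewrite coefN coefXnM coef_take_poly (gtn_eqF li).
case: ltnP => _; first by rewrite oppr0.
by rewrite ltnNge (_ : (l < e.-1 - (i - l.+1))%N) ?oppr0 //; lia.
Qed.

Lemma euler_coord y l : (l < e)%N -> (cp y)`_l = lam (y * euler_dual l).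
Proof.
move=> le; rewrite -{2}(cpE y) (pevE _ _ (cp_size y)) mulr_suml lam_sum.
rewrite (bigD1 (Ordinal le)) //= -mulrA lamZ euler_dualP // eqxx mulr1.
rewrite big1 ?addr0 // => i; rewrite -val_eqE /= => il.
by rewrite -mulrA lamZ euler_dualP // (negPf il) mulr0.
Qed.

Lemma euler_trace z : ext_trace j z = lam (z * pev j pi phi^`()).
Proof.
apply: ext_traceE; exists e, (fun i : 'I_e => pi ^+ i).
exists (\matrix_(i, l) (cp (z * pi ^+ i))`_l); split=> //.
  move=> i; rewrite -{1}(cpE (z * pi ^+ i)) (pevE _ _ (cp_size _)).
  by apply: eq_bigr => l _; rewrite mxE.
have -> : pev j pi phi^`() = \sum_(i < e) pi ^+ i * euler_dual i.
  (* In degree m, exactly the m + 1 summands with i <= m contribute, each the coefficient of [phi]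
     of index m + 1. *)
  have -> : phi^`() = \sum_(i < e) 'X^i * drop_poly i.+1 phi.
    apply/polyP => m; rewrite coef_deriv coef_sum.
    pose g i := ('X^i * drop_poly i.+1 phi)`_m.
    have gE i : g i = if (m < i)%N then 0 else phi`_m.+1.
      by rewrite /g coefXnM coef_drop_poly; case: ltnP => // im; congr (_`__); lia.
    rewrite -(big_mkord xpredT g); have [me|em] := ltnP m e; last first.
      rewrite nth_default ?sphi // mul0rn big_nat big1 // => i /andP [_ ie].
      by rewrite gE; case: ifP => // _; rewrite nth_default // sphi.
    rewrite (@big_cat_nat _ _ _ m.+1) //= [X in _ + X]big_nat [X in _ + X]big1; last first.
      by move=> i /andP [im _]; rewrite gE im.
    rewrite addr0 big_nat (eq_bigr (fun=> phi`_m.+1)); last first.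
      by move=> i /andP [_ im]; rewrite gE ltnNge -ltnS im.
    by rewrite -big_nat sumr_const_nat subn0.
  by rewrite rmorph_sum; apply: eq_bigr => i _; rewrite rmorphM /= pevXn.
rewrite mulr_sumr lam_sum; apply: eq_bigr => i _.
by rewrite mxE euler_coord // mulrA.
Qed.

End EulerTrace.

(** Applying [D] to p(y) = 0 gives p'(y) D(y) = 0, and p'(y) is nonzero by separability. *)
Lemma separable_der_eq0 (K L M : fieldType) (j : {rmorphism K -> L})
    (i : {rmorphism L -> M}) (D : L -> M) : is_der j i D -> separable_ext j ->
  forall y, D y = 0.
Proof.
move=> DP sep y; have [p sp rp] := sep y.
have cp : coprimep (map_poly j p) (map_poly j p)^`() 
  by rewrite deriv_map coprimep_map; move: sp; rewrite unlock.
have := der_pev DP y p; rewrite {1}/pev (eqP rp) (der0 DP) => /esym /eqP.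
rewrite mulf_eq0 fmorph_eq0 /pev -deriv_map (negPf (coprimep_root cp rp)).
by move=> /eqP.
Qed.

Lemma der_pev_coef (k K L : fieldType) (g : {rmorphism k -> L}) (j : {rmorphism K -> L})
    (D : L -> L) (x : L) (q : {poly K}) n : is_der g idfun D -> (size q <= n.+1)%N ->
  D (pev j x q) = \sum_(i < n.+1) D (j q`_i) * x ^+ i + pev j x q^`() * D x.
Proof.
move=> DP qn; rewrite (pevE _ _ qn) (der_sum DP).
have q'n : (size q^`() <= n)%N by rewrite (leq_trans (size_poly _ _)) // -ltnS; lia.
rewrite (pevE _ _ q'n) mulr_suml.
transitivity (\sum_(i < n.+1) D (j q`_i) * x ^+ i +
              \sum_(i < n.+1) j q`_i * (x ^+ i.-1 * D x *+ i)).
  rewrite -big_split /=; apply: eq_bigr => i _.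
  by rewrite (derM DP) (derXn DP) /=; ring.
congr (_ + _); rewrite big_ord_recl /= mulr0n mulr0 add0r.
by apply: eq_bigr => i _; rewrite coef_deriv rmorphMn /= !mulrnAl mulrnAr mulrA.
Qed.

(** * Change of uniformizer and the chain rule *)

Section UniformizerDerivation.
Variables (k K M : fieldType) (f : {rmorphism k -> K}) (i : {rmorphism K -> M}).
Variables (v : K -> int) (w : M -> int) (e : nat) (t : K) (DK : K -> K).
Hypotheses (vP : is_dval v) (wP : is_dval w).
Hypotheses (vf : forall c, v (f c) = 0) (res : residue_cst v f).
Hypotheses (DKP : is_der f idfun DK) (vt : v t = 1) (DKt : DK t = 1).
Hypothesis DKc : forall a m, val_ge v m a -> val_ge v (m - 1) (DK a).

(** The continuity bound alone gives -1; subtracting the residue of [a], a constant killed by [DK],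
    gains the missing unit. *)
Lemma der_unif_ge0 a : val_ge v 0 a -> val_ge v 0 (DK a).
Proof.
move=> /res [c hc]; rewrite -(subr0 (DK a)) -(der_cst DKP c) -(derB DKP).
exact: DKc hc.
Qed.

(** Up to order 2, [s] is c t with c a nonzero constant, so its derivative has residue c. *)
Lemma der_unif_val s : v s = 1 -> DK s != 0 /\ v (DK s) = 0.
Proof.
move=> vs; have t0 : t != 0 by apply: (dval_neq0 vP); rewrite vt.
have s0 : s != 0 by apply: (dval_neq0 vP); rewrite vs.
have [|c hc] := res (z := s / t).
  by apply/(val_ge_div vP) => //; rewrite vt add0r; right; rewrite vs.
have hs : val_ge v 2 (s - f c * t).
  by have := (val_ge_mulr vP 1 _ t0).1 hc; rewrite mulrBl divfK // vt.
have c0 : c != 0.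
  apply/eqP => c0; move: hs; rewrite c0 rmorph0 mul0r subr0 val_geE // vs; lia.
have := DKc hs; rewrite (derB DKP) (derM DKP) (der_cst DKP) DKt /= mulr0 addr0 mulr1.
have fc0 : f c != 0 by rewrite fmorph_eq0.
move=> h; have := @val_gt_add _ _ vP (f c) (DK s - f c) fc0.
by rewrite [f c + _]addrC subrK vf; apply; apply: val_ge_le h.
Qed.

(** The difference of the two sides is a continuous derivation that kills [t]. *)
Lemma continuous_der_unif (D : K -> M) (B : int) : (0 < e)%N -> is_der f i D ->
  (forall a m, val_ge v m a -> val_ge w (m *+ e - B) (D a)) ->
  (forall a, w (i a) = v a *+ e) ->
  forall a, D a = i (DK a) * D t.
Proof.
move=> e0 DP Dc wi a; apply/eqP; rewrite -subr_eq0; apply/eqP.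
pose D' a := D a - i (DK a) * D t.
suff : D' a = 0 by [].
(* The new bound adds up the possible losses: [B] for [D], [e] for the loss of one under [DK], and
   the value of the factor [D t]. *)
move: a; apply: (@continuous_der_eq0 _ _ _ f i v w e vP res e0 D' (absz B + e + absz (w (D t)))%N t) => //.
- split=> [x y|x y|c]; rewrite /D'.
  + by rewrite (derD DP) (derD DKP) rmorphD /=; ring.
  + by rewrite (derM DP) (derM DKP) rmorphD !rmorphM /=; ring.
  + by rewrite (der_cst DP) (der_cst DKP) rmorph0 mul0r subr0.
- move=> b m hb; rewrite /D'; apply: (val_geB wP).
    by apply: val_ge_le (Dc _ _ hb); lia.
  have h := val_geM wP (val_ge_ext wi (DKc hb)) (val_gexx w (D t)).
  by apply: val_ge_le h; rewrite -mulr_natr natz; lia.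
by rewrite /D' DKt rmorph1 mul1r subrr.
Qed.

End UniformizerDerivation.

(** * The different exponent as the order of dt/dpi *)

Section LocalDifferent.
Variables (k K L : fieldType) (f : {rmorphism k -> K}) (j : {rmorphism K -> L}).
Variables (v : K -> int) (w : L -> int) (e : nat) (pi : L).
Hypotheses (vP : is_dval v) (wP : is_dval w) (vK : is_complete v).
Hypotheses (vf : forall c, v (f c) = 0) (e0 : (0 < e)%N).
Hypotheses (wj : forall a, w (j a) = v a *+ e).
Hypotheses (resL : residue_cst w (j \o f)) (wpi : w pi = 1).

Let bP := ext_basis vP wP vK e0 wj resL wpi.
Let pi0 : pi != 0. Proof. by apply: (dval_neq0 wP); rewrite wpi. Qed.
Let hpi : val_ge w 0 pi. Proof. by right; rewrite wpi. Qed.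

Lemma pev_integral (q : {poly K}) : (forall i, val_ge v 0 q`_i) -> val_ge w 0 (pev j pi q).
Proof.
move=> hq; rewrite (pevE _ _ (leqnn _)); apply: (val_ge_sum wP) => i _.
apply: (val_ge0M wP); last exact: val_ge0X.
by have := val_ge_ext wj (hq i); rewrite mul0r.
Qed.

(** In the expansion of [pi ^+ e] every term has valuation at least [e], which forces all
    coefficients to have positive valuation. If the constant one had valuation at least 2, all terms
    would exceed [e]. *)
Lemma eisenstein : exists A : {poly K}, [/\ (size A <= e)%N, pev j pi A = pi ^+ e,
  forall i, val_ge v 1 A`_i & v A`_0 = 1].
Proof.
have [cp cpP] := power_basis_coord bP.
have [sA AE] := cpP (pi ^+ e); set A := cp _ in sA AE.
have wpin i : w (pi ^+ i) = i%:Z by rewrite (dvalX wP) // wpi -mulr_natr mul1r natz.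
have hA (i : 'I_e) : val_ge w e%:Z (j A`_i * pi ^+ i).
  apply: (ext_coord_ge wP wj wpi (c := fun i : 'I_e => A`_i)); rewrite -(pevE _ _ sA) AE.
  by right; rewrite wpin.
have hA1 (i : nat) : val_ge v 1 A`_i.
  have [ie|ie] := ltnP i e; last by rewrite nth_default ?(leq_trans sA) //; left.
  have [->|Ai0] := eqVneq A`_i 0; first by left.
  have := hA (Ordinal ie); rewrite /= val_geE ?mulf_neq0 ?fmorph_eq0 ?expf_neq0 //.
  rewrite (dvalM wP) ?fmorph_eq0 ?expf_neq0 // wpin wj -mulr_natr natz => h.
  by right; apply: (divz_rem_le ie); rewrite mul1r.
exists A; split=> //; apply/eqP/negPn/negP => /eqP A01.
have hA0 : val_ge v 2 A`_0 by case: (hA1 0%N) => [->|h]; [left|right; lia].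
have : val_ge w (e%:Z + 1) (pi ^+ e).
  rewrite -AE (pevE _ _ sA); apply: (val_ge_sum wP) => i _.
  have h := val_geM wP (val_ge_ext wj (hA1 i)) (val_gexx w (pi ^+ i)).
  have [i0|i0] := posnP i; last by apply: val_ge_le h; rewrite wpin; lia.
  rewrite i0 expr0 mulr1; apply: val_ge_le (val_ge_ext wj hA0); lia.
by rewrite val_geE ?expf_neq0 // wpin; lia.
Qed.

Variables (D : L -> L) (t : K).
Hypotheses (resK : residue_cst v f).
Hypotheses (DP : is_der (j \o f) idfun D) (Dpi : D pi = 1).
Hypothesis Dc : forall a m, val_ge w m a -> val_ge w (m - 1) (D a).
Hypotheses (vt : v t = 1) (Dt : D (j t) != 0).

(** Differentiating the Eisenstein equation shows that phi'(pi) has the valuation of the derivative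
    of [A]_0[. Since]A[_0] is a uniformizer of [K], so does dt/dpi. By Euler's formula the
    codifferent is generated by the inverse of phi'(pi). *)
Lemma dr_der : dr v w j = w (D (j t)).
Proof.
have [A [sA AE hA vA0]] := eisenstein.
have [DK [DKP DKA0 DKc]] := exists_der_unif vP vK resK vf vA0.
have DjP := der_comp DP.
have DjE a : D (j a) = j (DK a) * D (j A`_0).
  apply: (continuous_der_unif vP wP resK DKP vA0 DKA0 DKc e0 DjP) wj a => a m.
  by move=> /(val_ge_ext wj) /Dc; rewrite -mulr_natr natz; apply.
set T := D (j A`_0) in DjE.
have T0 : T != 0 by apply: contraNneq Dt => T0; rewrite DjE T0 mulr0.
have [DKt0 vDKt] := der_unif_val vP vf resK DKP vA0 DKA0 DKc vt.
have -> : w (D (j t)) = w T.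
  by rewrite DjE (dvalM wP) ?fmorph_eq0 // wj vDKt mul0rn add0r.
pose phi := 'X^e - A.
have sphi : size phi = e.+1.
  by rewrite size_polyDl ?size_polyXn // size_polyN ltnS.
have mphi : phi \is monic.
  by rewrite monicE lead_coefDl ?lead_coefXn // size_polyN size_polyXn ltnS.
have rphi : pev j pi phi = 0 by rewrite rmorphB /= pevXn AE subrr.
have phi_int i : val_ge v 0 phi`_i.
  rewrite coefB coefXn; apply: (val_geB vP).
    by case: eqP => _; [right; rewrite (dval1 vP)|left].
  exact: val_ge_le (hA i).
set fp := pev j pi phi^`().
have [fp0 wfp] : fp != 0 /\ w fp = w T.
  have fpE : fp = T * \sum_(i < e) j (DK A`_i) * pi ^+ i.
    have := der_pev_coef j pi DP (n := e); rewrite -sphi => /(_ phi (leqnn _)).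
    rewrite rphi (der0 DP) Dpi mulr1 sphi => /esym /eqP.
    rewrite addrC addr_eq0 /fp => /eqP ->; rewrite big_ord_recr /=.
    have -> : phi`_e = 1.
      by move: mphi; rewrite monicE lead_coefE sphi => /eqP.
    rewrite rmorph1 (der1 DP) mul0r addr0 mulr_sumr -sumrN; apply: eq_bigr => i _.
    have -> : phi`_i = - A`_i by rewrite coefB coefXn ltn_eqF // sub0r.
    by rewrite rmorphN (derN DP) DjE; ring.
  case: e e0 sA fpE => // e' _ sA; rewrite big_ord_recl DKA0 rmorph1 mul1r expr0 mulrDr mulr1.
  move=> ->; apply: (val_gt_add wP T0).
  apply: (val_geM wP); first exact: val_gexx.
  apply: (val_ge_sum wP) => i _; apply: (val_ge0M wP).
    have := val_ge_ext wj (der_unif_ge0 resK DKP DKc (val_ge_le (ler01) (hA (lift ord0 i)))).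
    by rewrite mul0r.
  by right; rewrite (dvalX wP) // wpi -mulr_natr mul1r natz lift0.
have [cp cpP] := power_basis_coord bP.
have trE := euler_trace e0 bP sphi mphi rphi cpP.
(* The coordinates of [x * fp] are the traces of [x] times the integral elements [euler_dual];
   conversely a trace is the last coordinate of an integral element. *)
have codP x : codifferent v w j x <-> val_ge w 0 (x * fp).
  split=> h.
    rewrite -(cpP (x * fp)).2; apply: pev_integral => l.
    have [le|le] := ltnP l e; last first.
      by rewrite nth_default ?(leq_trans (cpP _).1) //; left.
    rewrite (euler_coord e0 bP sphi mphi rphi cpP _ le) -mulrA [fp * _]mulrC mulrA -trE.
    apply: h; apply: pev_integral => i; rewrite coef_drop_poly; exact: phi_int.
  move=> z hz; rewrite trE -/fp mulrAC.
  have el : (e.-1 < e)%N by rewrite prednK.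
  suff h0 : val_ge w 0 (\sum_(i < e) j (cp (x * fp * z))`_i * pi ^+ i).
    exact: (ext_coord_ge0 wP wj wpi h0 (Ordinal el)).
  by rewrite -(pevE _ _ (cpP _).1) (cpP _).2; apply: (val_geM0 wP).
have difP z : different v w j z <-> val_ge w (w T) z.
  split=> h.
    have : val_ge w 0 (z * fp^-1).
      by apply: h; apply/codP; rewrite mulVf //; right; rewrite (dval1 wP).
    by move/(val_ge_div wP 0 _ fp0); rewrite add0r wfp.
  move=> x /codP hx; have -> : z * x = x * fp * (z / fp) by field.
  apply: (val_ge0M wP) => //; apply/(val_ge_div wP) => //.
  by rewrite wfp add0r.
have drP : exists n : int, (exists z, [/\ different v w j z, z != 0 & w z = n]) /\
    (forall z, different v w j z -> val_ge w n z).
  exists (w T); split; last by move=> z /difP.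
  by exists T; split=> //; apply/difP; right.
have [[z [/difP hz z0 wz]] hmin] := xgetPex 0 drP.
rewrite /dr; apply/eqP; rewrite eq_le; apply/andP; split.
  have : different v w j T by apply/difP; right.
  by move=> /hmin; rewrite val_geE.
by move: hz; rewrite val_geE // wz.
Qed.

End LocalDifferent.

(** * Function fields: rank bounds and residue fields *)

Lemma fractionP (R : idomainType) (x : {fraction R}) :
  exists n d : R, d != 0 /\ x * tofrac d = tofrac n.
Proof.
elim/quotW: x => y; exists \n_y, \d_y; split; first exact: denom_ratioP.
unlock FracField.tofrac; rewrite -[LHS]FracField.pi_mul.
apply/eqmodP => /=; rewrite FracField.equivfE /FracField.mulf /=.
by rewrite !numden_Ratio ?(oner_neq0, mulr1, mulf_neq0, denom_ratioP) // mulrC.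
Qed.

Lemma linear_relation (k : fieldType) (I J : finType) (A : I -> J -> k) :
  (#|J| < #|I|)%N ->
  exists c : I -> k, (exists i, c i != 0) /\ forall l, \sum_i c i * A i l = 0.
Proof.
move=> IJ; pose M : 'M[k]_(#|I|, #|J|) := \matrix_(i, l) A (enum_val i) (enum_val l).
have [N [N0 NM]] : exists N : 'M_(#|I|), N != 0 /\ N *m M = 0.
  exists (kermx M); rewrite mulmx_ker -mxrank_eq0 mxrank_ker subn_eq0 -ltnNge.
  by rewrite (leq_ltn_trans (rank_leq_col _)).
have /matrix0Pn [r [s rs]] := N0; exists (fun i => N r (enum_rank i)); split.
  by exists (enum_val s); rewrite enum_valK.
move=> l; have /matrixP /(_ r (enum_rank l)) := NM.
rewrite !mxE => h; rewrite -[RHS]h [RHS](reindex enum_rank) /=; last first.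
  by apply: onW_bij; exact: enum_rank_bij.
by apply: eq_bigr => i _; rewrite !mxE !enum_rankK.
Qed.

(** Division by the largest common power of ['X]. It makes a relation between polynomials in an
    element survive reduction modulo that element. *)
Lemma primitive_family (k : fieldType) (I : finType) (q : I -> {poly k}) i0 : q i0 != 0 ->
  exists n (q' : I -> {poly k}), (forall i, q i = q' i * 'X^n) /\ exists i, (q' i)`_0 != 0.
Proof.
have [n] := ubnP (size (q i0)); elim: n q => // n IH q sq q0.
have [[i qi]|h] := pselect (exists i, (q i)`_0 != 0).
  by exists 0%N, q; split; [move=> l; rewrite expr0 mulr1|exists i].
have qE i : q i = (q i %/ 'X) * 'X.
  rewrite divpK // -[X in X %| _]subr0 -(rmorph0 polyC) dvdp_XsubCl /root horner_coef0.
  by apply/negPn/negP => qi; apply: h; exists i.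
have q10 : q i0 %/ 'X != 0 by apply: contra_neq q0 => q10; rewrite qE q10 mul0r.
have [|//|m [q' [q'E hq']]] := IH (fun i => q i %/ 'X) _ _.
  by move: sq; rewrite {1}qE size_mulX //; lia.
exists m.+1, q'; split=> // i; rewrite qE q'E -mulrA; congr (_ * _).
by rewrite exprSr.
Qed.

Section FunctionField.
Variables (k : closedFieldType) (F : funField k).
Local Notation pv := (pev (ff_cst F)).

(** A basis of the field over k(t), with denominators cleared so that dimensions can be counted by
    sizes of polynomials in [t]. *)
Lemma ff_lattice : exists (t : F) (n : nat) (b : 'I_n -> F), forall z : F,
  exists (d : {poly k}) (p : 'I_n -> {poly k}),
    pv t d != 0 /\ pv t d * z = \sum_i pv t (p i) * b i.
Proof.
have [j [jc [n [b bP]]]] := ff_finite F.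
exists (j (tofrac 'X)), n, b => z.
have jE q : j (tofrac q) = pv (j (tofrac 'X)) q.
  elim/poly_ind: q => [|q c IH]; first by rewrite !rmorph0.
  by rewrite !rmorphD !rmorphM /= pevX pevC -IH jc.
have [c [zE _]] := bP z.
have /choice [nd hnd] : forall i, exists nd : {poly k} * {poly k},
    nd.2 != 0 /\ c 0 i * tofrac nd.2 = tofrac nd.1.
  by move=> i; have [m [d h]] := fractionP (c 0 i); exists (m, d).
exists (\prod_i (nd i).2), (fun i => (nd i).1 * \prod_(l | l != i) (nd l).2); split.
  rewrite -jE fmorph_eq0 tofrac_eq0; apply/prodf_neq0 => i _.
  by have [] := hnd i.
rewrite zE mulr_sumr; apply: eq_bigr => i _.
rewrite (bigD1 i) //= -!jE !tofracM -(hnd i).2 !rmorphM /=; ring.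
Qed.

(** The coefficients are formal polynomials, so a nonempty free family also forces [h] to be
    transcendental over [k]. *)
Definition poly_free (h : F) (I : finType) (u : I -> F) : Prop :=
  forall q : I -> {poly k}, \sum_i pv h (q i) * u i = 0 -> forall i, q i = 0.

Lemma poly_free_cst h (I : finType) (u : I -> F) n (c : I * 'I_n -> k) : poly_free h u ->
  \sum_x ff_cst F (c x) * (u x.1 * h ^+ x.2) = 0 -> forall x, c x = 0.
Proof.
move=> uP c0 [i l].
have := uP (fun i => \poly_(l < n) (if insub l is Some l' then c (i, l') else 0)).
move=> /(_ _ i) /polyP /(_ l); rewrite coef_poly ltn_ord valK coef0; apply.
have c0' : \sum_i \sum_(l < n) ff_cst F (c (i, l)) * (u i * h ^+ l) = 0.
  by rewrite pair_bigA -[RHS]c0 /=; apply: eq_bigr => -[].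
rewrite -[RHS]c0'; apply: eq_bigr => {}i _; rewrite (pevE _ _ (size_poly _ _)) mulr_suml.
by apply: eq_bigr => {}l _; rewrite coef_poly ltn_ord valK; ring.
Qed.

(* Counting the k-linearly independent elements [u i * h ^+ l], [l <= n], in a
   lattice over k[t] whose bounded parts have dimension linear in [n]. *)
Lemma poly_free_bounded h : exists R, forall (I : finType) (u : I -> F),
  poly_free h u -> (#|I| <= R)%N.
Proof.
have [t [n [b bP]]] := ff_lattice.
(* The elements with denominator [d] and numerators of size at most [M]. *)
pose W (d : {poly k}) M z := exists p : 'I_n -> {poly k}, (forall i, (size (p i) <= M)%N) /\
  pv t d * z = \sum_i pv t (p i) * b i.
have WM d M M' z : (M <= M')%N -> W d M z -> W d M' z.
  move=> MM' [p [sp pE]]; exists p; split=> // i; exact: leq_trans (sp i) MM'.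
have Wd d d' M z : W d M z -> W (d * d') (M + size d')%N z.
  move=> [p [sp pE]]; exists (fun i => p i * d'); split.
    by move=> i; rewrite (leq_trans (size_polyMleq _ _)) // (leq_trans (leq_pred _)) // leq_add2r.
  rewrite rmorphM /= mulrAC pE mulr_suml; apply: eq_bigr => i _.
  by rewrite rmorphM /=; ring.
have Wfin (I : finType) (z : I -> F) : exists d M, pv t d != 0 /\ forall i, W d M (z i).
  have /choice [d hd] := fun i => bP (z i); have [p hp] := choice hd.
  pose p' i l := p i l * \prod_(i' | i' != i) d i'.
  exists (\prod_i d i), (\max_i \max_l size (p' i l))%N; split.
    by rewrite rmorph_prod; apply/prodf_neq0 => i _; have [] := hp i.
  move=> i; exists (p' i); split.
    move=> l; apply: leq_trans (leq_bigmax i).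
    exact: (leq_bigmax (F := fun l => size (p' i l)) l).
  rewrite (bigD1 i) //= rmorphM /= mulrAC (hp i).2 mulr_suml.
  by apply: eq_bigr => l _; rewrite rmorphM /=; ring.
have [d [s [d0 hs]]] := Wfin _ (fun i => h * b i).
have Wh d' M z : W d' M z -> W (d' * d) (M + s)%N (h * z).
  move=> [p [sp pE]]; have [r hr] := choice hs.
  exists (fun l => \sum_i p i * r i l); split.
    move=> l; apply: (leq_trans (size_sum _ _ _)); apply/bigmax_leqP => i _.
    rewrite (leq_trans (size_polyMleq _ _)) // (leq_trans (leq_pred _)) //.
    by rewrite leq_add // (hr i).1.
  transitivity (pv t d * h * (pv t d' * z)); first by rewrite rmorphM /=; ring.
  rewrite pE mulr_sumr; transitivity (\sum_i pv t (p i) * \sum_l pv t (r i l) * b l).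
    by apply: eq_bigr => i _; rewrite -(hr i).2; ring.
  under eq_bigr do rewrite mulr_sumr.
  rewrite exchange_big; apply: eq_bigr => l _; rewrite rmorph_sum mulr_suml.
  by apply: eq_bigr => i _; rewrite rmorphM mulrA.
(* Each multiplication by [h] adds a factor [d] to the denominator and [s] to the sizes; bringing
   all to one denominator costs at most [size d] more, in each of [n] coordinates. *)
exists (n * (s + size d))%N => I u uP; rewrite leqNgt; apply/negP => Rlt.
have [D [M [D0 hM]]] := Wfin _ u.
have Wl i l : W (D * d ^+ l) (M + l * s)%N (u i * h ^+ l).
  elim: l => [|l IH]; first by rewrite !expr0 !mulr1 mul0n addn0.
  have := Wh _ _ _ IH; rewrite -mulrA -exprSr mulrCA -exprS.
  by congr W; lia.
(* With r = [n * (s + size d)], there are at least (r + 1)(L + 1) products against n B = n (M + 1) +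
   r L coordinates; this [L] makes the former larger. *)
pose L := (n * M.+1)%N; pose B := (M.+1 + L * (s + size d))%N.
have WL (x : I * 'I_L.+1) : W (D * d ^+ L) B (u x.1 * h ^+ x.2).
  case: x => i l /=; have lL : (l <= L)%N by rewrite -ltnS.
  have := Wd _ (d ^+ (L - l)) _ _ (Wl i l); rewrite -mulrA -exprD subnKC //.
  apply: WM; have := size_poly_exp_leq d (L - l); rewrite /B.
  move: (nat_of_ord l) lL (size d) (size (d ^+ (L - l))) => {}l lL y x xy.
  have : ((L - l) * y + l * y = L * y)%N by rewrite -mulnDl subnK.
  have : (l * s <= L * s)%N by rewrite leq_mul2r lL orbT.
  have : (y.-1 * (L - l) <= (L - l) * y)%N by rewrite mulnC leq_mul2l leq_pred orbT.
  rewrite mulnDr; move: (y.-1 * _)%N ((L - l) * y)%N (l * y)%N (L * y)%N (l * s)%N (L * s)%N xy.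
  by clear; lia.
have [p hp] := choice WL.
have [|c [[x cx] hc]] := @linear_relation k (I * 'I_L.+1)%type ('I_n * 'I_B)%type
    (fun x y => (p x y.1)`_y.2) _.
  rewrite !card_prod !card_ord /B /L.
  move: Rlt; set y := (s + size d)%N; set a := #|I| => Rlt.
  have : ((n * y).+1 * (n * M.+1).+1 <= a * (n * M.+1).+1)%N by rewrite leq_mul2r Rlt orbT.
  by rewrite mulSn mulnDr; nia.
move/eqP: cx; apply; apply: (poly_free_cst uP).
have DL0 : pv t (D * d ^+ L) != 0.
  by rewrite rmorphM rmorphXn /= mulf_neq0 ?expf_neq0.
apply: (mulfI DL0); rewrite mulr0 mulr_sumr.
under eq_bigr => y _ do rewrite mulrCA (hp y).2 mulr_sumr.
rewrite exchange_big big1 //= => i _.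
under eq_bigr => y _ do rewrite mulrA -pevZ.
rewrite -mulr_suml -rmorph_sum /=.
suff -> : \sum_y c y *: p y i = 0 by rewrite rmorph0 mul0r.
apply/polyP => l; rewrite coef0 coef_sum.
under eq_bigr do rewrite coefZ.
have [lB|lB] := ltnP l B; first exact: (hc (i, Ordinal lB)).
rewrite big1 // => y _; rewrite nth_default ?mulr0 //.
exact: leq_trans ((hp y).1 i) lB.
Qed.

Lemma point_cst (p : point F) (c : k) : p (ff_cst F c) = 0.
Proof. exact: pt_cst. Qed.

(** The powers of [z] cannot all be independent over k[t], for [t] a uniformizer at [p]. A primitive
    relation between them reduces at [p] to a nonzero polynomial over [k] having the residue of [z]
    as a root. *)
Lemma point_residue (p : point F) : residue_cst p (ff_cst F).
Proof.
move=> z hz; have pP := pt_dval p; have [t t0 pt] := dval_unif pP.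
have [R hR] := poly_free_bounded t.
have [q [q0 [i qi]]] : exists q : 'I_R.+1 -> {poly k},
    \sum_i pv t (q i) * z ^+ i = 0 /\ exists i, q i != 0.
  apply: contrapT => h; have := hR _ (fun i : 'I_R.+1 => z ^+ i).
  rewrite card_ord ltnn => fR; suff: false by []; apply: fR => q q0 i; apply: contrapT => qi.
  by apply: h; exists q; split=> //; exists i; apply/eqP.
have [n [q' [qE [l q'l]]]] := primitive_family qi.
have q'0 : \sum_i pv t (q' i) * z ^+ i = 0.
  have tn0 : t ^+ n != 0 by rewrite expf_neq0.
  apply: (mulfI tn0); rewrite mulr0 -[RHS]q0 mulr_sumr; apply: eq_bigr => m _.
  by rewrite qE rmorphM /= pevXn; ring.
apply: (@residue_root _ _ _ _ _ (\poly_(m < R.+1) (q' (inord m))`_0)) => //.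
- exact: point_cst.
- apply/eqP => /polyP /(_ l); rewrite coef_poly ltn_ord inord_val coef0.
  by apply/eqP.
rewrite (pevE _ _ (size_poly _ _)) -[X in val_ge _ _ X]subr0 -[X in _ - X]q'0 -sumrB.
apply: (val_ge_sum pP) => m _; rewrite coef_poly ltn_ord inord_val -mulrBl.
apply: (val_geM0 pP); last exact: (val_ge0X pP).
rewrite -opprB; apply: (val_geN pP); apply: (pev_coef0 pP) => //; first exact: point_cst.
by right; rewrite pt.
Qed.

End FunctionField.

(** * Weak approximation and zeros of functions *)

Section Points.
Variables (k : closedFieldType) (F : funField k).
Local Notation pv := (pev (ff_cst F)).
Implicit Types (p q r : point F) (S : seq (point F)).

Lemma point_eq p q : (forall x, p x = q x) -> p = q.
Proof.
case: p q => [p pP pc] [q qP qc] /= pq.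
have E : p = q by apply: funext.
by move: pP pc; rewrite E => pP pc; congr Point; apply: Prop_irrelevance.
Qed.

(** Otherwise the ring of [p] lies in that of [q], and units go to units. Then [q] is [q t] times
    [p], and normalization forces [q t = 1]. *)
Lemma point_separation p q : p <> q -> exists y, [/\ y != 0, 0 < p y & q y < 0].
Proof.
move=> pq; apply: contrapT => h; apply: pq; apply: point_eq.
have pP := pt_dval p; have qP := pt_dval q.
have {}h y : y != 0 -> 0 < p y -> 0 <= q y.
  by move=> y0 py; rewrite leNgt; apply/negP => qy; apply: h; exists y.
have [t t0 pt] := dval_unif pP.
have h0 x : x != 0 -> 0 <= p x -> 0 <= q x.
  move=> x0 px; rewrite leNgt; apply/negP => qx.
  (* This element has positive value at [p], while the exponent lets the pole of [x] at [q] outweigh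
     [q t]. *)
  have := h (x ^+ (absz (q t)).+1 * t); rewrite mulf_neq0 ?expf_neq0 //.
  rewrite (dvalM pP) ?(dvalM qP) ?expf_neq0 // (dvalX pP) // (dvalX qP) // pt.
  rewrite -mulr_natr -[_ *+ _ in X in _ -> _ -> X]mulr_natr; nia.
have h1 x : x != 0 -> p x = 0 -> q x = 0.
  move=> x0 px; have := h0 x x0; have := h0 x^-1.
  by rewrite invr_eq0 x0 (dvalV pP) (dvalV qP) px; lia.
have hn x (n : nat) : x != 0 -> p x = n%:Z -> q x = n%:Z * q t.
  move=> x0 px; have tn0 : t ^+ n != 0 by rewrite expf_neq0.
  have := h1 (x / t ^+ n); rewrite mulf_neq0 ?invr_eq0 //.
  rewrite (dvalM pP) ?(dvalM qP) ?invr_eq0 // (dvalV pP) (dvalV qP) !(dvalX pP, dvalX qP) //.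
  by rewrite pt px natz -(mulr_natr (q t)) natz; lia.
have qE x : q x = p x * q t.
  have [->|x0] := eqVneq x 0; first by rewrite (dval0 qP) (dval0 pP) mul0r.
  have [px|px] := leP 0 (p x).
    rewrite -(gez0_abs px); apply: hn => //; lia.
  have := hn x^-1 (absz (p x)); rewrite invr_eq0 (dvalV pP) (dvalV qP).
  by move=> /(_ x0) h2; have := h2 _; nia.
have [s s0 qs] := dval_unif qP.
have qt : 0 <= q t by apply: h0 => //; rewrite pt.
have qt1 : q t = 1.
  move: qs; rewrite qE; move: (p s) (q t) qt => a b b0 ab.
  have a1 : 1 <= a by nia.
  nia.
by move=> x; rewrite qE qt1 mulr1.
Qed.

(** Each [q] excludes at most one constant, the residue of [- y], and an algebraically closed field
    is infinite. *)
Lemma avoid_residues S (y : F) : exists2 c : k, c != 0 &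
  forall q, q \in S -> ~ val_ge q 1 (ff_cst F c + y).
Proof.
pose bad q := xget 0 [set c : k | val_ge q 1 (ff_cst F c + y)].
have badP q c : val_ge q 1 (ff_cst F c + y) -> c = bad q.
  move=> hc; have hb : val_ge q 1 (ff_cst F (bad q) + y).
    exact: (@xgetPex _ 0 [set c : k | val_ge q 1 (ff_cst F c + y)] (ex_intro _ c hc)).
  apply/eqP; rewrite -subr_eq0; apply/eqP.
  apply: (@val_ge_cst_eq0 _ _ q (ff_cst F) (pt_cst q) _ 1) => //.
  have := val_geB (pt_dval q) hc hb; rewrite opprD addrACA subrr addr0.
  by rewrite rmorphB.
have [|c] := @closed_nonrootP k (\prod_(c <- 0 :: map bad S) ('X - c%:P)) _.
  by rewrite monic_neq0 // monic_prod_XsubC.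
rewrite root_prod_XsubC inE negb_or => /andP [c0 cS]; exists c => // q qS hq.
by move: cS; rewrite (badP _ _ hq) map_f.
Qed.

(** The function is c / (c + y), where [y] vanishes at [p] and has a pole of order above [M] at [q].
    The constant c is chosen so that c + y vanishes nowhere on [S]. *)
Lemma approx_pair p q S (M : nat) : q <> p -> exists f : F,
  [/\ val_ge p 1 (f - 1), val_ge q M%:Z f & forall r, r \in S -> val_ge r 0 f].
Proof.
move=> /nesym /point_separation [y0 [y00 py qy]].
have pP := pt_dval p; have qP := pt_dval q.
pose y := y0 ^+ M.+1; have y_0 : y != 0 by rewrite expf_neq0.
have {}py : 1 <= p y by rewrite (dvalX pP) // -mulr_natr; nia.
have {}qy : q y <= - M.+1%:Z by rewrite (dvalX qP) // -mulr_natr; nia.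
have [c c0 hc] := avoid_residues S y.
have fc0 : ff_cst F c != 0 by rewrite fmorph_eq0.
have [z0 pz] : ff_cst F c + y != 0 /\ p (ff_cst F c + y) = 0.
  have [||z0 pz] := val_gt_add pP (x := ff_cst F c) (y := y) => //.
    by rewrite point_cst; right; lia.
  by split=> //; rewrite pz point_cst.
exists (ff_cst F c / (ff_cst F c + y)); split.
- have -> : ff_cst F c / (ff_cst F c + y) - 1 = - y / (ff_cst F c + y).
    by rewrite -[X in _ - X](divff z0) -mulrBl; congr (_ / _); ring.
  by apply/(val_ge_div pP) => //; rewrite pz addr0; apply: (val_geN pP); right.
- have [||_ qz] := val_gt_add qP (x := y) (y := ff_cst F c) => //.
    by right; rewrite point_cst; lia.
  apply/(val_ge_div qP) => //; right; rewrite point_cst addrC.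
  by move: qz; rewrite [y + _]addrC => ->; lia.
move=> r rS; apply/(val_ge_div (pt_dval r)) => //; right.
rewrite point_cst add0r leNgt; apply/negP => h.
by apply: (hc r rS); right; lia.
Qed.

Lemma weak_approx p S (M : nat) : (forall q, q \in S -> q <> p) -> exists f : F,
  val_ge p 1 (f - 1) /\ forall q, q \in S -> val_ge q M%:Z f.
Proof.
move=> pS; have pP := pt_dval p.
suff : forall S', {subset S' <= S} -> exists f : F, [/\ val_ge p 1 (f - 1),
    forall q, q \in S -> val_ge q 0 f & forall q, q \in S' -> val_ge q M%:Z f].
  by move=> /(_ S) [//|f [? _ ?]]; exists f.
elim=> [_|q S' IH qS].
  exists 1; rewrite subrr; split=> //; first by left.
  by move=> r _; right; rewrite (dval1 (pt_dval r)).
have [|f [pf Sf S'f]] := IH; first by move=> r rS; apply: qS; rewrite inE rS orbT.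
have [g [pg qg Sg]] := approx_pair S M (pS q (qS _ (mem_head _ _))).
exists (f * g); split.
- have -> : f * g - 1 = (f - 1) * (g - 1) + (f - 1) + (g - 1) by ring.
  apply: (val_geD pP) => //; apply: (val_geD pP) => //.
  by apply: (val_geM0 pP) => //; apply: val_ge_le pg.
- by move=> r rS; have rP := pt_dval r; apply: (val_ge0M rP); [apply: Sf|apply: Sg].
move=> r; rewrite inE => /orP [/eqP ->|rS'].
  by have rP := pt_dval q; apply: (val_ge0M rP) => //; apply: Sf; apply: qS; rewrite mem_head.
have rP := pt_dval r; apply: (val_geM0 rP); first exact: S'f.
by apply: Sg; apply: qS; rewrite inE rS' orbT.
Qed.

(** The element of index (i, l) has order l at [p i] and order at least [e j] at every other [p j].
    Modulo order [e i] at [p i] only the terms of index i remain, and their orders differ modulo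
    [e i], so nothing cancels. The condition on [c] covers polynomials in a function with zeros of
    order [e i], and elements of a subfield with ramification indices [e i]. *)
Lemma independent_family n (p : 'I_n -> point F) (e : 'I_n -> nat) : injective p ->
  exists u : {i : 'I_n & 'I_(e i)} -> F,
  forall c : {i : 'I_n & 'I_(e i)} -> F,
    (forall x i, c x = 0 \/ exists a : nat, p i (c x) = a%:Z * (e i)%:Z) ->
    (exists x, c x != 0 /\ p (tag x) (c x) = 0) -> \sum_x c x * u x <> 0.
Proof.
move=> p_inj.
have /choice [u hu] : forall x : {i : 'I_n & 'I_(e i)}, exists u : F,
    [/\ u != 0, p (tag x) u = (tagged x)%:Z &
        forall i, i != tag x -> val_ge (p i) (e i)%:Z u].
  move=> [i l] /=; have [y y0 py] := dval_surj (pt_dval (p i)) l%:Z.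
  (* The precision also absorbs the poles that [y] may have at the other points. *)
  have [|f [pf hf]] := @weak_approx (p i) [seq p j | j <- enum 'I_n & j != i]
      (\sum_j (e j + absz (p j y)))%N.
    by move=> q /mapP [j]; rewrite mem_filter => /andP [ji _] -> /p_inj /eqP; rewrite (negPf ji).
  have [f0 vf] : f != 0 /\ p i f = 0.
    have := val_gt_add (pt_dval (p i)) (oner_neq0 _) (y := f - 1).
    by rewrite [1 + _]addrC subrK (dval1 (pt_dval (p i))); apply.
  exists (y * f); split; first by rewrite mulf_neq0.
    by rewrite (dvalM (pt_dval (p i))) // py vf addr0.
  move=> j ji; have jP := pt_dval (p j).
  have jS : j \in [seq j <- enum 'I_n | j != i] by rewrite mem_filter ji mem_enum.
  have := hf (p j) (map_f p jS).
  move=> /(val_geM jP (val_gexx (p j) y)); apply: val_ge_le.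
  have : (e j + absz (p j y) <= \sum_j (e j + absz (p j y)))%N.
    by rewrite [leqRHS](bigD1 j) //= leq_addr.
  by lia.
exists u => c hc [[i l] [cx0 pcx]] s0; have iP := pt_dval (p i); rewrite /= in pcx.
have eterm x : tag x = i -> c x != 0 -> exists a : nat,
    p i (c x * u x) = a%:Z * (e i)%:Z + (tagged x)%:Z.
  move=> xi cx; have [ux0 vux _] := hu x; have [/eqP|[a ha]] := hc x i.
    by rewrite (negPf cx).
  by exists a; rewrite (dvalM iP) // ha -vux xi.
pose y x := if tag x == i then c x * u x else 0.
have ysum : val_ge (p i) (e i)%:Z (\sum_x y x).
  have -> : \sum_x y x = - \sum_(x | tag x != i) c x * u x.
    apply/eqP; rewrite -addr_eq0; apply/eqP.
    rewrite -[RHS]s0 [RHS](bigID (fun x => tag x == i)) /=; congr (_ + _).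
    by rewrite -big_mkcond.
  apply: (val_geN iP); apply: (val_ge_sum iP) => x xi.
  have [_ _ /(_ i)] := hu x; rewrite eq_sym xi => /(_ isT) hx.
  apply: (val_ge0M iP) => //.
  by have [->|[a ha]] := hc x i; [left|right; rewrite ha; nia].
have := val_ge_sum_distinct iP _ ysum (Tagged _ l); rewrite /y /= eqxx.
have [ux0 vux _] := hu (Tagged (fun i => 'I_(e i)) l); rewrite /= in vux.
rewrite val_geE ?mulf_neq0 // (dvalM iP) // pcx vux add0r.
move=> h; have := ltn_ord l; suff : (e i)%:Z <= l%:Z by lia.
apply: h => -[i1 l1] [i2 l2]; rewrite /=.
case: (i1 =P i) => [i1i|_]; last by rewrite eqxx.
case: (i2 =P i) => [i2i|_]; last by rewrite eqxx.
subst i1 i2; rewrite !mulf_eq0 !negb_or => /andP [c1 _] /andP [c2 _].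
have [a ->] := eterm (Tagged _ l1) erefl c1; have [b ->] := eterm (Tagged _ l2) erefl c2.
move=> /divz_rem_inj => /(_ (ltn_ord _) (ltn_ord _)) /= ll.
by congr Tagged; apply: val_inj.
Qed.

(** Polynomials in [h] have values at [p i] that are multiples of [e i], and a primitive relation
    has a coefficient of value 0. *)
Lemma zeros_poly_free n (p : 'I_n -> point F) (e : 'I_n -> nat) (h : F) : injective p ->
  (forall i, (0 < e i)%N) -> (forall i, p i h = (e i)%:Z) ->
  exists u : {i : 'I_n & 'I_(e i)} -> F, poly_free h u.
Proof.
move=> p_inj e0 ph; have [u hu] := independent_family e p_inj.
exists u => q q0 x; apply/eqP/negPn/negP => qx.
have [m [q' [qE [y qy]]]] := primitive_family qx.
have h0 : h != 0 by apply: (dval_neq0 (pt_dval (p (tag x)))); rewrite ph; have := e0 (tag x); lia.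
apply: (hu (fun x => pv h (q' x))).
- move=> z i; have [->|q'z] := eqVneq (q' z) 0; [by left; rewrite rmorph0|right].
  have [|_ [a ->]] := pev_val (pt_dval (p i)) (point_cst (p i)) (t := h) _ q'z.
    by rewrite ph; have := e0 i; lia.
  by exists a; rewrite ph -mulr_natr mulrC natz.
- exists y; apply: (pev_coef0_val (pt_dval _) (point_cst _)) => //.
  by rewrite ph ltz_nat e0.
have hm0 : h ^+ m != 0 by rewrite expf_neq0.
apply: (mulfI hm0); rewrite mulr0 -[RHS]q0 mulr_sumr; apply: eq_bigr => z _.
by rewrite qE rmorphM /= pevXn; ring.
Qed.

End Points.

(** * Existence of poles *)

Section ValuationRing.
Variables (k : closedFieldType) (F : funField k).
Local Notation cst := (ff_cst F).
Local Notation pv := (pev cst).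

Definition subalgebra (A : set F) : Prop :=
  [/\ forall c, A (cst c), forall x y, A x -> A y -> A (x + y)
    & forall x y, A x -> A y -> A (x * y)].

Section Subalgebra.
Variables (A : set F) (sA : subalgebra A).

Lemma subalgC c : A (cst c). Proof. by case: sA. Qed.
Lemma subalgD x y : A x -> A y -> A (x + y). Proof. by case: sA => _ + _; apply. Qed.
Lemma subalgM x y : A x -> A y -> A (x * y). Proof. by case: sA => _ _; apply. Qed.
Lemma subalg0 : A 0. Proof. by rewrite -(rmorph0 cst); apply: subalgC. Qed.
Lemma subalg1 : A 1. Proof. by rewrite -(rmorph1 cst); apply: subalgC. Qed.
Lemma subalgN x : A x -> A (- x).
Proof.
move=> Ax; have -> : - x = cst (-1) * x by rewrite rmorphN1 mulN1r.
by apply: subalgM => //; apply: subalgC.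
Qed.
Lemma subalgB x y : A x -> A y -> A (x - y).
Proof. by move=> Ax Ay; apply: subalgD => //; apply: subalgN. Qed.
Lemma subalgX x n : A x -> A (x ^+ n).
Proof.
by move=> Ax; elim: n => [|n IH]; rewrite ?expr0 ?exprS; [exact: subalg1|exact: subalgM].
Qed.
Lemma subalg_sum (I : Type) (r : seq I) (P : pred I) (f : I -> F) :
  (forall i, P i -> A (f i)) -> A (\sum_(i <- r | P i) f i).
Proof. by move=> h; apply: big_ind => //; [exact: subalg0|exact: subalgD]. Qed.
Lemma subalg_horner (p : {poly F}) x : A x -> (forall i, A p`_i) -> A p.[x].
Proof.
move=> Ax Ap; rewrite horner_coef; apply: subalg_sum => i _.
by apply: subalgM => //; apply: subalgX.
Qed.
End Subalgebra.

Variables (A : set F) (h s : F).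
Hypotheses (sA : subalgebra A) (hs : h * s = 1) (As : A s) (Ah : ~ A h).
Hypothesis Amax : forall B, subalgebra B -> A `<=` B -> ~ B h -> B `<=` A.

Let s0 : s != 0.
Proof. by apply/eqP => s0; move: hs; rewrite s0 mulr0 => /esym /eqP; rewrite oner_eq0. Qed.

(** Inverting d = 1 - s a does not bring in [h]: as d^n = 1 - s b with b in [A], one has h = b + h
    d^n. Maximality then puts the inverse in [A]. *)
Let A_loc a : A a -> A (1 - s * a)^-1.
Proof.
move=> Aa; pose d := 1 - s * a.
have Ad : A d by apply: (subalgB sA); [exact: (subalg1 sA)|exact: (subalgM sA)].
have d0 : d != 0.
  apply/eqP => /eqP; rewrite subr_eq0 => /eqP sa; apply: Ah.
  by have -> : h = a by rewrite -[h]mulr1 sa mulrA hs mul1r.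
have dX n : exists2 b, A b & d ^+ n = 1 - s * b.
  elim: n => [|n [b Ab E]].
    by exists 0; [exact: (subalg0 sA)|rewrite expr0 mulr0 subr0].
  exists (a + b - s * a * b); last by rewrite exprS E /d; ring.
  apply: (subalgB sA); first exact: (subalgD sA).
  by do 2?apply: (subalgM sA).
apply: (Amax (B := [set x | exists n, A (x * d ^+ n)])).
- split=> [c|x y [n xn] [m ym]|x y [n xn] [m ym]] /=.
  + by exists 0%N; rewrite expr0 mulr1; apply: (subalgC sA).
  + exists (n + m)%N; rewrite exprD.
    have -> : (x + y) * (d ^+ n * d ^+ m) = x * d ^+ n * d ^+ m + y * d ^+ m * d ^+ n by ring.
    by apply: (subalgD sA); apply: (subalgM sA) => //; apply: (subalgX sA).
  exists (n + m)%N; rewrite exprD mulrACA; exact: (subalgM sA).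
- by move=> x Ax; exists 0%N; rewrite expr0 mulr1.
- move=> [n hn]; have [b Ab dE] := dX n; apply: Ah.
  have -> : h = b + h * d ^+ n.
    by rewrite dE mulrBr mulr1 mulrA hs mul1r addrC subrK.
  exact: (subalgD sA).
by exists 1%N; rewrite expr1 mulVf //; apply: (subalg1 sA).
Qed.

Let reaches z n := exists p : {poly F}, [/\ (size p <= n)%N, forall i, A p`_i & p.[z] = h].

Let A_adjoin z : ~ A z -> exists n, reaches z n.
Proof.
move=> Az; apply: contrapT => hz; apply: Az.
apply: (Amax (B := [set x | exists p : {poly F}, (forall i, A p`_i) /\ p.[z] = x])).
- split=> [c|x y [p [Ap <-]] [q [Aq <-]]|x y [p [Ap <-]] [q [Aq <-]]] /=.
  + exists (cst c)%:P; split; last by rewrite hornerC.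
    move=> i; rewrite coefC; case: eqP => _; [exact: (subalgC sA)|exact: (subalg0 sA)].
  + exists (p + q); rewrite hornerD; split=> // i; rewrite coefD; exact: (subalgD sA).
  exists (p * q); rewrite hornerM; split=> // i; rewrite coefM.
  by apply: (subalg_sum sA) => l _; apply: (subalgM sA).
- move=> x Ax; exists x%:P; rewrite hornerC; split=> // i; rewrite coefC.
  by case: eqP => _ //; apply: (subalg0 sA).
- by move=> [p [Ap ph]]; apply: hz; exists (size p), p.
exists 'X; rewrite hornerX; split=> // i; rewrite coefX.
by case: eqP => _; [exact: (subalg1 sA)|exact: (subalg0 sA)].
Qed.

Let reaches_pos z n : reaches z n -> (1 < n)%N.
Proof.
move=> [p [pn Ap ph]]; rewrite ltnNge; apply/negP => n1; apply: Ah; rewrite -ph.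
by rewrite (size1_polyC (leq_trans pn n1)) hornerC.
Qed.

(** The expression of [h] in the inverse of [z], multiplied by [s], has 1 - s q_0 as the coefficient
    to invert, a unit by [A_loc]. It rewrites [z ^+ n] by lower powers, which shortens the
    expression of [h] in [z]. *)
Let reaches_lower z n m : z != 0 -> (m <= n)%N -> reaches z n.+1 -> reaches z^-1 m.+1 ->
  reaches z n.
Proof.
move=> z0 mn hp hq; have n0 := reaches_pos hp; have m0 := reaches_pos hq.
have [p [pn Ap ph]] := hp; have [q [qm Aq qh]] := hq.
pose b j := q`_j / (1 - s * q`_0).
have Ab j : A (b j) by apply: (subalgM sA) => //; apply: A_loc.
have d0 : 1 - s * q`_0 != 0.
  apply/eqP => /eqP; rewrite subr_eq0 => /eqP sa; apply: Ah.
  by have -> : h = q`_0 by rewrite -[h]mulr1 sa mulrA hs mul1r.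
have zE : z ^+ n = s * \sum_(j < m) b j.+1 * z ^+ (n - j.+1).
  have qE : s * \sum_(j < m) q`_j.+1 * z^-1 ^+ j.+1 = 1 - s * q`_0.
    rewrite -hs [h * s]mulrC -mulrBr -qh (@horner_coef_wide _ m.+1) // big_ord_recl.
    by rewrite expr0 mulr1 addrC addKr.
  apply: (mulfI d0); rewrite -{1}qE mulrCA -!mulrA; congr (s * _).
  rewrite mulr_suml mulr_sumr; apply: eq_bigr => j _.
  have jn : (j < n)%N by rewrite (leq_trans (ltn_ord j)).
  rewrite /b; have -> : z ^+ n = z ^+ (n - j.+1) * z ^+ j.+1 by rewrite -exprD subnK.
  by rewrite exprVn; field; rewrite d0 expf_neq0.
exists (\poly_(i < n) p`_i + \sum_(j < m) (p`_n * s * b j.+1) *: 'X^(n - j.+1)); split.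
- rewrite (leq_trans (size_polyD _ _)) // geq_max size_poly /=.
  apply: (leq_trans (size_sum _ _ _)); apply/bigmax_leqP => j _.
  rewrite (leq_trans (size_scale_leq _ _)) // size_polyXn.
  by have := ltn_ord j; lia.
- move=> i; rewrite coefD; apply: (subalgD sA).
    by rewrite coef_poly; case: ifP => _ //; apply: (subalg0 sA).
  rewrite coef_sum; apply: (subalg_sum sA) => j _; rewrite coefZ coefXn.
  apply: (subalgM sA); first by apply: (subalgM sA) => //; apply: (subalgM sA).
  by case: eqP => _; [exact: (subalg1 sA)|exact: (subalg0 sA)].
rewrite hornerD horner_sum -ph (@horner_coef_wide _ n.+1 p) // big_ord_recr /= zE.
congr (_ + _).
  rewrite (horner_coef_wide _ (size_poly _ _)); apply: eq_bigr => i _.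
  by rewrite coef_poly ltn_ord.
rewrite mulrA mulr_sumr; apply: eq_bigr => j _.
by rewrite hornerZ hornerXn mulrA.
Qed.

(** If neither lies in [A], adjoining either one reaches [h]. The longer of the two expressions of
    [h] can always be shortened, an infinite descent. *)
Lemma maximal_total z : A z \/ A z^-1.
Proof.
have [->|z0] := eqVneq z 0; first by left; apply: (subalg0 sA).
have [Az|Az] := pselect (A z); first by left.
have [Az'|Az'] := pselect (A z^-1); first by right.
have [n hn] := A_adjoin Az; have [m hm] := A_adjoin Az'.
exfalso; move: z0 hn hm {Az Az'}; have [N] := ubnP (n + m).
elim: N z n m => // N IH z n m nmN z0 hn hm.
have n1 := reaches_pos hn; have m1 := reaches_pos hm.
case: n m n1 m1 nmN hn hm => [//|n] [//|m] n1 m1 nmN hn hm.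
have [mn|nm] := leqP m n.
  apply: (IH z n m.+1) => //.
  exact: reaches_lower hn hm.
apply: (IH z n.+1 m) => //; first by rewrite -addnS.
apply: reaches_lower (ltnW nm) hm _; first by rewrite invr_eq0.
by rewrite invrK.
Qed.

End ValuationRing.

(** * Discreteness of the valuation rings of a function field *)

Section DiscreteValuation.
Variables (k : closedFieldType) (F : funField k).
Local Notation cst := (ff_cst F).
Local Notation pv := (pev cst).
Variables (A : set F) (s : F).
Hypotheses (sA : subalgebra A) (tot : forall z, A z \/ A z^-1).
Hypotheses (As : A s) (s0 : s != 0) (As' : ~ A s^-1).

Definition nonunit z := A z /\ (z = 0 \/ ~ A z^-1).
Definition isunit z := [/\ z != 0, A z & A z^-1].

Lemma unit_or_nonunit z : A z -> isunit z \/ nonunit z.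
Proof.
move=> Az; have [->|z0] := eqVneq z 0; first by right; split; [exact: (subalg0 sA)|left].
by have [Az'|Az'] := pselect (A z^-1); [left|right; split=> //; right].
Qed.

Lemma unit_nonunit z : isunit z -> ~ nonunit z.
Proof. by move=> [z0 _ Az'] [_ [/eqP|//]]; rewrite (negPf z0). Qed.

Lemma nonunitM x y : nonunit x -> A y -> nonunit (x * y).
Proof.
move=> [Ax nx] Ay; split; first exact: (subalgM sA).
have [->|x0] := eqVneq x 0; first by left; rewrite mul0r.
have [->|y0] := eqVneq y 0; first by left; rewrite mulr0.
right=> xy; case: nx => [/eqP|]; first by rewrite (negPf x0).
apply; have -> : x^-1 = (x * y)^-1 * y by rewrite invfM mulfVK.
exact: (subalgM sA).
Qed.

Lemma isunitM x y : isunit x -> isunit y -> isunit (x * y).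
Proof.
move=> [x0 Ax Ax'] [y0 Ay Ay']; split; first by rewrite mulf_neq0.
  exact: (subalgM sA).
by rewrite invfM; apply: (subalgM sA).
Qed.

Lemma isunitV x : isunit x -> isunit x^-1.
Proof. by move=> [x0 Ax Ax']; split; rewrite ?invr_eq0 ?invrK. Qed.

Lemma isunit_cst c : c != 0 -> isunit (cst c).
Proof.
move=> c0; split; first by rewrite fmorph_eq0.
  exact: (subalgC sA).
by rewrite -fmorphV; apply: (subalgC sA).
Qed.

Lemma nonunitD x y : nonunit x -> nonunit y -> nonunit (x + y).
Proof.
have gen a b : nonunit a -> nonunit b -> b != 0 -> A (a / b) -> nonunit (a + b).
  move=> na nb b0 ab; have -> : a + b = b * (a / b + 1) by rewrite mulrDr mulr1 mulrC divfK.
  by apply: nonunitM => //; apply: (subalgD sA) => //; apply: (subalg1 sA).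
move=> nx ny; have [->|x0] := eqVneq x 0; first by rewrite add0r.
have [->|y0] := eqVneq y 0; first by rewrite addr0.
have [xy|xy] := tot (x / y); first exact: gen.
by rewrite addrC; apply: gen => //; move: xy; rewrite invfM invrK mulrC.
Qed.

Lemma unit_add_nonunit x y : isunit x -> nonunit y -> isunit (x + y).
Proof.
move=> ux ny; have [//|nxy] := unit_or_nonunit (subalgD sA (let: And3 _ a _ := ux in a) ny.1).
case: (unit_nonunit ux); rewrite -(addrK y x); apply: nonunitD => //.
rewrite -mulrN1; apply: nonunitM => //; apply: (subalgN sA); exact: (subalg1 sA).
Qed.

(** A primitive relation over k[z], reduced modulo z A, is a nontrivial relation between the [u i]
    over [k]. *)
Lemma independent_mod_free z (I : finType) (u : I -> F) : z != 0 -> A z -> (forall i, A (u i)) ->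
  (forall c, A ((\sum_i cst (c i) * u i) / z) -> forall i, c i = 0) -> poly_free z u.
Proof.
move=> z0 Az Au hu q q0 i; apply/eqP/negPn/negP => qi.
have [m [q' [qE [l ql]]]] := primitive_family qi.
move/eqP: ql; apply; apply: (hu (fun i => (q' i)`_0)).
have zm0 : z ^+ m != 0 by rewrite expf_neq0.
have q'0 : \sum_i pv z (q' i) * u i = 0.
  apply: (mulfI zm0); rewrite mulr0 -[RHS]q0 mulr_sumr; apply: eq_bigr => y _.
  by rewrite qE rmorphM /= pevXn; ring.
have -> : \sum_i cst (q' i)`_0 * u i = - (z * \sum_i pv z (drop_poly 1 (q' i)) * u i).
  apply/eqP; rewrite -addr_eq0; apply/eqP; rewrite -[RHS]q'0 mulr_sumr -big_split.
  apply: eq_bigr => y _; rewrite -[in RHS](poly_take_drop 1 (q' y)) rmorphD rmorphM /= pevXn expr1.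
  have -> : take_poly 1 (q' y) = ((q' y)`_0)%:P.
    by apply/polyP => j; rewrite coef_take_poly coefC; case: j.
  by rewrite pevC; ring.
rewrite mulNr [z * _]mulrC mulfK //; apply: (subalgN sA).
apply: (subalg_sum sA) => y _; apply: (subalgM sA) => //.
apply: (subalg_horner sA) => // j; rewrite coef_map; exact: (subalgC sA).
Qed.

(* A chain of proper divisors of [z] is linearly independent modulo [z]. *)
Lemma chain_bounded z : z != 0 -> A z -> exists R, forall N (f : nat -> F),
  (forall i, (i < N)%N -> f i != 0 /\ A (f i)) ->
  (forall i, (i < N)%N -> nonunit (z / f i)) ->
  (forall i l, (i < l < N)%N -> nonunit (f l / f i)) -> (N <= R)%N.
Proof.
move=> z0 Az; have [R hR] := poly_free_bounded z; exists R => N f Af fz ff.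
rewrite -(card_ord N); apply: (hR _ (fun i : 'I_N => f i)).
apply: independent_mod_free => // [i|c hc]; first by have [] := Af i (ltn_ord i).
apply: contrapT => hc0.
have [i ci] : exists i, c i != 0.
  apply: contrapT => hn; apply: hc0 => i; apply/eqP/negPn/negP => ci.
  by apply: hn; exists i.
(* The first term with nonzero coefficient divides all later ones properly, so the sum is [f l]
   times a unit; divisibility by [z] would then contradict that [f l] is a proper divisor of [z]. *)
pose l := [arg min_(l < i | c l != 0) (l : nat)].
have [cl lmin] : c l != 0 /\ forall l', c l' != 0 -> (l <= l')%N.
  by rewrite /l; case: arg_minnP.
have [fl0 Afl] := Af l (ltn_ord l).
have sumE : \sum_i cst (c i) * f i = f l * (cst (c l) + \sum_(i | i != l) cst (c i) * (f i / f l)).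
  rewrite (bigD1 l) //= mulrDr mulrC; congr (_ + _).
  by rewrite mulr_sumr; apply: eq_bigr => y _; field.
have ul : isunit (cst (c l) + \sum_(i | i != l) cst (c i) * (f i / f l)).
  apply: unit_add_nonunit; first exact: isunit_cst.
  apply: big_ind => [||y yl]; first by split; [exact: (subalg0 sA)|left].
    exact: nonunitD.
  have [->|cy] := eqVneq (c y) 0.
    by rewrite rmorph0 mul0r; split; [exact: (subalg0 sA)|left].
  rewrite mulrC; apply: nonunitM; last exact: (subalgC sA).
  by apply: ff; rewrite ltn_ord andbT ltn_neqAle eq_sym yl lmin.
move: hc; rewrite sumE mulrAC => hc.
have [u0 _ Au'] := ul.
have fz' : A (f l / z).
  by rewrite -(mulfK u0 (f l / z)); apply: (subalgM sA).
case: (fz l (ltn_ord l)) => _ [/eqP|]; first by rewrite mulf_eq0 invr_eq0 (negPf z0) (negPf fl0).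
by apply; rewrite invfM invrK mulrC.
Qed.

Lemma nonunit_s : nonunit s.
Proof. by split=> //; right. Qed.

(** Otherwise every nonzero nonunit has a proper divisor that is again a nonunit, and iterating from
    [s] contradicts [chain_bounded]. *)
Lemma nonunit_generator : exists t, [/\ t != 0, nonunit t & forall y, nonunit y -> A (y / t)].
Proof.
apply: contrapT => hgen.
have /choice [g hg] : forall t, exists y, t != 0 /\ nonunit t ->
    [/\ y != 0, nonunit y & nonunit (t / y)].
  move=> t; have [[t0 nt]|h'] := pselect (t != 0 /\ nonunit t); last by exists 0.
  have [y [ny yt]] : exists y, nonunit y /\ ~ A (y / t).
    apply: contrapT => hy; apply: hgen; exists t; split=> // y ny.
    by apply: contrapT => hyt; apply: hy; exists y.
  have y0 : y != 0.
    by apply/eqP => y0; apply: yt; rewrite y0 mul0r; apply: (subalg0 sA).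
  exists y => _; split=> //; have [//|] := tot (y / t).
  by rewrite invfM invrK mulrC => ty; split=> //; right; rewrite invfM invrK mulrC.
pose f n := iter n g s.
have hf n : f n != 0 /\ nonunit (f n).
  by elim: n => [|n IH]; [split=> //; exact: nonunit_s|have [] := hg _ IH].
have ff a d : nonunit (f a / f (a + d).+1).
  elim: d => [|d IH]; first by rewrite addn0; have [] := hg _ (hf a).
  rewrite addnS; have -> : f a / f (a + d).+2 = f a / f (a + d).+1 * (f (a + d).+1 / f (a + d).+2).
    by rewrite mulrA divfK //; have [] := hf (a + d).+1.
  by apply: nonunitM => //; have [_ _ []] := hg _ (hf (a + d).+1).
have [R hR] := chain_bounded s0 As.
(* The iterates divide their predecessors, so the order is reversed; [s] itself, of index 0, is left
   out. *)
have := hR R.+1 (fun i => f (R.+1 - i)%N); rewrite ltnn => h'; suff: false by [].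
apply: h' => [i iR|i iR|i l /andP [il lR]].
- by have [? []] := hf (R.+1 - i)%N.
- by have := ff 0%N (R - i)%N; rewrite add0n -subSn.
have := ff (R.+1 - l)%N (l - i).-1.
by have -> : ((R.+1 - l) + (l - i).-1).+1 = (R.+1 - i)%N by lia.
Qed.

Section Generator.
Variable t : F.
Hypotheses (t0 : t != 0) (nt : nonunit t) (gt : forall y, nonunit y -> A (y / t)).

(** Otherwise all powers of [t] are proper divisors of [x], a chain of unbounded length. *)
Lemma generator_power x : x != 0 -> A x -> exists n, isunit (x / t ^+ n).
Proof.
move=> x0 Ax; apply: contrapT => hx.
have hA n : A (x / t ^+ n).
  elim: n => [|n IH]; first by rewrite expr0 divr1.
  have [ux|nx] := unit_or_nonunit IH; first by case: hx; exists n.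
  by have := gt nx; rewrite exprSr invfM mulrA.
have hn n : nonunit (x / t ^+ n).
  by have [ux|//] := unit_or_nonunit (hA n); case: hx; exists n.
have tn i : A (t ^+ i) by apply: (subalgX sA); case: nt.
have [R hR] := chain_bounded x0 Ax.
have := hR R.+1 (fun i => t ^+ i); rewrite ltnn => h'; suff: false by [].
apply: h' => [i iR|i iR|i l /andP [il lR]] //; first by rewrite expf_neq0.
rewrite -expfB //; have -> : (l - i = (l - i).-1.+1)%N by lia.
by rewrite exprS; apply: nonunitM.
Qed.

Lemma generator_val : exists v : F -> int, [/\ is_dval v, forall c, v (cst c) = 0 &
  forall x, x != 0 -> nonunit x -> 0 < v x].
Proof.
have tz m : t ^ m != 0 by rewrite expfz_neq0.
have ex x : exists m : int, if x == 0 then m = 0 else isunit (x / t ^ m).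
  have [x0|x0] := eqVneq x 0; first by exists 0.
  have [Ax|Ax] := tot x; first by have [n hn] := generator_power x0 Ax; exists n%:Z.
  have [|n hn] := generator_power _ Ax; first by rewrite invr_eq0.
  exists (- n%:Z); rewrite -invr_expz invrK.
  by have := isunitV hn; rewrite invfM !invrK.
have [v hv] := choice ex; exists v.
have v0 : v 0 = 0 by have := hv 0; rewrite eqxx.
have vu x : x != 0 -> isunit (x / t ^ v x) by move=> x0; have := hv x; rewrite (negPf x0).
have tpos m : 0 < m -> nonunit (t ^ m).
  case: m => // -[|m] // _; rewrite -exprnP exprS.
  by apply: nonunitM => //; apply: (subalgX sA); case: nt.
have uniq m : isunit (t ^ m) -> m = 0.
  move=> um; have [m0|m0|//] := ltgtP m 0; last by case: (unit_nonunit um); apply: tpos.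
  case: (unit_nonunit (isunitV um)); rewrite invr_expz; apply: tpos; lia.
have vE x m : x != 0 -> isunit (x / t ^ m) -> v x = m.
  move=> x0 ux; have := isunitM (isunitV (vu x x0)) ux.
  have -> : (x / t ^ v x)^-1 * (x / t ^ m) = t ^ (v x - m).
    rewrite expfzDr // -invr_expz invfM invrK; by field; rewrite x0 tz.
  by move=> /uniq; lia.
split.
- split=> // [x y x0 y0|x y x0 y0 xy0|].
  + apply: vE; first by rewrite mulf_neq0.
    by rewrite expfzDr // invfM mulrACA; apply: isunitM; apply: vu.
  + wlog xy : x y x0 y0 xy0 / v x <= v y.
      move=> hw; have [xy|/ltW yx] := leP (v x) (v y).
        by have := hw x y x0 y0 xy0 xy; rewrite (min_idPl xy).
      have := hw y x y0 x0; rewrite addrC => /(_ xy0 yx).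
      by rewrite (min_idPl yx).
    rewrite minEle xy leNgt; apply/negP => hlt.
    have uxy := vu _ xy0.
    have hA : A ((x + y) / t ^ v x).
      rewrite mulrDl; apply: (subalgD sA); first by have [] := vu x x0.
      have -> : y / t ^ v x = y / t ^ v y * t ^ (v y - v x).
        by rewrite expfzDr // -invr_expz mulrA divfK.
      apply: (subalgM sA); first by have [] := vu y y0.
      have : 0 <= v y - v x by lia.
      by case: (v y - v x) => // n _; apply: (subalgX sA); case: nt.
    apply: (unit_nonunit uxy).
    have -> : (x + y) / t ^ v (x + y) = t ^ (v x - v (x + y)) * ((x + y) / t ^ v x).
      by rewrite expfzDr // -invr_expz; field; rewrite !tz.
    by apply: nonunitM => //; apply: tpos; lia.
  exists t => //; apply: vE => //; rewrite expr1z divff //.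
  by rewrite -(rmorph1 cst); apply: isunit_cst; apply: oner_neq0.
- move=> c; have [->|c0] := eqVneq c 0; first by rewrite rmorph0.
  by apply: vE; rewrite ?fmorph_eq0 // expr0z divr1; apply: isunit_cst.
move=> x x0 nx; rewrite ltNge; apply/negP => vx.
have := vu x x0; move/unit_nonunit; apply.
rewrite invr_expz; apply: nonunitM => //.
have : 0 <= - v x by lia.
by case: (- v x) => // n _; apply: (subalgX sA); case: nt.
Qed.

End Generator.

Lemma discrete_valuation : exists p : point F, 0 < p s.
Proof.
have [t [t0 nt gt]] := nonunit_generator.
have [v [vP vc vpos]] := generator_val t0 nt gt.
exists (Point vP vc); exact: (vpos s s0 nonunit_s).
Qed.

End DiscreteValuation.

(** * Zeros and poles of nonconstant functions *)

Section Poles.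
Variables (k : closedFieldType) (F : funField k).
Local Notation cst := (ff_cst F).
Local Notation pv := (pev cst).

Lemma pev_transcendental (s : F) q : (forall c, s != cst c) -> q != 0 -> pv s q != 0.
Proof.
move=> sc q0; have [r ->] := closed_field_poly_normal q.
rewrite pevZ mulf_neq0 ?fmorph_eq0 ?lead_coef_eq0 // rmorph_prod.
rewrite prodf_seq_neq0; apply/allP => c _.
by rewrite rmorphB /= pevX pevC subr_eq0.
Qed.

(** The subalgebra k[s] does not contain the inverse of [s], which is transcendental. A maximal
    subalgebra containing [s] but not its inverse is the ring of a point where [s] vanishes. *)
Lemma exists_zero (s : F) : (forall c, s != cst c) -> exists p : point F, 0 < p s.
Proof.
move=> sc; have s0 : s != 0 by rewrite -(rmorph0 cst).
pose good (A : set F) := [/\ subalgebra A, A s & ~ A s^-1].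
pose A0 : set F := [set x | exists q, pv s q = x].
have gA0 : good A0.
  split.
  - split=> [c|_ _ [p <-] [q <-]|_ _ [p <-] [q <-]]; first by exists c%:P; rewrite pevC.
      by exists (p + q); rewrite rmorphD.
    by exists (p * q); rewrite rmorphM.
  - by exists 'X; rewrite pevX.
  move=> [q qs]; have : pv s ('X * q - 1) = 0.
    by rewrite rmorphB rmorphM rmorph1 /= pevX qs divff ?subrr.
  apply/eqP/(pev_transcendental sc); apply/eqP => /polyP /(_ 0%N).
  by rewrite coefB coefXM coef1 coef0 /= sub0r => /eqP; rewrite oppr_eq0 oner_eq0.
have [A [gA Amax]] : exists A, (A = set0 \/ good A) /\
    forall B, A `<` B -> ~ (B = set0 \/ good B).
  apply: Zorn_bigcup => C Cg Ctot.
  have [[X [CX gX]]|hX] := pselect (exists X, C X /\ good X); last first.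
    left; apply/seteqP; split=> // x [X CX Xx].
    by have [X0|gX] := Cg X CX; [rewrite X0 in Xx|case: hX; exists X].
  have goodX Y y : C Y -> Y y -> good Y.
    by move=> CY Yy; have [Y0|//] := Cg Y CY; rewrite Y0 in Yy.
  have join x y Y Z : C Y -> C Z -> Y x -> Z y -> exists W, [/\ C W, good W, W x & W y].
    move=> CY CZ Yx Zy; have [YZ|ZY] := Ctot Y Z CY CZ.
      by exists Z; split=> //; [apply: goodX Zy|apply: YZ].
    by exists Y; split=> //; [apply: goodX Yx|apply: ZY].
  right; split.
  - split=> [c|x y [Y CY Yx] [Z CZ Zy]|x y [Y CY Yx] [Z CZ Zy]].
    + by exists X => //; case: gX => sX _ _; apply: (subalgC sX).
    + have [W [CW [sW _ _] Wx Wy]] := join _ _ _ _ CY CZ Yx Zy.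
      by exists W => //; apply: (subalgD sW).
    have [W [CW [sW _ _] Wx Wy]] := join _ _ _ _ CY CZ Yx Zy.
    by exists W => //; apply: (subalgM sW).
  - by exists X => //; case: gX.
  by move=> [Y CY Ys]; have [_ _] := goodX _ _ CY Ys.
have {}gA : good A.
  case: gA => // A_0; case: (Amax A0); last by right.
  rewrite A_0; split; first by move=> x.
  by move=> /(_ s); apply; case: gA0.
have [sA As As'] := gA.
have {}Amax B : subalgebra B -> A `<=` B -> ~ B s^-1 -> B `<=` A.
  move=> sB AB Bs'; apply: contrapT => BA; apply: (Amax B); first by split.
  by right; split=> //; apply: AB.
have hs : s^-1 * s = 1 by rewrite mulVf.
exact: (discrete_valuation sA (maximal_total sA hs As As' Amax) As s0 As').
Qed.

Lemma exists_pole (h : F) : (forall c, h != cst c) -> exists p : point F, p h < 0.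
Proof.
move=> hc; have [c|p] := @exists_zero h^-1.
  apply/eqP => hE; have := hc c^-1; rewrite fmorphV -hE invrK; exact/negP/negPn.
by rewrite (dvalV (pt_dval p)) => hp; exists p; lia.
Qed.

End Poles.

(** * Degrees of divisors *)

Lemma card_sigma_ord n (e : 'I_n -> nat) : #|{: {i : 'I_n & 'I_(e i)}}| = (\sum_i e i)%N.
Proof.
rewrite card_tagged sumnE big_map big_enum /=.
by apply: eq_bigr => i _; rewrite card_ord.
Qed.

Lemma fsbig_list (R : nmodType) (T : choiceType) (f : T -> R) (S : seq T) : uniq S ->
  (forall x, f x != 0 -> x \in S) -> \sum_(x \in [set: T]) f x = \sum_(x <- S) f x.
Proof.
move=> uS fS; rewrite (fsbigE S) //; last first.
  by move=> x _ xS; apply/eqP/negPn/negP => /fS; rewrite (negPf xS).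
by apply: eq_bigl => x; rewrite in_setT.
Qed.

Lemma sum_seq_ord (T : eqType) (R : nmodType) (x0 : T) (S : seq T) (f : T -> R) :
  \sum_(i < size S) f (nth x0 S i) = \sum_(x <- S) f x.
Proof. by rewrite (big_nth x0) big_mkord. Qed.

Section DivisorDegree.
Variables (k : closedFieldType) (F : funField k).
Local Notation cst := (ff_cst F).
Local Notation pv := (pev cst).

(** Zeros counted with multiplicity give a family free over k[h] of that size, while
    [poly_free_bounded] limits such families. *)
Lemma zeros_bounded (h : F) : exists R, forall S : seq (point F), uniq S ->
  (forall p, p \in S -> 0 < p h) -> (\sum_(p <- S) absz (p h) <= R)%N.
Proof.
have [R hR] := poly_free_bounded h; exists R => -[|p0 S'] uS hS; first by rewrite big_nil.
set S := p0 :: S' in uS hS *.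
have [|||u hu] := @zeros_poly_free _ _ (size S) (fun i => nth p0 S i)
    (fun i => absz (nth p0 S i h)) h.
- by move=> i j /eqP; rewrite nth_uniq // => /eqP /val_inj.
- by move=> i; rewrite absz_gt0 gt_eqF // hS // mem_nth.
- by move=> i; rewrite gez0_abs // ltW // hS // mem_nth.
have := hR _ u hu; rewrite card_sigma_ord.
by rewrite -(sum_seq_ord p0 S (fun p => absz (p h) : nat)).
Qed.

Lemma zeros_finite (h : F) : finite_set [set p : point F | 0 < p h].
Proof.
have [R hR] := zeros_bounded h; apply: contrapT => /(@infinite_set_fset _ _ R.+1) [B BA].
have hB p : p \in enum_fset B -> 0 < p h by move=> pB; apply: BA.
have := hR _ (fset_uniq B) hB; move: hB; case: B {BA} => /= S _ hS hSR.
rewrite ltnNge; move/negP; apply; apply: leq_trans hSR.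
rewrite -sum1_size !big_seq; apply: leq_sum => p /hS; lia.
Qed.

Lemma zeros_list (h : F) : exists S : seq (point F), uniq S /\ forall p : point F, (p \in S) = (0 < p h).
Proof.
have /finite_seqP [S SE] := zeros_finite h; exists (undup S); rewrite undup_uniq.
split=> // p; rewrite mem_undup; apply/idP/idP => hp.
  have : [set` S] p by []; by rewrite -SE.
by have : [set p : point F | 0 < p h] p by []; rewrite SE.
Qed.

Definition zeros (h : F) : seq (point F) :=
  xget [::] [set S : seq (point F) | uniq S /\ forall p : point F, (p \in S) = (0 < p h)].

Lemma zerosP h : uniq (zeros h) /\ forall p : point F, (p \in zeros h) = (0 < p h).
Proof. exact: (@xgetPex _ [::] [set S : seq (point F) | uniq S /\ forall p : point F, (p \in S) = (0 < p h)] (zeros_list h)). Qed.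

Definition zero_degree (h : F) : nat := (\sum_(p <- zeros h) absz (p h))%N.

Definition pole_order (p : point F) (h : F) : nat := if p h < 0 then absz (p h) else 0%N.

Lemma pole_order_ge (p : point F) h : val_ge p (- (pole_order p h)%:Z) h.
Proof. by right; rewrite /pole_order; case: ltP => hp; lia. Qed.

Lemma pole_order_zeros (p : point F) h : pole_order p h != 0%N -> p \in zeros h^-1.
Proof.
rewrite (zerosP _).2 (dvalV (pt_dval p)) /pole_order.
by case: ltP => //; lia.
Qed.

Lemma sum_pole_order h (S : seq (point F)) : uniq S -> {subset zeros h^-1 <= S} ->
  (\sum_(p <- S) pole_order p h)%N = zero_degree h^-1.
Proof.
move=> uS hS; rewrite /zero_degree.
have -> : (\sum_(p <- zeros h^-1) absz (p h^-1) = \sum_(p <- zeros h^-1) pole_order p h)%N.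
  rewrite !big_seq; apply: eq_bigr => p; rewrite (zerosP _).2 (dvalV (pt_dval p)) /pole_order.
  by rewrite oppr_gt0 abszN => ->.
have [uZ _] := zerosP h^-1.
rewrite -(@fsbig_list nat _ (pole_order^~ h) (zeros h^-1)) //; last first.
  by move=> p ph; apply: pole_order_zeros ph.
rewrite -(@fsbig_list nat _ (pole_order^~ h) S) //.
by move=> p /pole_order_zeros /hS.
Qed.

(* A function vanishing at [p0] whose poles are bounded by the divisor [a] is
   determined by its principal parts, and these satisfy [\sum a] linear
   conditions. *)
Lemma bounded_poles_relation (p0 : point F) (S : seq (point F)) (a : point F -> nat)
    (I : finType) (z : I -> F) : uniq S -> p0 \in S -> (forall p, p \notin S -> a p = 0%N) ->
  (forall i (p : point F), val_ge p (- (a p)%:Z) (z i)) -> ((\sum_(p <- S) a p).+1 < #|I|)%N ->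
  exists c : I -> k, (exists i, c i != 0) /\ \sum_i cst (c i) * z i = 0.
Proof.
(* The extra condition at [p0] is the vanishing there, which excludes nonzero constants. *)
move=> uS p0S aS za SI; pose b (p : point F) := (a p + (p == p0))%N.
have /choice [t ht] : forall p : point F, exists t, t != 0 /\ p t = 1.
  by move=> p; have [t t0 pt] := dval_unif (pt_dval p); exists t.
have ptX (p : point F) n : p (t p ^+ n) = n%:Z.
  by have [t0 pt] := ht p; rewrite (dvalX (pt_dval p)) // pt natz.
have tX0 (p : point F) n : t p ^+ n != 0 by rewrite expf_neq0 //; have [] := ht p.
(* The polynomial records the principal part at the point, together with the constant term at
   [p0]. *)
have /choice [q hq] : forall x : I * point F, exists q : {poly k}, (size q <= b x.2)%N /\
    val_ge x.2 (b x.2)%:Z (z x.1 * t x.2 ^+ a x.2 - pev cst (t x.2) q).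
  move=> [i p] /=; have [_ pt] := ht p.
  have [|q qs hq] := pev_approx (pt_dval p) (b p) (@point_residue _ _ p) pt
      (z := z i * t p ^+ a p); last by exists q.
  have := (val_ge_mulr (pt_dval p) (- (a p)%:Z) (z i) (tX0 p (a p))).1 (za i p).
  by rewrite ptX addNr.
have [|c [ci hc]] := @linear_relation k I {m : 'I_(size S) & 'I_(b (nth p0 S m))}
   (fun i x => (q (i, nth p0 S (tag x)))`_(tagged x)).
  rewrite card_sigma_ord; have -> : (\sum_(m < size S) b (nth p0 S m) = (\sum_(p <- S) a p).+1)%N.
    transitivity (\sum_(p <- S) b p)%N; first exact: (sum_seq_ord p0 S b).
    rewrite big_split -addn1 /=; congr addn.
    transitivity (count_mem p0 S); last by rewrite count_uniq_mem // p0S.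
    by rewrite -sum1_count [RHS]big_mkcond; apply: eq_bigr => p _ /=; case: (p == p0).
  by [].
exists c; split=> //; set y := \sum_i _.
have yS (p : point F) : p \in S -> val_ge p (b p - a p)%:Z y.
  move=> pS; have pP := pt_dval p; have ib : (index p S < size S)%N by rewrite index_mem.
  have q0 : \sum_i c i *: q (i, p) = 0.
    apply/polyP => l; rewrite coef0 coef_sum; under eq_bigr do rewrite coefZ.
    have [lb|lb] := ltnP l (b p); last first.
      by rewrite big1 // => i _; rewrite nth_default ?mulr0 // (leq_trans (hq (i, p)).1).
    have lb' : (l < b (nth p0 S (Ordinal ib)))%N by rewrite /= nth_index.
    by have := hc (Tagged (fun m : 'I_(size S) => 'I_(b (nth p0 S m))) (Ordinal lb')); rewrite /= nth_index.
  have h1 : val_ge p (b p)%:Z (y * t p ^+ a p).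
    have -> : y * t p ^+ a p = \sum_i cst (c i) * (z i * t p ^+ a p - pev cst (t p) (q (i, p))).
      under [RHS]eq_bigr do rewrite mulrBr -pevZ.
      rewrite sumrB -rmorph_sum q0 rmorph0 subr0 mulr_suml.
      by apply: eq_bigr => i _; rewrite mulrA.
    apply: (val_ge_sum pP) => i _; apply: (val_ge0M pP); last exact: (hq (i, p)).2.
    exact: (val_ge_cst (point_cst p)).
  apply/(val_ge_mulr pP _ _ (tX0 p (a p))); apply: val_ge_le h1; rewrite ptX /b; lia.
have y0 (p : point F) : val_ge p 0 y.
  have [pS|pS] := boolP (p \in S); first by apply: val_ge_le (yS p pS).
  apply: (val_ge_sum (pt_dval p)) => i _; apply: (val_ge0M (pt_dval p)).
    exact: (val_ge_cst (point_cst p)).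
  by have := za i p; rewrite aS.
(* The combination [y] has no poles, so it is constant, and its zero at [p0] makes it 0. *)
have [yc|yc] := pselect (forall c, y != cst c).
  have [p py] := exists_pole yc; case: (y0 p) => [yE|]; last by lia.
  by have := yc 0; rewrite yE rmorph0 eqxx.
have [d yd] : exists d, y = cst d.
  by apply: contrapT => hd; apply: yc => d; apply/eqP => yd; apply: hd; exists d.
have := yS p0 p0S; rewrite /b eqxx addKn yd => /(val_ge_cst_eq0 (point_cst p0) ltr01) ->.
by rewrite rmorph0.
Qed.

Lemma poly_free_nonconst (h : F) (I : finType) (u : I -> F) : poly_free h u -> (0 < #|I|)%N ->
  forall c, h != cst c.
Proof.
move=> hu /card_gt0P [i _] c; apply/eqP => hc.
suff : 'X - c%:P = 0 :> {poly k} by move/eqP; rewrite polyXsubC_eq0.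
by apply: (hu (fun=> 'X - c%:P) _ i); rewrite big1 // => l _; rewrite rmorphB /= pevX pevC hc subrr mul0r.
Qed.

(** The products of the [u i] with the powers of [h] up to [L] are independent over [k]. Their poles
    are bounded by [L] times the poles of [h] plus a fixed divisor. Letting [L] grow compares the
    leading terms of both counts. *)
Lemma poly_free_card (h : F) (I : finType) (u : I -> F) : poly_free h u ->
  (#|I| <= zero_degree h^-1)%N.
Proof.
move=> hu; have [->//|I0] := posnP #|I|.
have [p0 _] := exists_pole (poly_free_nonconst hu I0).
pose S := undup (p0 :: zeros h^-1 ++ flatten [seq zeros (u i)^-1 | i <- enum I]).
pose C (p : point F) := (\sum_i pole_order p (u i))%N.
(* With z the number of poles of [h], this makes (z + 1)(L + 1) exceed the number of conditions, L z
   plus the degree of [C] plus 1. *)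
pose L := (\sum_(p <- S) C p).+1.
pose a (p : point F) := (L * pole_order p h + C p)%N.
rewrite leqNgt; apply/negP => hI.
have uS : uniq S by rewrite undup_uniq.
have hS : {subset zeros h^-1 <= S}.
  by move=> p ph; rewrite mem_undup inE mem_cat ph orbT.
have CS p : p \notin S -> C p = 0%N.
  move=> pS; apply: big1 => i _; apply/eqP/negPn/negP => /pole_order_zeros pu.
  move/negP: pS; apply; rewrite mem_undup inE mem_cat; apply/orP; right; apply/orP; right.
  by apply/flattenP; exists (zeros (u i)^-1) => //; apply: map_f; rewrite mem_enum.
have [||||c [[x cx] hc]] := @bounded_poles_relation p0 S a (I * 'I_L.+1)%type
    (fun x => u x.1 * h ^+ x.2) uS.
- by rewrite mem_undup mem_head.
- move=> p pS; rewrite /a CS // addn0; apply/eqP; rewrite muln_eq0; apply/orP; right.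
  by apply/negPn/negP => /pole_order_zeros /hS; rewrite (negPf pS).
- move=> [i l] p /=; have pP := pt_dval p.
  apply: val_ge_le (val_geM pP (pole_order_ge p (u i)) (val_geX pP l (pole_order_ge p h))).
  rewrite /a -mulr_natr natz mulNr -PoszM [(pole_order p h * l)%N]mulnC.
  have h1 : (pole_order p (u i) <= C p)%N by rewrite /C (bigD1 i) //= leq_addr.
  have h2 : (l * pole_order p h <= L * pole_order p h)%N by rewrite leq_mul2r -ltnS ltn_ord orbT.
  move: (L * _)%N (l * _)%N (pole_order p (u i)) (C p) h1 h2 => x y u' w; lia.
- rewrite card_prod card_ord /a big_split /= -big_distrr /= (sum_pole_order uS hS).
  have : ((zero_degree h^-1).+1 * L.+1 <= #|I| * L.+1)%N by rewrite leq_mul2r hI orbT.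
  rewrite -/L mulSn [(zero_degree _ * _)%N]mulnC [(L.+1 * _)%N]mulSn /L.
  move: (\sum_(p <- S) C p)%N (zero_degree _) #|I| => x y w.
  by move: (x.+1 * y)%N (w * x.+2)%N => m m'; lia.
by move/eqP: cx; apply; apply: (poly_free_cst hu).
Qed.

Lemma zero_degree_free (h : F) : exists (I : finType) (u : I -> F),
  poly_free h u /\ #|I| = zero_degree h.
Proof.
have [uZ hZ] := zerosP h; rewrite /zero_degree; case: (zeros h) uZ hZ => [|p0 S'].
  by exists void, (fun=> 0); rewrite big_nil card_void; split=> // q _ [].
set S := p0 :: S' => uS hS.
have hS' i : (i < size S)%N -> 0 < nth p0 S i h by move=> iS; rewrite -hS mem_nth.
have [|||u hu] := @zeros_poly_free _ _ (size S) (fun i => nth p0 S i)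
    (fun i => absz (nth p0 S i h)) h.
- by move=> i j /eqP; rewrite nth_uniq // => /eqP /val_inj.
- by move=> i; rewrite absz_gt0 gt_eqF // hS'.
- by move=> i; rewrite gez0_abs // ltW // hS'.
exists _, u; split=> //; rewrite card_sigma_ord.
exact: (sum_seq_ord p0 S (fun p => absz (p h) : nat)).
Qed.

(** The free family built at the zeros is bounded by the number of poles; applied to the inverse,
    this gives the other inequality. *)
Lemma zero_degreeV (h : F) : zero_degree h^-1 = zero_degree h.
Proof.
have le x : (zero_degree x <= zero_degree x^-1)%N.
  by have [I [u [hu <-]]] := zero_degree_free x; apply: poly_free_card hu.
by apply/eqP; rewrite eqn_leq le andbT -{2}(invrK h) le.
Qed.

Lemma principal_list (h : F) : exists S : seq (point F), uniq S /\ forall p : point F, p h != 0 -> p \in S.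
Proof.
exists (undup (zeros h ++ zeros h^-1)); rewrite undup_uniq; split=> // p ph.
rewrite mem_undup mem_cat !(zerosP _).2 (dvalV (pt_dval p)); lia.
Qed.

Lemma principal_degree (h : F) : \sum_(p \in [set: point F]) p h = 0.
Proof.
pose S := undup (zeros h ++ zeros h^-1).
have uS : uniq S by rewrite undup_uniq.
rewrite (@fsbig_list _ _ (fun p : point F => p h) S) //; last first.
  by move=> p ph; rewrite mem_undup mem_cat !(zerosP _).2 (dvalV (pt_dval p)); lia.
have -> : \sum_(p <- S) p h = \sum_(p <- S) ((pole_order p h^-1)%:Z - (pole_order p h)%:Z).
  apply: eq_bigr => p _; rewrite /pole_order (dvalV (pt_dval p)).
  rewrite oppr_lt0 abszN; move: (p h) => x; case: (ltgtP 0 x) => [x0|x0|<-].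
  - by rewrite gtz0_abs // subr0.
  - by rewrite ltz0_abs // sub0r opprK.
  by rewrite subrr.
rewrite sumrB -!(big_morph Posz PoszD (erefl _)) !sum_pole_order //.
- by rewrite invrK zero_degreeV subrr.
- by move=> p hp; rewrite mem_undup mem_cat hp orbT.
by move=> p; rewrite invrK => hp; rewrite mem_undup mem_cat hp.
Qed.

End DivisorDegree.

(** * Fibers of coverings *)

Lemma partition_big_seq (R : nmodType) (T U : eqType) (phi : T -> U) (f : T -> R)
    (S : seq T) (S' : seq U) : uniq S' -> (forall y, y \in S -> phi y \in S') ->
  \sum_(y <- S) f y = \sum_(x <- S') \sum_(y <- S | phi y == x) f y.
Proof.
move=> uS' hS; under [RHS]eq_bigr do rewrite big_mkcond.
rewrite exchange_big /= !big_seq; apply: eq_bigr => y yS.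
rewrite (bigD1_seq _ (hS y yS)) //= eqxx big1 ?addr0 // => x.
by rewrite eq_sym => /negPf ->.
Qed.

Section Fibers.
Variables (k : closedFieldType) (E F : funField k) (j : {rmorphism E -> F}) (n : nat).
Hypotheses (jc : forall c, j (ff_cst E c) = ff_cst F c) (jn : ext_has_degree j n).
Variables (phi : point F -> point E) (e : point F -> nat).
Hypotheses (e0 : forall y, (0 < e y)%N) (ye : forall (y : point F) a, y (j a) = phi y a *+ e y).

Let yeE (y : point F) a : y (j a) = phi y a * (e y)%:Z. Proof. by rewrite ye -mulr_natr natz. Qed.

Lemma pev_morph h q : j (pev (ff_cst E) h q) = pev (ff_cst F) (j h) q.
Proof.
elim/poly_ind: q => [|q c IH]; first by rewrite !rmorph0.
by rewrite !rmorphD !rmorphM /= !pevX !pevC IH jc.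
Qed.

Lemma poly_free_ext (h : E) (I : finType) (u : I -> E) (b : 'I_n -> F) : is_ext_basis j b ->
  poly_free h u -> poly_free (j h) (fun x : I * 'I_n => j (u x.1) * b x.2).
Proof.
move=> bP uP q q0 [i l]; apply: (uP (fun i => q (i, l))).
pose M : 'rV[E]_n := \row_l \sum_i pev (ff_cst E) h (q (i, l)) * u i.
suff /rowP /(_ l) : M = 0 by rewrite !mxE.
apply: (ext_basis_inj bP) => r; rewrite {r}(ord1 r).
transitivity (0 : F); last by rewrite big1 // => l' _; rewrite mxE rmorph0 mul0r.
rewrite -[RHS]q0; transitivity (\sum_l \sum_i pev (ff_cst F) (j h) (q (i, l)) * (j (u i) * b l)).
  apply: eq_bigr => l' _; rewrite mxE rmorph_sum mulr_suml; apply: eq_bigr => i' _.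
  by rewrite rmorphM /= pev_morph mulrA.
by rewrite exchange_big pair_bigA /=; apply: eq_bigr => -[].
Qed.

(** More than [n] elements are linearly dependent over [E]. Dividing a relation by a coefficient of
    least valuation at [x] contradicts [independent_family], the values of [E] at [y] being
    multiples of [e y]. *)
Lemma fiber_le (x : point E) (Y : seq (point F)) : uniq Y -> (forall y, y \in Y -> phi y = x) ->
  (\sum_(y <- Y) e y <= n)%N.
Proof.
case: Y => [|y0 Y']; first by rewrite big_nil.
set Y := y0 :: Y' => uY hY; rewrite leqNgt; apply/negP => hn.
pose p (i : 'I_(size Y)) := nth y0 Y i; have pY i : phi (p i) = x by apply: hY; rewrite mem_nth.
have p_inj : injective p by move=> i l /eqP; rewrite nth_uniq // => /eqP /val_inj.
have [u hu] := independent_family (fun i => e (p i)) p_inj.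
have [b bP] := jn; pose T : finType := {m : 'I_(size Y) & 'I_(e (p m))}.
have [P PE] := ext_basis_coord (fun i : 'I_#|T| => u (enum_val i)) bP.
have [|c [[i ci] hc]] := @linear_relation E T 'I_n (fun i l => P (enum_rank i) l) _.
  by rewrite card_ord card_sigma_ord (sum_seq_ord y0 Y (fun y => e y : nat)).
pose i1 := [arg min_(l < i | c l != 0) x (c l)]%O.
have [c1 cmin] : c i1 != 0 /\ forall l, c l != 0 -> x (c i1) <= x (c l).
  by rewrite /i1; case: arg_minP.
apply: (hu (fun i => j (c i / c i1))).
- move=> l m; have [->|cl] := eqVneq (c l) 0; first by left; rewrite mul0r rmorph0.
  right; exists (absz (x (c l / c i1))); rewrite yeE pY gez0_abs //.
  rewrite (dvalM (pt_dval x)) ?invr_eq0 // (dvalV (pt_dval x)).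
  by have := cmin l cl; lia.
- exists i1; rewrite divff // rmorph1 oner_neq0; split=> //.
  exact: (dval1 (pt_dval _)).
have jc0 : j (c i1) != 0 by rewrite fmorph_eq0.
apply: (mulfI jc0); rewrite mulr0 mulr_sumr.
transitivity (\sum_i \sum_l j (c i * P (enum_rank i) l) * b l).
  apply: eq_bigr => l _; rewrite mulrA -rmorphM mulrC /= mulrC mulrCA divff // mulr1.
  have := PE (enum_rank l); rewrite enum_rankK => ->.
  by rewrite mulr_sumr; apply: eq_bigr => m _; rewrite rmorphM mulrA.
rewrite exchange_big big1 //= => l _.
by rewrite -mulr_suml -rmorph_sum hc rmorph0 mul0r.
Qed.

(** For [h] a uniformizer at [x], a free family for [h] times a basis of the extension shows that
    [j h] has at least [n] times as many zeros as [h]. No fiber exceeds [n], so all fibers over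
    zeros of [h] attain it. *)
Lemma fiber_list (x : point E) : exists Y : seq (point F),
  [/\ uniq Y, forall y, (y \in Y) = (phi y == x) & (\sum_(y <- Y) e y)%N = n].
Proof.
have [h h0 xh] := dval_unif (pt_dval x).
have [uE hE] := zerosP h; have [uF hF] := zerosP (j h).
have hF' y : (y \in zeros (j h)) = (phi y \in zeros h).
  by rewrite hE hF yeE; have := e0 y; nia.
exists [seq y <- zeros (j h) | phi y == x]; rewrite filter_uniq //.
have memY y : (y \in [seq y <- zeros (j h) | phi y == x]) = (phi y == x).
  by rewrite mem_filter hF' hE; case: eqP => // ->; rewrite xh.
split=> //.
pose G x' := (\sum_(y <- zeros (j h) | phi y == x') e y)%N.
have Gle x' : (G x' <= n)%N.
  rewrite /G -big_filter; apply: (@fiber_le x'); first by rewrite filter_uniq.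
  by move=> y; rewrite mem_filter => /andP [/eqP].
have zF : zero_degree (j h) = (\sum_(x' <- zeros h) absz (x' h) * G x')%N.
  transitivity (\sum_(y <- zeros (j h)) absz (phi y h) * e y)%N.
    by apply: eq_bigr => y _; rewrite yeE abszM.
  rewrite -[LHS]/(\sum_(y <- zeros (j h)) (absz (phi y h) * e y)%N)%R.
  rewrite (@partition_big_seq nat _ _ phi _ _ (zeros h)) //; last by move=> y; rewrite hF'.
  apply: eq_bigr => x' _; rewrite /G big_distrr /=.
  by apply: eq_bigr => y /eqP ->.
have zn : (n * zero_degree h <= zero_degree (j h))%N.
  have [I [u [uP cI]]] := zero_degree_free h; have [b bP] := jn.
  have := poly_free_card (poly_free_ext bP uP).
  by rewrite card_prod card_ord cI zero_degreeV mulnC.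
apply/eqP; rewrite big_filter -/(G x) eqn_leq Gle /= leqNgt; apply/negP => Gn.
move: zn; rewrite leqNgt => /negP; apply.
have xE : x \in zeros h by rewrite hE xh.
rewrite zF /zero_degree mulnC big_distrl /= !(bigD1_seq x) //= xh !mul1n.
rewrite -addSn leq_add //; apply: leq_sum => x' _; by rewrite leq_mul2l Gle orbT.
Qed.

(** The degree of a pulled back divisor; integer coefficients serve for differentials, rational ones
    for branch data. *)
Lemma fiber_sum (R : comNzRingType) (g : point E -> R) (S : seq (point E)) : uniq S ->
    (forall x, g x != 0 -> x \in S) ->
  exists Y : seq (point F), [/\ uniq Y, forall y, (y \in Y) = (phi y \in S) &
    \sum_(y <- Y) g (phi y) * (e y)%:R = n%:R * \sum_(x <- S) g x].
Proof.
move=> uS gS; have [Z hZ] := choice fiber_list.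
pose Y := undup (flatten [seq Z x | x <- S]).
have memY y : (y \in Y) = (phi y \in S).
  rewrite mem_undup; apply/flattenP/idP => [[_ /mapP [x xS ->]]|yS].
    by have [_ -> _] := hZ x => /eqP ->.
  by exists (Z (phi y)); [apply: map_f|have [_ -> _] := hZ (phi y)].
exists Y; split=> //; first exact: undup_uniq.
rewrite (partition_big_seq (phi := phi) _ uS); last by move=> y; rewrite memY.
rewrite mulr_sumr !big_seq; apply: eq_bigr => x xS.
transitivity (g x * \sum_(y <- Y | phi y == x) (e y)%:R).
  by rewrite mulr_sumr; apply: eq_bigr => y /eqP ->.
rewrite mulrC; congr (_ * _); rewrite -natr_sum; congr (_%:R).
have [uZ memZ <-] := hZ x; rewrite -big_filter; apply: perm_big; apply: uniq_perm => //.
  by rewrite filter_uniq // undup_uniq.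
by move=> y; rewrite mem_filter memZ memY; case: eqP => // ->.
Qed.

End Fibers.

(** * Derivations of function fields *)

Lemma sum_multiples (V : nmodType) (p N : nat) (g : nat -> V) : (0 < p)%N ->
  (forall i, (N < i)%N -> g i = 0) -> (forall i, ~~ (p %| i)%N -> g i = 0) ->
  \sum_(i < N.+1) g (p * i)%N = \sum_(i < N.+1) g i.
Proof.
move=> p0 gN gp.
have -> : \sum_(i < N.+1) g i = \sum_(i < N.+1 * p) g i.
  rewrite -!(big_mkord xpredT g) [RHS](@big_cat_nat _ _ _ N.+1) //=; last by rewrite leq_pmulr.
  by rewrite [X in _ = _ + X]big_nat [X in _ = _ + X]big1 ?addr0 // => i /andP [Ni _]; apply: gN.
rewrite -(big_mkord xpredT g) big_nat_mul -(big_mkord xpredT (fun i => g (p * i)%N)).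
apply: eq_bigr => i _; rewrite big_ltn ?mulSn; last by rewrite -[X in (X < _)%N]add0n ltn_add2r.
rewrite mulnC /= big_nat big1 ?addr0 // => l /andP [il lp]; apply: gp.
apply/negP => /dvdnP [m lm]; move: il lp; rewrite lm -mulSn !ltn_mul2r p0 /= ltnS.
by move=> h1 h2; have := leq_trans h1 h2; rewrite ltnn.
Qed.

Lemma frobenius_sum (R : comNzRingType) (p : nat) (I : Type) (r : seq I) (P : pred I) (f : I -> R) :
  p \in [pchar R] -> (\sum_(i <- r | P i) f i) ^+ p = \sum_(i <- r | P i) f i ^+ p.
Proof. by move=> cp; rewrite -!(pFrobenius_autE cp) rmorph_sum. Qed.

Section AlgebraicDerivations.
Variables (k : closedFieldType) (F : funField k).
Local Notation cst := (ff_cst F).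
Local Notation pv := (pev cst).
Variables (t a : F).

(** The value of [P] at (t, a): the inner variable goes to [t], the outer one to [a]. *)
Definition biev (P : {poly {poly k}}) : F := (map_poly (pv t) P).[a].

Lemma biev_cons P c : biev (P * 'X + c%:P) = biev P * a + pv t c.
Proof.
by rewrite /biev rmorphD rmorphM /= map_polyX map_polyC hornerD hornerM hornerX hornerC.
Qed.

Lemma bievE n m (P : {poly {poly k}}) : (size P <= n)%N -> (forall i, (size (P`_i)%R <= m)%N) ->
  biev P = \sum_(i < n) \sum_(l < m) cst P`_i`_l * t ^+ l * a ^+ i.
Proof.
move=> sP sPi; rewrite /biev (@horner_coef_wide _ n) ?(leq_trans (size_poly _ _)) //.
apply: eq_bigr => i _; rewrite coef_map_id0 ?rmorph0 //.
by rewrite (pevE _ _ (sPi i)) mulr_suml.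
Qed.

Lemma der_biev (M : fieldType) (i : {rmorphism F -> M}) (D : F -> M) (P : {poly {poly k}}) :
  is_der cst i D ->
  D (biev P) = i (biev P^`()) * D a + i (biev (map_poly (fun q => q^`()) P)) * D t.
Proof.
move=> DP; elim/poly_ind: P => [|P c IH].
  rewrite deriv0 [map_poly (fun q : {poly k} => q^`()) 0]map_poly0.
  by rewrite /biev map_poly0 horner0 rmorph0 !mul0r addr0 (der0 DP).
rewrite biev_cons (derD DP) (derM DP) IH (der_pev DP).
have -> : (P * 'X + c%:P)^`() = P^`() * 'X + P.
  by rewrite derivD derivC addr0 derivM derivX mulr1.
have -> : map_poly (fun q : {poly k} => q^`()) (P * 'X + c%:P) =
    map_poly (fun q : {poly k} => q^`()) P * 'X + c^`()%:P.
  apply/polyP => l; rewrite coef_map_id0 ?deriv0 // !coefD !coefMX !coefC.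
  by case: l => [|l] /=; rewrite ?add0r ?addr0 ?coef_map_id0 ?deriv0.
rewrite biev_cons !rmorphD !rmorphM /= /biev rmorphD rmorphM /= map_polyX.
by rewrite hornerD hornerM hornerX rmorphD rmorphM /=; ring.
Qed.

Definition total_degree_le (N : nat) (P : {poly {poly k}}) :=
  forall i l, (N < i + l)%N -> P`_i`_l = 0.

Let tsize N P i : total_degree_le N P -> (size P <= N.+1)%N /\ (size (P`_i)%R <= N.+1)%N.
Proof.
move=> hP; split; apply/leq_sizeP => l Nl; last by apply: hP; rewrite (leq_trans Nl) ?leq_addl.
by apply/polyP => m; rewrite coef0 hP // (leq_trans Nl) ?leq_addr.
Qed.

Lemma exists_relation : exists P, P != 0 /\ biev P = 0.
Proof.
have [R hR] := poly_free_bounded t.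
have [q [q0 [i qi]]] : exists q : 'I_R.+1 -> {poly k},
    \sum_i pv t (q i) * a ^+ i = 0 /\ exists i, q i != 0.
  apply: contrapT => h; have := hR _ (fun i : 'I_R.+1 => a ^+ i).
  rewrite card_ord ltnn => fR; suff: false by []; apply: fR => q q0 i; apply: contrapT => qi.
  by apply: h; exists q; split=> //; exists i; apply/eqP.
pose P := \poly_(i < R.+1) q (inord i).
have PE (l : 'I_R.+1) : P`_l = q l by rewrite coef_poly ltn_ord inord_val.
exists P; split; first by apply: contra_neq qi => P0; rewrite -PE P0 coef0.
rewrite /biev (@horner_coef_wide _ R.+1) ?(leq_trans (size_poly _ _)) ?size_poly //.
by rewrite -[RHS]q0; apply: eq_bigr => l _; rewrite coef_map_id0 ?rmorph0 // PE.
Qed.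

(* A relation of minimal total degree that is inseparable in both variables
   would be a p-th power. *)
Lemma separable_relation (M : fieldType) (i : {rmorphism F -> M}) (D : F -> M) :
  is_der cst i D -> D t != 0 -> exists P, biev P = 0 /\ biev P^`() != 0.
Proof.
move=> DP Dt.
pose rel N := `[< exists P, [/\ P != 0, biev P = 0 & total_degree_le N P] >].
have exN : exists N, rel N.
  have [P [P0 EP]] := exists_relation.
  exists (size P + \max_(i < size P) size (P`_i)%R)%N; apply/asboolP; exists P; split=> // l m lm.
  have [lP|lP] := ltnP l (size P); last by rewrite [(P`_l)%R]nth_default ?coef0.
  have := leq_bigmax (F := fun i : 'I_(size P) => size (P`_i)%R) (Ordinal lP) => /= h.
  rewrite nth_default //; apply: leq_trans h _.
  by rewrite -ltnS -(ltn_add2l (size P)) (leq_trans lm) // leq_add // ltnW.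
case: (ex_minnP exN) => N /asboolP [P [P0 EP hP]] Nmin.
have lower Q : total_degree_le N.-1 Q -> (0 < N)%N -> biev Q = 0 -> Q = 0.
  move=> hQ N0 EQ; apply: contrapT => /eqP Q0.
  have /Nmin : rel N.-1 by apply/asboolP; exists Q.
  by rewrite leqNgt prednK ?leqnn.
have sP := (tsize 0 hP).1; have sPi i := (tsize i hP).2.
have N0 : (0 < N)%N.
  rewrite lt0n; apply/negP => /eqP NE; move: hP sP sPi; rewrite NE => hP sP sPi.
  have PE : P = (P`_0`_0)%:P%:P.
    apply/polyP => l; apply/polyP => m; rewrite !coefC.
    case: l => [|l]; last by rewrite /= coef0 hP.
    by rewrite /= coefC; case: m => // m; rewrite hP.
  move: EP; rewrite PE /biev map_polyC hornerC /= pevC => /eqP; rewrite fmorph_eq0 => /eqP P00.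
  by move/eqP: P0; apply; rewrite PE P00 !rmorph0.
exists P; split=> //; apply/eqP => EPA.
(* Both partial derivatives have smaller total degree and vanish at (t, a): one by assumption, the
   other because D(P(t, a)) = 0 and [D t] is nonzero. Minimality makes both of them zero. *)
have PA0 : P^`() = 0.
  by apply: lower => // l m lm; rewrite coef_deriv coefMn hP ?mul0rn //; lia.
have PT0 : map_poly (fun q : {poly k} => q^`()) P = 0.
  apply: lower => //.
    by move=> l m lm; rewrite coef_map_id0 ?deriv0 // coef_deriv hP ?mul0rn //; lia.
  have := der_biev P DP; rewrite EP EPA (der0 DP) rmorph0 mul0r add0r => /esym /eqP.
  by rewrite mulf_eq0 (negPf Dt) orbF fmorph_eq0 => /eqP.
have cA l m : P`_l`_m != 0 -> l%:R = 0 :> k.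
  move=> c0; case: l c0 => // l c0; have /polyP /(_ l) := PA0.
  rewrite coef_deriv coef0 => /polyP /(_ m); rewrite coefMn coef0 => /eqP.
  by rewrite -(mulr_natr (P`_l.+1`_m)) mulf_eq0 (negPf c0) => /eqP.
have cT l m : P`_l`_m != 0 -> m%:R = 0 :> k.
  move=> c0; case: m c0 => // m c0; have /polyP /(_ l) := PT0.
  rewrite coef_map_id0 ?deriv0 // coef0 => /polyP /(_ m).
  rewrite coef_deriv coef0 => /eqP.
  by rewrite -(mulr_natr (P`_l`_m.+1)) mulf_eq0 (negPf c0) => /eqP.
have [l [m [clm lm0]]] : exists l m, P`_l`_m != 0 /\ (0 < l + m)%N.
  apply: contrapT => h; move/eqP: P0; apply; apply: lower => //.
  move=> l m lm; apply/eqP/negPn/negP => c0; apply: h; exists l, m; split=> //.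
  exact: leq_ltn_trans lm.
have [p cp] : exists p, p \in [pchar k].
  have [l0|l0] := posnP l; last by apply: (natf0_pchar l0); rewrite (cA _ _ clm).
  have m0 : (0 < m)%N by rewrite l0 in lm0.
  by apply: (natf0_pchar m0); rewrite (cT _ _ clm).
have p0 : (0 < p)%N by rewrite prime_gt0 // (pcharf_prime cp).
have p1 : (1 < p)%N by rewrite prime_gt1 // (pcharf_prime cp).
have cpF : p \in [pchar F] by rewrite (fmorph_pchar cst).
(* All exponents in [P] are multiples of p. Taking p-th roots of the coefficients yields [Q] with
   Q(t, a)^p = P(t, a) = 0, of total degree at most N / p, against minimality. *)
have /choice [root hroot] : forall c : k, exists d, d ^+ p = c.
  move=> c; have [|d] := @closed_rootP k ('X^p - c%:P) _.
    by rewrite size_XnsubC // eqSS -lt0n.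
  by rewrite /root !hornerE subr_eq0 => /eqP; exists d.
have root0 : root 0 = 0.
  by have /eqP := hroot 0; rewrite expf_eq0 p0 /= => /eqP.
pose Q : {poly {poly k}} := \poly_(l < N.+1) \poly_(m < N.+1) root P`_(p * l)`_(p * m).
have coefQ l' m' : Q`_l'`_m' = root P`_(p * l')`_(p * m').
  have big x : (N.+1 <= x)%N -> (N < p * x)%N by move=> h; apply: (leq_trans h); rewrite leq_pmull.
  rewrite coef_poly; case: ltnP => [_|/big h]; last by rewrite coef0 hP ?root0 // ltn_addr.
  by rewrite coef_poly; case: ltnP => // /big h; rewrite hP ?root0 // ltn_addl.
have Q0 : Q != 0.
  have pl : (p %| l)%N by rewrite (dvdn_pcharf cp) (cA _ _ clm).
  have pm : (p %| m)%N by rewrite (dvdn_pcharf cp) (cT _ _ clm).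
  apply/eqP => Q0; have := coefQ (l %/ p)%N (m %/ p)%N.
  rewrite Q0 !coef0 ![(p * _)%N]mulnC !divnK // => /esym r0.
  by move: clm; rewrite -(hroot P`_l`_m) r0 expr0n; case: (p) p0 => // ? _; rewrite eqxx.
have hQ : total_degree_le N.-1 Q.
  move=> l' m' lm; rewrite coefQ hP ?root0 // -mulnDr.
  have : (2 * (l' + m') <= p * (l' + m'))%N by rewrite leq_mul2r p1 orbT.
  lia.
move/eqP: Q0; apply; apply: lower => //; apply/eqP.
have sQ l' : (size (Q`_l')%R <= N.+1)%N.
  by rewrite (leq_trans (tsize l' hQ).2) // prednK // leqnSn.
have [sQ1 _] := tsize 0 hQ; have {}sQ1 : (size Q <= N.+1)%N.
  by rewrite (leq_trans sQ1) // prednK // leqnSn.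
pose g l m : F := cst P`_l`_m * t ^+ m * a ^+ l.
have : biev Q ^+ p == 0.
  rewrite (bievE sQ1 sQ) frobenius_sum //.
  under eq_bigr => l' _ do rewrite frobenius_sum //.
  have E l' m' : (cst Q`_l'`_m' * t ^+ m' * a ^+ l') ^+ p = g (p * l')%N (p * m')%N.
    by rewrite coefQ !exprMn -rmorphXn hroot -!exprM ![(_ * p)%N]mulnC.
  under eq_bigr => l' _ do under eq_bigr => m' _ do rewrite E.
  have gdvd x y : ~~ ((p %| x) && (p %| y))%N -> g x y = 0.
    rewrite negb_and !(dvdn_pcharf cp) /g => xy.
    have [->|c0] := eqVneq P`_x`_y 0; first by rewrite rmorph0 !mul0r.
    by move: xy; rewrite (cA _ _ c0) (cT _ _ c0) eqxx.
  have gN x y : (N < x + y)%N -> g x y = 0 by move=> xy; rewrite /g hP // rmorph0 !mul0r.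
  rewrite (sum_multiples (N := N) (g := fun x => \sum_(m' < N.+1) g x (p * m')%N) p0).
  - apply/eqP; rewrite -[RHS]EP (bievE sP sPi); apply: eq_bigr => l' _.
    apply: (sum_multiples (g := g l') p0) => x hx; first by apply: gN; rewrite ltn_addl.
    by apply: gdvd; rewrite (negPf hx) andbF.
  - by move=> x Nx; rewrite big1 // => y _; apply: gN; rewrite ltn_addr.
  by move=> x px; rewrite big1 // => y _; apply: gdvd; rewrite (negPf px).
by rewrite expf_eq0 p0.
Qed.

End AlgebraicDerivations.

(** * Canonical divisors *)

Section Uniformizing.
Variables (k : closedFieldType) (F : funField k).
Local Notation cst := (ff_cst F).
Local Notation pv := (pev cst).

(** Implicit differentiation of a relation between [t] and [a]. The same [h] serves all derivations
    into all fields, in particular those of a completion restricted to [F]. *)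
Lemma der_ratio (M : fieldType) (i : {rmorphism F -> M}) (D : F -> M) (t a : F) :
  is_der cst i D -> D t != 0 -> exists h : F,
  forall (M' : fieldType) (i' : {rmorphism F -> M'}) (D' : F -> M'),
    is_der cst i' D' -> D' a = i' h * D' t.
Proof.
move=> DP Dt; have [P [EP EPA]] := separable_relation a DP Dt.
exists (- biev t a (map_poly (fun q => q^`()) P) / biev t a P^`()) => M' i' D' D'P.
have := der_biev t a P D'P; rewrite EP (der0 D'P) => /esym /eqP; rewrite addr_eq0 => /eqP h.
have iA0 : i' (biev t a P^`()) != 0 by rewrite fmorph_eq0.
by apply: (mulfI iA0); rewrite h fmorph_div rmorphN; field.
Qed.

(* [D] is the derivation d/dpi with respect to the uniformizer [pi] at [p]. *)
Definition uniformizing (p : point F) (pi : F) (D : F -> F) : Prop :=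
  [/\ p pi = 1, D pi = 1, is_der cst idfun D,
      forall a m, val_ge p m a -> val_ge p (m - 1) (D a)
    & forall (M : fieldType) (i : {rmorphism F -> M}) (D' : F -> M),
        is_der cst i D' -> forall a, D' a = i (D a) * D' pi].

Lemma completion_residue (p : point F) (C : completion p) :
  residue_cst (@lf_val C) (cp_in C \o cst).
Proof.
have vP := @lf_dval C; move=> z hz; have [a ha] := cp_dense z 1.
have [|c hc] := @point_residue _ _ p a.
  have h0 : val_ge (@lf_val C) 0 (cp_in C a).
    rewrite -(subKr z (cp_in C a)); apply: (val_geB vP) => //; exact: val_ge_le ha.
  by case: h0 => [/eqP|]; rewrite ?fmorph_eq0 ?cp_val; [by move=> /eqP ->; left|by move=> ?; right].
exists c; have -> : z - (cp_in C \o cst) c = (z - cp_in C a) + cp_in C (a - cst c).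
  by rewrite rmorphB addrA subrK.
apply: (val_geD vP) => //; case: hc => [->|h]; first by rewrite rmorph0; left.
by right; rewrite cp_val.
Qed.

Lemma val_ge_completion (p : point F) (C : completion p) m a :
  val_ge (@lf_val C) m (cp_in C a) <-> val_ge p m a.
Proof.
split=> -[].
- by move/eqP; rewrite fmorph_eq0 => /eqP ->; left.
- by rewrite cp_val => h; right.
- by move=> ->; rewrite rmorph0; left.
by move=> h; right; rewrite cp_val.
Qed.

(** The restriction to [F] of d/dpi on the completion takes values in [F] by [der_ratio]. The clause
    on [delta] later identifies local derivations with global ones. *)
Lemma exists_uniformizing (p : point F) (C : completion p) pi : p pi = 1 ->
  exists D, uniformizing p pi D /\ forall delta : C -> C,
    is_der (cp_in C \o cst) idfun delta -> delta (cp_in C pi) = 1 ->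
    forall a, delta (cp_in C a) = cp_in C (D a).
Proof.
move=> ppi; have vP := @lf_dval C.
have vc c : lf_val ((cp_in C \o cst) c) = 0 by rewrite /= cp_val point_cst.
have vpi : lf_val (cp_in C pi) = 1 by rewrite cp_val.
have [delta [dP dpi dc]] :=
  exists_der_unif vP (@lf_complete C) (@completion_residue p C) vc vpi.
have DP := der_comp dP.
have Dpi0 : (delta \o cp_in C) pi != 0 by rewrite /= dpi oner_neq0.
have /choice [D hD] := fun a => der_ratio a DP Dpi0.
have DE (d : C -> C) : is_der (cp_in C \o cst) idfun d -> d (cp_in C pi) = 1 ->
    forall a, d (cp_in C a) = cp_in C (D a).
  by move=> hd d1 a; have := hD a _ _ _ (der_comp hd); rewrite /= d1 mulr1.
have {}dE := DE _ dP dpi; exists D; split=> //; split=> //.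
- by apply: (fmorph_inj (cp_in C)); rewrite -dE dpi rmorph1.
- split=> [x y|x y|c]; apply: (fmorph_inj (cp_in C)).
  + by rewrite rmorphD -!dE rmorphD (derD dP).
  + by rewrite rmorphD !rmorphM -!dE rmorphM (derM dP).
  by rewrite rmorph0 -dE; exact: (der_cst dP).
- by move=> a m /(@val_ge_completion p C) /dc; rewrite dE => /(@val_ge_completion p C).
by move=> M i D' D'P a; apply: hD.
Qed.

Section OneUniformizing.
Variables (p : point F) (pi : F) (D : F -> F).
Hypothesis pD : uniformizing p pi D.

Lemma uniformizing_val s : p s = 1 -> D s != 0 /\ p (D s) = 0.
Proof.
case: pD => ppi Dpi DP Dc _.
exact: (der_unif_val (pt_dval p) (point_cst p) (@point_residue _ _ p) DP ppi Dpi Dc).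
Qed.

(** The order does not depend on the uniformizer in its definition, because the derivative of any
    other uniformizer is a unit. *)
Lemma ord_diffE x : ord_diff x p = p (D x).
Proof.
case: (pD) => ppi Dpi DP Dc Du.
have val_n n : (exists g t : F, [/\ p t = 1, eq_diff 1 x g t & p g = n]) -> n = p (D x).
  move=> [g [t [pt xg <-]]]; have := xg D DP; rewrite mul1r => ->.
  have [Dt0 pDt] := uniformizing_val pt; have pP := pt_dval p.
  have [->|g0] := eqVneq g 0; first by rewrite mul0r.
  by rewrite (dvalM pP) // pDt addr0.
apply: val_n; apply: (@xgetPex _ 0 [set n | exists g t : F, [/\ p t = 1, eq_diff 1 x g t & p g = n]]).
exists (p (D x)), (D x), pi; split=> // D' D'P.
by rewrite mul1r; exact: (Du _ idfun D' D'P x).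
Qed.

Lemma sep_elt_der : D (sep_elt F) != 0.
Proof.
case: (pD) => ppi Dpi DP Dc Du; apply/eqP => Dx.
have : ~ eq_diff 1 (sep_elt F) 0 0.
  apply: (@xgetPex _ 0 [set x : F | ~ eq_diff 1 x 0 0]); exists pi => h.
  by have := h D DP; rewrite Dpi mul1r mul0r => /eqP; rewrite oner_eq0.
apply=> D' D'P; rewrite mul1r mul0r.
by have := Du _ idfun D' D'P (sep_elt F); rewrite Dx /= mul0r.
Qed.

End OneUniformizing.

(** The quotient of the derivatives is the function dx/dy, the same at all points. *)
Lemma uniformizing_change p pi D p' pi' D' x y : uniformizing p pi D ->
  uniformizing p' pi' D' -> D y != 0 -> D' y != 0 /\ D' x / D' y = D x / D y.
Proof.
move=> [_ Dpi DP _ Du] [_ D'pi' D'P _ Du'] Dy.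
have hx := Du _ idfun D' D'P x; have hy := Du _ idfun D' D'P y; rewrite /= in hx hy.
have D'pi : D' pi != 0.
  apply/eqP => h; have := Du _ idfun D' D'P pi'.
  by rewrite h mulr0 D'pi' => /eqP; rewrite oner_eq0.
by rewrite hy mulf_neq0 // hx; split=> //; field; rewrite Dy D'pi.
Qed.

End Uniformizing.

(** * Newton approximation inside a subfield *)

Section Newton.
Variables (F : fieldType) (v : F -> int) (K0 : set F).
Hypotheses (vP : is_dval v).
Hypotheses (K0D : forall x y, K0 x -> K0 y -> K0 (x + y)).
Hypotheses (K0M : forall x y, K0 x -> K0 y -> K0 (x * y)).
Hypotheses (K0N : forall x, K0 x -> K0 (- x)) (K0V : forall x, K0 x -> K0 x^-1).
Hypothesis (K00 : K0 0).

Let K0_horner (p : {poly F}) x : K0 x -> (forall i, K0 p`_i) -> K0 p.[x].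
Proof.
move=> hx; elim/poly_ind: p => [|p c IH] hp; first by rewrite horner0.
rewrite hornerMXaddC; apply: K0D; last by have := hp 0%N; rewrite coefD coefMX coefC add0r.
apply: K0M => //; apply: IH => i.
by have := hp i.+1; rewrite coefD coefMX coefC addr0.
Qed.

Lemma horner_ge0 (p : {poly F}) x : val_ge v 0 x -> (forall i, val_ge v 0 p`_i) -> val_ge v 0 p.[x].
Proof.
move=> hx hp; rewrite horner_coef; apply: (val_ge_sum vP) => i _.
by apply: (val_ge0M vP) => //; apply: (val_ge0X vP).
Qed.

Lemma taylor2 (p : {poly F}) r x : val_ge v 0 r -> val_ge v 0 x ->
  (forall i, val_ge v 0 p`_i) ->
  exists2 Q, val_ge v 0 Q & p.[r + x] = p.[r] + p^`().[r] * x + x ^+ 2 * Q.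
Proof.
move=> hr hx; elim/poly_ind: p => [|p c IH] hp.
  by exists 0; [left|rewrite deriv0 !horner0 mul0r mulr0 !addr0].
have hp' i : val_ge v 0 p`_i by have := hp i.+1; rewrite coefD coefMX coefC addr0.
have [Q hQ pE] := IH hp'; exists (p^`().[r] + Q * (r + x)).
  apply: (val_geD vP); last by apply: (val_geM0 vP) => //; apply: (val_geD vP).
  apply: horner_ge0 => // i; rewrite coef_deriv; exact: (val_ge_MnatR vP).
rewrite !hornerMXaddC derivD derivC addr0 derivM derivX mulr1 hornerD hornerM hornerX pE; ring.
Qed.

(** The root [b] already exists, so completeness is irrelevant; the point is that Newton's iterates
    stay in the subfield [K0], which puts [b] in its closure. The error is squared at each step. *)
Lemma newton (p : {poly F}) b (n : nat) : (forall i, val_ge v 0 p`_i) -> (forall i, K0 p`_i) ->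
  val_ge v 0 b -> p.[b] = 0 -> p^`().[b] != 0 -> v p^`().[b] = 0 ->
  (exists2 r, K0 r & val_ge v 1 (b - r)) ->
  exists2 r, K0 r & val_ge v n%:Z (b - r).
Proof.
move=> hp Kp hb pb p'b0 vp'b [r0 Kr0 hr0].
suff : exists2 r, K0 r & val_ge v n.+1%:Z (b - r).
  by move=> [r Kr hr]; exists r => //; apply: val_ge_le hr; lia.
elim: n => [|n [r Kr hr]]; first by exists r0.
have hr_0 : val_ge v 0 r.
  rewrite -(subKr b r); apply: (val_geB vP) => //; apply: val_ge_le hr; lia.
have hx : val_ge v 0 (b - r) by apply: val_ge_le hr; lia.
have [Q hQ] := taylor2 hr_0 hx hp; rewrite [r + _]addrC subrK pb => taylor.
have hp' i : val_ge v 0 p^`()`_i by rewrite coef_deriv; apply: (val_ge_MnatR vP).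
have [p'r0 vp'r] : p^`().[r] != 0 /\ v p^`().[r] = 0.
  have [Q' hQ'] := taylor2 hr_0 hx hp'; rewrite [r + _]addrC subrK => t'.
  have := @val_gt_sub _ _ vP _ p^`().[r] p'b0; rewrite vp'b; apply.
  have -> : p^`().[b] - p^`().[r] = (b - r) * (p^`()^`().[r] + (b - r) * Q') by rewrite t'; ring.
  apply: (val_geM0 vP); first by apply: val_ge_le hr; lia.
  apply: (val_geD vP); last exact: (val_geM0 vP).
  apply: horner_ge0 => // i; rewrite coef_deriv; exact: (val_ge_MnatR vP).
exists (r - p.[r] / p^`().[r]).
  apply: K0D => //; apply: K0N; apply: K0M; first exact: K0_horner.
  apply: K0V; apply: K0_horner => // i; rewrite coef_deriv.
  by elim: (X in _ *+ X) => [|m IH]; rewrite ?mulr0n ?mulrS //; apply: K0D.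
have -> : b - (r - p.[r] / p^`().[r]) = - ((b - r) ^+ 2 * Q) / p^`().[r].
  apply: (mulIf p'r0); rewrite divfK // mulrBl mulrBl divfK //.
  by apply/eqP; rewrite -subr_eq0; apply/eqP; rewrite [RHS]taylor; ring.
apply/(val_ge_div vP) => //; rewrite vp'r addr0; apply: (val_geN vP).
apply: (val_geM0 vP) => //; have := val_geX vP 2 hr; apply: val_ge_le.
rewrite -mulr_natr; lia.
Qed.

End Newton.

Lemma pev_comp (k F : fieldType) (f : {rmorphism k -> F}) (x : F) (q r : {poly k}) :
  pev f x (q \Po r) = pev f (pev f x r) q.
Proof.
elim/poly_ind: q => [|q c IH]; first by rewrite comp_poly0 !rmorph0.
rewrite comp_polyD comp_polyM comp_polyX comp_polyC !rmorphD !rmorphM /=.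
by rewrite IH !pevC pevX.
Qed.

(** * Finiteness of the support of a differential *)

Section FiniteRamification.
Variables (k : closedFieldType) (F : funField k).
Local Notation cst := (ff_cst F).
Local Notation pv := (pev cst).

(** At almost all points finitely many generators of [F] are integral and simple roots modulo the
    point of equations over k[t], so k(t) is dense. A uniformizer can then be replaced by a rational
    function in t - c, all of whose values are multiples of that of t - c. *)
Lemma finite_ramification (t : F) (D : F -> F) : is_der cst idfun D -> D t != 0 ->
  exists S : seq (point F), forall p, p \notin S -> exists c, p (t - cst c) = 1.
Proof.
move=> DP Dt; have [tau [n [b bP]]] := ff_lattice F.
have /choice [P hP] := fun g => separable_relation g DP Dt.
(* The list [G] generates [F] over [k]; [E g] is the derivative, at its root [g], of an equation of
   [g] over k[t]. *)
pose E g := biev t g (P g)^`(); pose G := tau :: [seq b i | i <- enum 'I_n].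
exists (zeros t^-1 ++ flatten [seq zeros g^-1 ++ zeros (E g) ++ zeros (E g)^-1 | g <- G]) => p.
have pP := pt_dval p; have pc := point_cst p.
rewrite mem_cat negb_or => /andP [pt /flattenP pG].
have int_of z : p \notin zeros z^-1 -> val_ge p 0 z.
  by rewrite (zerosP _).2 (dvalV pP) => h; right; lia.
have ht := int_of t pt.
have good g : g \in G -> [/\ val_ge p 0 g & p (E g) = 0].
  move=> gG; have : p \notin zeros g^-1 ++ zeros (E g) ++ zeros (E g)^-1.
    by apply/negP => pg; apply: pG; exists (zeros g^-1 ++ zeros (E g) ++ zeros (E g)^-1) => //;
      apply/mapP; exists g.
  rewrite !mem_cat !negb_or => /and3P [pg p1 p2]; split; first exact: int_of.
  by move: p1 p2; rewrite !(zerosP _).2 (dvalV pP); lia.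
pose K0 := [set r : F | exists q1 q2, pv t q2 != 0 /\ r = pv t q1 / pv t q2].
have K0pv q : K0 (pv t q) by exists q, 1; rewrite rmorph1 oner_neq0 divr1.
have K0cst c : K0 (cst c) by rewrite -(pevC cst t).
have K0D x y : K0 x -> K0 y -> K0 (x + y).
  move=> [q1 [q2 [q20 ->]]] [r1 [r2 [r20 ->]]]; exists (q1 * r2 + r1 * q2), (q2 * r2).
  by rewrite !rmorphD !rmorphM /= mulf_neq0 //; split=> //; field; rewrite q20 r20.
have K0M x y : K0 x -> K0 y -> K0 (x * y).
  move=> [q1 [q2 [q20 ->]]] [r1 [r2 [r20 ->]]]; exists (q1 * r1), (q2 * r2).
  by rewrite !rmorphM /= mulf_neq0 //; split=> //; field; rewrite q20 r20.
have K0N x : K0 x -> K0 (- x).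
  by move=> [q1 [q2 [q20 ->]]]; exists (- q1), q2; rewrite rmorphN mulNr.
have K0V x : K0 x -> K0 x^-1.
  have [->|x0] := eqVneq x 0; first by rewrite invr0.
  move=> [q1 [q2 [q20 xE]]]; exists q2, q1; split; last by rewrite xE invfM invrK mulrC.
  by apply/eqP => q10; move: x0; rewrite xE q10 mul0r eqxx.
have K00 : K0 0 by rewrite -(rmorph0 cst).
(* The closure of k(t) in [F] at [p]; it is a field containing the generators, hence all of [F]. *)
pose V := [set z : F | forall m : nat, exists2 r, K0 r & val_ge p m%:Z (z - r)].
have VK z : K0 z -> V z by move=> Kz m; exists z => //; rewrite subrr; left.
have VG g : g \in G -> V g.
  move=> gG m; have [hg Eg] := good g gG; have [EP EP'] := hP g.
  have coefE i : (map_poly (pv t) (P g))`_i = pv t (P g)`_i by rewrite coef_map_id0 ?rmorph0.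
  apply: (newton pP K0D K0M K0N K0V K00 (p := map_poly (pv t) (P g))) => //.
  - by move=> i; rewrite coefE; apply: (pev_ge0 pP pc).
  - by move=> i; rewrite coefE.
  - by rewrite deriv_map.
  - by rewrite deriv_map.
  by have [c hc] := point_residue hg; exists (cst c).
have VD x y : V x -> V y -> V (x + y).
  move=> hx hy m; have [r Kr hr] := hx m; have [s Ks hs] := hy m.
  exists (r + s); first exact: K0D.
  have -> : x + y - (r + s) = (x - r) + (y - s) by ring.
  exact: (val_geD pP).
have VM x y : V x -> V y -> V (x * y).
  move=> hx hy m; pose B := (absz (p x) + absz (p y))%N.
  have [r Kr hr] := hx (m + B)%N; have [s Ks hs] := hy (m + B)%N.
  exists (r * s); first exact: K0M.
  have hB : val_ge p (- B%:Z) x by right; lia.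
  have hBs : val_ge p (- B%:Z) s.
    rewrite -(subKr y s); apply: (val_geB pP); first by right; lia.
    by apply: val_ge_le hs; lia.
  have -> : x * y - r * s = x * (y - s) + (x - r) * s by ring.
  apply: (val_geD pP); first by have := val_geM pP hB hs; apply: val_ge_le; lia.
  by have := val_geM pP hr hBs; apply: val_ge_le; lia.
have VV x : V x -> V x^-1.
  have [->|x0] := eqVneq x 0; first by rewrite invr0.
  move=> hx m; pose B := (absz (p x)).+1; have [r Kr hr] := hx (m + B + B)%N.
  have [r0 pr] : r != 0 /\ p r = p x.
    by apply: (val_gt_sub pP x0); apply: val_ge_le hr; lia.
  exists r^-1; first exact: K0V.
  have -> : x^-1 - r^-1 = - (x - r) / (x * r) by field; rewrite x0 r0.
  apply/(val_ge_div pP); first by rewrite mulf_neq0.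
  by apply: (val_geN pP); apply: val_ge_le hr; rewrite (dvalM pP) // pr; lia.
have Vall z : V z.
  have [d [q [d0 dz]]] := bP z.
  have Vtau r : V (pv tau r).
    elim/poly_ind: r => [|r c IH]; first by rewrite rmorph0; apply: VK.
    rewrite rmorphD rmorphM /= pevX pevC; apply: VD; last exact: VK.
    by apply: VM => //; apply: VG; rewrite mem_head.
  have -> : z = (pv tau d)^-1 * (\sum_i pv tau (q i) * b i) by rewrite -dz mulKf.
  apply: (VM _ _); first exact: VV.
  apply: big_ind => //; first exact: VK.
  by move=> i _; apply: VM => //; apply: VG; rewrite inE map_f ?orbT ?mem_enum.
have [pi pi0 ppi] := dval_unif pP; have [r [q1 [q2 [q20 rE]]] hr] := Vall pi 2%N.
have [r0 pr] : r != 0 /\ p r = 1 by rewrite -ppi; apply: (val_gt_sub pP pi0); rewrite ppi.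
have [c hc] := point_residue ht; exists c.
have s0 : t - cst c != 0.
  by apply: contraNneq Dt => /eqP; rewrite subr_eq0 => /eqP ->; rewrite (der_cst DP).
have ps : 0 < p (t - cst c) by move: hc; rewrite val_geE //; lia.
have pvs q : pv t q != 0 -> exists m, p (pv t q) = p (t - cst c) *+ m.
  move=> q0; pose q' := q \Po ('X + c%:P).
  have qE : pv t q = pv (t - cst c) q' by rewrite pev_comp rmorphD /= pevX pevC subrK.
  have q'0 : q' != 0 by apply: contra_neq q0 => q'0; rewrite qE q'0 rmorph0.
  by have [_ [m hm]] := pev_val pP pc ps q'0; exists m; rewrite qE.
have q10 : pv t q1 != 0 by apply: contra_neq r0 => q10; rewrite rE q10 mul0r.
have [m1 E1] := pvs _ q10; have [m2 E2] := pvs _ q20.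
move: pr; rewrite rE (dvalM pP) ?invr_eq0 // (dvalV pP) E1 E2.
move: (p (t - cst c)) ps => x x0; rewrite -(mulr_natr x m1) -(mulr_natr x m2) !natz -mulrBr.
move: (m1%:Z - m2%:Z) => y xy; have y0 : 1 <= y by nia.
by nia.
Qed.

Variables (pi : point F -> F) (D : point F -> F -> F).
Hypothesis D_unif : forall p, uniformizing p (pi p) (D p).

(** For a fixed [t], dx = (dx/dt) dt, and almost everywhere t - c is a uniformizer, so that dt has
    order 0; only zeros and poles of the function dx/dt are left. *)
Lemma differential_finite x : (forall p, D p x != 0) ->
  exists S : seq (point F), forall p : point F, p (D p x) != 0 -> p \in S.
Proof.
move=> Dx; have [[q _]|noq] := pselect (exists q : point F, True); last first.
  by exists [::] => p; case: noq; exists p.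
have [_ Dq1 DqP _ _] := D_unif q.
have Dqt : D q (pi q) != 0 by rewrite Dq1 oner_neq0.
have [S1 hS1] := finite_ramification DqP Dqt.
have [S2 [_ hS2]] := principal_list (D q x); exists (S1 ++ S2) => p; apply: contraNT.
rewrite mem_cat negb_or => /andP [pS1 pS2]; have pP := pt_dval p.
have [c ptc] := hS1 p pS1; have [Dt0 pDt] := uniformizing_val (D_unif p) ptc.
have [_ _ DpP _ _] := D_unif p.
rewrite (derB DpP) (der_cst DpP) subr0 in Dt0 pDt.
have [_] := uniformizing_change x (D_unif q) (D_unif p) Dqt.
rewrite Dq1 divr1 => h; have -> : D p x = D q x * D p (pi q) by rewrite -h divfK.
rewrite (dvalM pP) // pDt addr0; apply/negPn/negP => /hS2; exact/negP.
Qed.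

(** The divisors of two differentials differ by the principal divisor of their quotient, of degree
    0. *)
Lemma canonical_degreeE x : (forall p, D p x != 0) ->
  canonical_degree F = \sum_(p \in [set: point F]) p (D p x).
Proof.
move=> Dx; rewrite /canonical_degree /canonical_divisor.
have Ds p : D p (sep_elt F) != 0 by apply: sep_elt_der (D_unif p).
rewrite (eq_fsbigr (fun p : point F => p (D p (sep_elt F)))); last first.
  by move=> p _; apply: (ord_diffE (D_unif p)).
have [[q _]|noq] := pselect (exists q : point F, True); last first.
  by apply: eq_fsbigr => p; case: noq; exists p.
pose r := D q (sep_elt F) / D q x.
have rE (p : point F) : p (D p (sep_elt F)) = p (D p x) + p r.
  have [_ h] := uniformizing_change (sep_elt F) (D_unif q) (D_unif p) (Dx q).
  by rewrite /r -h -(dvalM (pt_dval p)) ?mulf_neq0 ?invr_eq0 // mulrC divfK.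
have [S1 hS1] := differential_finite Ds; have [S2 hS2] := differential_finite Dx.
have [S3 [_ hS3]] := principal_list r; pose S := undup (S1 ++ S2 ++ S3).
have uS : uniq S by apply: undup_uniq.
rewrite !(@fsbig_list _ _ _ S) //.
- under eq_bigr do rewrite rE.
  rewrite big_split /=; have -> : \sum_(p <- S) p r = 0; last by rewrite addr0.
  rewrite -[RHS](principal_degree r) (@fsbig_list _ _ _ S) //.
  by move=> p /hS3 ph; rewrite mem_undup !mem_cat ph !orbT.
- by move=> p /hS2 ph; rewrite mem_undup !mem_cat ph !orbT.
by move=> p /hS1 ph; rewrite mem_undup !mem_cat ph.
Qed.

End FiniteRamification.

(** * Differentials under a separable extension of function fields *)

Section RiemannHurwitz.
Variables (k : closedFieldType) (E F : funField k) (j : {rmorphism E -> F}) (n : nat).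
Hypotheses (jc : forall c, j (ff_cst E c) = ff_cst F c) (jn : ext_has_degree j n).
Hypothesis jsep : separable_ext j.
Variables (phi : point F -> point E) (e : point F -> nat).
Hypotheses (e0 : forall y, (0 < e y)%N).
Hypothesis ye : forall (y : point F) a, y (j a) = phi y a *+ e y.
Variables (piE : point E -> E) (DE : point E -> E -> E).
Variables (piF : point F -> F) (DF : point F -> F -> F).
Hypothesis DE_unif : forall p, uniformizing p (piE p) (DE p).
Hypothesis DF_unif : forall p, uniformizing p (piF p) (DF p).

Lemma der_restrict y : is_der (ff_cst E) j (DF y \o j).
Proof.
have [_ _ DP _ _] := DF_unif y; split=> [x z|x z|c] /=.
- by rewrite rmorphD (derD DP).
- by rewrite rmorphM (derM DP).
by rewrite jc (der_cst DP).
Qed.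

Lemma der_restrictE y a : DF y (j a) = j (DE (phi y) a) * DF y (j (piE (phi y))).
Proof. by have [_ _ _ _ Du] := DE_unif (phi y); apply: (Du _ _ _ (der_restrict y)). Qed.

(** Otherwise d/dpi would vanish on [E], hence on [F] by separability, although it is 1 at its
    uniformizer. *)
Lemma ramification_neq0 y : DF y (j (piE (phi y))) != 0.
Proof.
have [_ D1 [DD DM _] _ _] := DF_unif y; apply/eqP => h.
have DP : is_der j idfun (DF y) by split=> // a; rewrite der_restrictE h mulr0.
by have /eqP := separable_der_eq0 DP jsep (piF y); rewrite D1 oner_eq0.
Qed.

(** By the chain rule, the order at [y] of a differential of [E] is [e y] times its order at [phi y]
    plus the order of dt/dpi. The finite support is part of the conclusion because later sums are
    split along it. *)
Lemma riemann_hurwitz :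
  (exists S : seq (point F), forall y : point F, y (DF y (j (piE (phi y)))) != 0 -> y \in S) /\
  canonical_degree F = n%:Z * canonical_degree E +
    \sum_(y \in [set: point F]) y (DF y (j (piE (phi y)))).
Proof.
pose x := sep_elt E; have Ex p : DE p x != 0 by apply: sep_elt_der (DE_unif p).
have Fx y : DF y (j x) != 0.
  by rewrite der_restrictE mulf_neq0 ?ramification_neq0 ?fmorph_eq0.
pose rho (y : point F) := y (DF y (j (piE (phi y)))).
pose g (p : point E) := p (DE p x).
have yE (y : point F) : y (DF y (j x)) = g (phi y) * (e y)%:R + rho y.
  rewrite der_restrictE (dvalM (pt_dval y)) ?fmorph_eq0 ?ramification_neq0 //.
  by rewrite ye mulr_natr.
have [SE0 hSE0] := differential_finite DE_unif Ex; pose SE := undup SE0.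
have uSE : uniq SE by apply: undup_uniq.
have hSE p : g p != 0 -> p \in SE by move=> /hSE0; rewrite mem_undup.
have [SF hSF] := differential_finite DF_unif Fx.
have [Y [uY memY sumY]] := fiber_sum jc jn e0 ye uSE hSE.
pose T := undup (Y ++ SF); have uT : uniq T by apply: undup_uniq.
have gT y : g (phi y) * (e y)%:R != 0 -> y \in Y.
  by rewrite memY => h; apply: hSE; apply: contra_neq h => ->; rewrite mul0r.
have rhoT y : rho y != 0 -> y \in T.
  rewrite mem_undup mem_cat => h; apply/orP.
  have [gy|gy] := eqVneq (g (phi y) * (e y)%:R) 0; last by left; apply: gT.
  by right; apply: hSF; rewrite yE gy add0r.
split; first by exists T.
rewrite (canonical_degreeE DF_unif Fx) (canonical_degreeE DE_unif Ex).
rewrite (@fsbig_list _ _ (fun p : point E => p (DE p x)) SE) // -natz -sumY.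
rewrite -(@fsbig_list _ _ (fun y => g (phi y) * (e y)%:R) Y) //.
rewrite !(@fsbig_list _ _ _ T) //.
- by rewrite -big_split; apply: eq_bigr => y _; apply: yE.
- by move=> y /hSF ySF; rewrite mem_undup mem_cat ySF orbT.
by move=> y /gT yY; rewrite mem_undup mem_cat yY.
Qed.

End RiemannHurwitz.

(** * Ramification of the local extensions *)

Section UniqueExtension.
Variables (k K L M : fieldType) (f : {rmorphism k -> K}) (j : {rmorphism K -> L}).
Variables (i : {rmorphism L -> M}) (v : K -> int) (w : L -> int) (u : M -> int).
Variables (e e' : nat) (pi : L).
Hypotheses (vP : is_dval v) (wP : is_dval w) (uP : is_dval u) (vK : is_complete v).
Hypotheses (vf : forall c, v (f c) = 0) (e0 : (0 < e)%N) (e'0 : (0 < e')%N).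
Hypotheses (wj : forall a, w (j a) = v a *+ e) (uij : forall a, u (i (j a)) = v a *+ e').
Hypotheses (resL : residue_cst w (j \o f)) (wpi : w pi = 1).

(* A valuation of [M] prolonging [v] is positive on [pi], by its Eisenstein
   equation, hence nonnegative on the valuation ring of [L]. *)
Lemma val_ext_unique : exists2 m : nat, (0 < m)%N & forall z, u (i z) = w z *+ m.
Proof.
have pi0 : pi != 0 by apply: (dval_neq0 wP); rewrite wpi.
have ipi0 : i pi != 0 by rewrite fmorph_eq0.
have [A [sA AE hA _]] := eisenstein vP wP vK e0 wj resL wpi.
have uij_ge m a : val_ge v m a -> val_ge u (m * e'%:Z) (i (j a)).
  exact: (@val_ge_ext _ _ (i \o j) _ _ _ _ _ uij).
have upi : 0 < u (i pi).
  rewrite ltNge; apply/negP => upi.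
  (* If [u (i pi) <= 0], each term of the Eisenstein equation has value above [e] times
     [u (i pi)]. *)
  have : val_ge u (u (i pi) *+ e + 1) (i (pi ^+ e)).
    rewrite -AE (pevE _ _ sA) rmorph_sum; apply: (val_ge_sum uP) => l _; rewrite rmorphM rmorphXn /=.
    apply: val_ge_le (val_geM uP (uij_ge _ _ (hA l)) (val_geX uP l (val_gexx u (i pi)))).
    rewrite -(mulr_natr (u (i pi)) e) -(mulr_natr (u (i pi)) l) !natz.
    have := ltn_ord l; nia.
  by rewrite rmorphXn val_geE ?expf_neq0 //= (dvalX uP) //; lia.
have [m mE] : exists m : nat, u (i pi) = m%:Z by exists (absz (u (i pi))); lia.
have intz z : val_ge w 0 z -> val_ge u 0 (i z).
  have [c ->] := ext_span vP wP vK e0 wj resL wpi z.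
  move=> /(ext_coord_ge0 wP wj wpi) hc; rewrite rmorph_sum.
  apply: (val_ge_sum uP) => l _; rewrite rmorphM rmorphXn /=; apply: (val_ge0M uP).
    by have := uij_ge _ _ (hc l); rewrite mul0r.
  by apply: (val_ge0X uP); right; lia.
have unit_val z : z != 0 -> w z = 0 -> u (i z) = 0.
  move=> z0 wz; have h1 : val_ge u 0 (i z) by apply: intz; right; rewrite wz.
  have : val_ge u 0 (i z^-1) by apply: intz; right; rewrite (dvalV wP) wz.
  rewrite fmorphV; move: h1; rewrite !val_geE ?invr_eq0 ?fmorph_eq0 //.
  by rewrite (dvalV uP) => h2 h3; apply/le_anti; rewrite h2 -oppr_ge0 h3.
have nat_case z (n : nat) : z != 0 -> w z = n%:Z -> u (i z) = w z *+ m.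
  move=> z0 wz; have pn0 : pi ^+ n != 0 by rewrite expf_neq0.
  have := unit_val (z / pi ^+ n); rewrite mulf_neq0 ?invr_eq0 // => /(_ isT).
  rewrite (dvalM wP) ?invr_eq0 // (dvalV wP) (dvalX wP) // wpi wz natz subrr => /(_ erefl).
  rewrite fmorph_div rmorphXn (dvalM uP) ?invr_eq0 ?expf_neq0 ?fmorph_eq0 //.
  rewrite (dvalV uP) (dvalX uP) // mE -(mulr_natr n%:Z m) -(mulr_natr m%:Z n) !natz.
  by rewrite [n%:Z * _]mulrC => /eqP; rewrite subr_eq0 => /eqP.
exists m => [|z]; first by rewrite -ltz_nat -mE.
have [->|z0] := eqVneq z 0; first by rewrite rmorph0 (dval0 uP) (dval0 wP) mul0rn.
have [wz|wz] := leP 0 (w z); first by apply: (nat_case z (absz (w z))) => //; rewrite gez0_abs.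
have := nat_case z^-1 (absz (w z)); rewrite invr_eq0 fmorphV (dvalV uP) (dvalV wP).
move=> /(_ z0) h; by apply: oppr_inj; rewrite h ?mulNrn // ltz0_abs.
Qed.

End UniqueExtension.

Section GaloisExtension.
Variables (k : closedFieldType) (K : localField) (f : {rmorphism k -> K}) (L : galoisExt K).
Hypotheses (vf : forall c, lf_val (f c) = 0) (res : residue_cst (@lf_val K) f).
Local Notation w := (@ge_val K L).

Lemma galois_separable_ext : separable_ext (in_alg L).
Proof.
move=> y; have /and3P [_ /separableP sep _] := ge_galois L.
have := sep y (memvf y); rewrite /separable_element => sy.
have /polyOver1P [p pE] := minPolyOver 1%AS y.
exists p; last by rewrite -[map_poly _ _]pE root_minPoly.
by move: sy; rewrite pE separable_map.
Qed.

Lemma galois_has_degree : ext_has_degree (in_alg L) (ge_degree L).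
Proof.
exists (fun i => (vbasis {:L})`_i) => y; exists (\row_i coord (vbasis {:L}) i y); split.
  rewrite {1}(coord_vbasis (memvf y)); apply: eq_bigr => i _.
  by rewrite mxE /= mulr_algl.
move=> c yE; apply/rowP => i; rewrite mxE yE.
under eq_bigr do rewrite /= mulr_algl.
by rewrite coord_sum_free // (basis_free (vbasisP _)).
Qed.

Lemma galois_residue : residue_cst w (in_alg L \o f).
Proof.
apply: (residue_algebraic (@lf_dval K) (@ge_dval K L) (@ge_ext K L) vf res) => z.
by have [p sp rp] := galois_separable_ext z; exists p => //; apply: separable_poly_neq0.
Qed.

(** The powers of a uniformizer below the ramification index form a basis, so that index is the
    degree. *)
Lemma galois_val a : w (in_alg L a) = lf_val a *+ ge_degree L.
Proof.
have [e e0 we] := @ge_ext K L; have [pi _ wpi] := dval_unif (@ge_dval K L).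
have := ext_basis (@lf_dval K) (@ge_dval K L) (@lf_complete K) e0 we galois_residue wpi.
by move=> bP; rewrite we (ext_has_degree_uniq galois_has_degree (ex_intro _ _ bP)).
Qed.

Lemma ge_degree_gt0 : (0 < ge_degree L)%N.
Proof.
have [t t0 vt] := dval_unif (@lf_dval K); have [e e0 we] := @ge_ext K L.
by have := galois_val t; rewrite we vt !natz => -[<-].
Qed.

Lemma galois_complete : is_complete w.
Proof.
have [pi _ wpi] := dval_unif (@ge_dval K L).
exact: (ext_complete (@lf_dval K) (@ge_dval K L) (@lf_complete K) ge_degree_gt0
          galois_val galois_residue wpi).
Qed.

Lemma galois_cst c : w ((in_alg L \o f) c) = 0.
Proof. by rewrite galois_val /= vf mul0rn. Qed.

Lemma galois_der : exists (pi : L) (D : L -> L), [/\ w pi = 1, D pi = 1,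
  is_der (in_alg L \o f) idfun D & forall a m, val_ge w m a -> val_ge w (m - 1) (D a)].
Proof.
have [pi _ wpi] := dval_unif (@ge_dval K L).
have [D [DP D1 Dc]] :=
  exists_der_unif (@ge_dval K L) galois_complete galois_residue galois_cst wpi.
by exists pi, D.
Qed.

Section Derivation.
Variables (t : K) (pi : L) (D : L -> L).
Hypotheses (vt : lf_val t = 1) (wpi : w pi = 1) (D1 : D pi = 1).
Hypotheses (DP : is_der (in_alg L \o f) idfun D).
Hypothesis Dc : forall a m, val_ge w m a -> val_ge w (m - 1) (D a).

Lemma der_galois (DK : K -> K) : is_der f idfun DK -> DK t = 1 ->
  (forall a m, val_ge (@lf_val K) m a -> val_ge (@lf_val K) (m - 1) (DK a)) ->
  forall a, D (in_alg L a) = in_alg L (DK a) * D (in_alg L t).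
Proof.
move=> DKP DKt DKc a.
have DjP := der_comp DP.
apply: (continuous_der_unif (@lf_dval K) (@ge_dval K L) res DKP vt DKt DKc
  ge_degree_gt0 DjP) galois_val a => a m.
by move=> /(val_ge_ext galois_val) /Dc; rewrite -mulr_natr natz; apply.
Qed.

Lemma der_galois_neq0 : D (in_alg L t) != 0.
Proof.
have [DK [DKP DKt DKc]] := exists_der_unif (@lf_dval K) (@lf_complete K) res vf vt.
apply/eqP => Dt; have DjP : is_der (in_alg L) idfun D.
  by case: DP => DD DM _; split=> // c; rewrite (der_galois DKP DKt DKc) Dt mulr0.
have /eqP := separable_der_eq0 DjP galois_separable_ext pi.
by rewrite D1 oner_eq0.
Qed.

Lemma galois_dr : dr (@lf_val K) w (in_alg L) = w (D (in_alg L t)).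
Proof.
exact: (dr_der (@lf_dval K) (@ge_dval K L) (@lf_complete K) vf ge_degree_gt0 galois_val
  galois_residue wpi res DP D1 Dc vt der_galois_neq0).
Qed.

Lemma galois_dr1 : ge_degree L = 1%N -> dr (@lf_val K) w (in_alg L) = 0.
Proof.
move=> d1; rewrite galois_dr; have [|_ //] :=
  der_unif_val (@ge_dval K L) galois_cst galois_residue DP wpi D1 Dc (s := in_alg L t).
by rewrite galois_val vt d1.
Qed.

End Derivation.

(** In degree 1 a uniformizer of [K] stays one, and its derivative is a unit. Points outside the
    branch support thus contribute 0, and sums may run over all points. *)
Lemma trivial_dr : ge_degree L = 1%N -> dr (@lf_val K) w (in_alg L) = 0.
Proof.
have [pi [D [wpi D1 DP Dc]]] := galois_der; have [t _ vt] := dval_unif (@lf_dval K).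
exact: galois_dr1 vt wpi D1 DP Dc.
Qed.

End GaloisExtension.

(* The additivity of the different exponents in [Kx <= P <= Q] and in
   [Kx <= Ky <= Q] is the chain rule for d(tx) / d(piQ). *)
Lemma tower_different (k : closedFieldType) (Kx Ky : localField)
    (fx : {rmorphism k -> Kx}) (fy : {rmorphism k -> Ky}) (j : {rmorphism Kx -> Ky})
    (P : galoisExt Kx) (Q : galoisExt Ky) (i : {rmorphism P -> Q}) (e : nat)
    (tx : Kx) (ty : Ky) (Dy : Ky -> Ky) :
  (forall c, lf_val (fx c) = 0) -> (forall c, lf_val (fy c) = 0) ->
  residue_cst (@lf_val Kx) fx -> residue_cst (@lf_val Ky) fy ->
  (forall c, j (fx c) = fy c) -> (forall a, i (in_alg P a) = in_alg Q (j a)) ->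
  (0 < e)%N -> (forall a, lf_val (j a) = lf_val a *+ e) ->
  lf_val tx = 1 -> lf_val ty = 1 -> is_der fy idfun Dy -> Dy ty = 1 ->
  (forall a m, val_ge (@lf_val Ky) m a -> val_ge (@lf_val Ky) (m - 1) (Dy a)) ->
  Dy (j tx) != 0 ->
  (dr (@ge_val _ P) (@ge_val _ Q) i)%:~R / (ge_degree Q)%:R =
    (dr (@lf_val Ky) (@ge_val _ Q) (in_alg Q))%:~R / (ge_degree Q)%:R
    + (lf_val (Dy (j tx)))%:~R
    - (dr (@lf_val Kx) (@ge_val _ P) (in_alg P))%:~R / (ge_degree P)%:R * e%:R :> rat.
Proof.
move=> vfx vfy resx resy jf ij e0 je vtx vty DyP Dyt Dyc Dytx.
have [piP [DP [wpiP DP1 DPP DPc]]] := galois_der P vfx resx.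
have [piQ [DQ [wpiQ DQ1 DQP DQc]]] := galois_der Q vfy resy.
have wP := @ge_dval _ P; have wQ := @ge_dval _ Q.
have degP := galois_val P vfx resx; have degQ := galois_val Q vfy resy.
have P0 := ge_degree_gt0 P vfx resx; have Q0 := ge_degree_gt0 Q vfy resy.
have ivf a : ge_val (i (in_alg P a)) = lf_val a *+ (e * ge_degree Q).
  by rewrite ij degQ je mulrnA.
have eQ0 : (0 < e * ge_degree Q)%N by rewrite muln_gt0 e0.
(* The embedding [i] carries no valuation data; its ramification index [m] comes from the uniqueness
   of extensions from [Kx]. *)
have [m m0 im] := val_ext_unique (@lf_dval _) wP wQ (@lf_complete _) P0 eQ0 degP ivf
  (galois_residue vfx resx) wpiP.
have degE : (e * ge_degree Q = ge_degree P * m)%N.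
  by have := ivf tx; rewrite im degP vtx -mulrnA => /eqP; rewrite eqr_nat => /eqP.
have cstQ c : (i \o (in_alg P \o fx)) c = (in_alg Q \o fy) c by rewrite /= ij jf.
have DQP' : is_der (i \o (in_alg P \o fx)) idfun DQ.
  by case: DQP => DD DM DC; split=> // c; apply: etrans (DC c); exact: (congr1 DQ (cstQ c)).
have resQ' : residue_cst (@ge_val _ Q) (i \o (in_alg P \o fx)).
  move=> z /(galois_residue vfy resy) [c hc]; exists c.
  by have -> : z - (i \o (in_alg P \o fx)) c = z - (in_alg Q \o fy) c by rewrite -cstQ.
have DiP := der_comp DQP'.
have chainP a : DQ (i a) = i (DP a) * DQ (i piP).
  apply: (continuous_der_unif (B := 1) wP wQ (galois_residue vfx resx) DPP wpiP DP1 DPc m0 DiP _ im) => b n.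
  by move=> /(val_ge_ext im) /DQc; rewrite -mulr_natr natz; apply.
have chainQ := der_galois vfy resy vty DQP DQc DyP Dyt Dyc.
have DQt0 := der_galois_neq0 vfy resy vty DQ1 DQP DQc.
have E : DQ (i (in_alg P tx)) = in_alg Q (Dy (j tx)) * DQ (in_alg Q ty) by rewrite ij chainQ.
have nz : DQ (i (in_alg P tx)) != 0 by rewrite E mulf_neq0 // fmorph_eq0.
have iP0 : DQ (i piP) != 0.
  by apply: contra_neq nz => h; rewrite chainP h mulr0.
have DPt0 := der_galois_neq0 vfx resx vtx DP1 DPP DPc.
have drQP : dr (@ge_val _ P) (@ge_val _ Q) i = ge_val (DQ (i piP)).
  exact: (dr_der wP wQ (galois_complete vfx resx) (galois_cst P vfx resx) m0 im
    resQ' wpiQ (galois_residue vfx resx) DQP' DQ1 DQc wpiP iP0).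
(* The derivative of [tx] with respect to [piQ], computed through [Ky] on the left and through [P]
   on the right. *)
have key : lf_val (Dy (j tx)) *+ ge_degree Q + ge_val (DQ (in_alg Q ty)) =
    ge_val (DP (in_alg P tx)) *+ m + ge_val (DQ (i piP)).
  rewrite -degQ -im -!(dvalM wQ) ?fmorph_eq0 //.
  by rewrite -E chainP.
rewrite drQP (galois_dr vfy resy vty wpiQ DQ1 DQP DQc) (galois_dr vfx resx vtx wpiP DP1 DPP DPc).
have Q0' : (ge_degree Q)%:R != 0 :> rat by rewrite pnatr_eq0 -lt0n.
have P0' : (ge_degree P)%:R != 0 :> rat by rewrite pnatr_eq0 -lt0n.
have degE' : e%:R = (ge_degree P)%:R * m%:R / (ge_degree Q)%:R :> rat.
  by apply: (mulIf Q0'); rewrite divfK // -!natrM degE.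
have key' : (lf_val (Dy (j tx)))%:~R * (ge_degree Q)%:R + (ge_val (DQ (in_alg Q ty)))%:~R =
    (ge_val (DP (in_alg P tx)))%:~R * m%:R + (ge_val (DQ (i piP)))%:~R :> rat.
  rewrite !mulr_natr; have /(congr1 (fun x : int => x%:~R : rat)) := key.
  by rewrite !rmorphD /= !rmorphMn.
have -> : (ge_val (DQ (i piP)))%:~R =
    (lf_val (Dy (j tx)))%:~R * (ge_degree Q)%:R + (ge_val (DQ (in_alg Q ty)))%:~R
    - (ge_val (DP (in_alg P tx)))%:~R * m%:R :> rat by rewrite key' addrAC subrr add0r.
by rewrite degE'; field; rewrite Q0' P0'.
Qed.

(** * Formal orbifolds *)

Definition branch_term (k : closedFieldType) (X : formalOrbifold k) (i : components X)
    (p : point (funfield X i)) : rat :=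
  (dr (@lf_val (local_at X p)) (@ge_val _ (branch X p)) (in_alg (branch X p)))%:~R
  / (ge_degree (branch X p))%:R.

Section Orbifold.
Variables (k : closedFieldType) (X : formalOrbifold k).

Let cst (i : components X) (p : point (funfield X i)) :=
  cp_in (local_at X p) \o ff_cst (funfield X i).

Lemma completion_cst i (p : point (funfield X i)) c : lf_val (cst p c) = 0.
Proof. by rewrite /= cp_val point_cst. Qed.

Lemma branch_term_support i (p : point (funfield X i)) :
  branch_term p != 0 -> branch_support (@branch _ X) i p.
Proof.
move=> /eqP h d1; apply: h; rewrite /branch_term.
by rewrite (trivial_dr (@completion_cst i p) (@completion_residue _ _ p _)) ?mul0r.
Qed.

Lemma branch_term_finite i : exists S : seq (point (funfield X i)),
  uniq S /\ forall p : point (funfield X i), branch_term p != 0 -> p \in S.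
Proof.
have /finite_seqP [S SE] := @branch_finite _ X i; exists (undup S); rewrite undup_uniq.
by split=> // p /branch_term_support; rewrite SE mem_undup.
Qed.

Lemma sum_branch_support i :
  \sum_(p \in branch_support (@branch _ X) i) branch_term p =
  \sum_(p \in [set: point (funfield X i)]) branch_term p.
Proof.
apply: fsbig_widen => // p [_ /= np]; apply/eqP/negPn/negP => /branch_term_support.
exact: np.
Qed.

Lemma orb_genusE : 2%:R * orb_genus X - 2%:R =
  \sum_(i : components X) ((canonical_degree (funfield X i))%:~R +
    \sum_(p \in [set: point (funfield X i)]) branch_term p) :> rat.
Proof.
rewrite /orb_genus /genus big_split /= -(eq_bigr _ (fun i _ => sum_branch_support i)).
by rewrite rmorph_sum /=; field.
Qed.

Lemma curve_uniformizing i : exists (pi : point (funfield X i) -> funfield X i)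
    (D : point (funfield X i) -> funfield X i -> funfield X i),
  forall p, uniformizing p (pi p) (D p) /\
  forall delta : local_at X p -> local_at X p, is_der (cst p) idfun delta ->
    delta (cp_in (local_at X p) (pi p)) = 1 ->
    forall a, delta (cp_in (local_at X p) a) = cp_in (local_at X p) (D p a).
Proof.
have /choice [pi hpi] : forall p : point (funfield X i), exists t, p t = 1.
  by move=> p; have [t _ pt] := dval_unif (pt_dval p); exists t.
have /choice [D hD] := fun p => exists_uniformizing (local_at X p) (hpi p).
by exists pi, D.
Qed.

End Orbifold.

(** * Morphisms of formal orbifolds *)

Section Morphism.
Variables (k : closedFieldType) (Y X : formalOrbifold k) (f : orbMorphism Y X).
Variable j : components Y.
Local Notation E := (funfield X (cov_comp f j)).
Local Notation F := (funfield Y j).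
Local Notation phi := (@cov_point _ _ _ f j).

(** The identity [ramE] between divisors on one component is summed; the pulled back branch terms
    give the degree times their sum on the base, and the orders of dt/dpi cancel against
    [riemann_hurwitz]. *)
Lemma component_riemann_hurwitz :
  (canonical_degree F)%:~R + \sum_(y \in [set: point F]) branch_term y =
  (ext_degree (cov_fun f j))%:R *
    ((canonical_degree E)%:~R + \sum_(x \in [set: point E]) branch_term x)
  + \sum_(y \in [set: point F]) ramification_divisor f y :> rat.
Proof.
have [n jn] := cov_finite f j; rewrite (ext_degreeE jn).
have /choice [e he] : forall y : point F, exists e, (0 < e)%N /\
    forall a, lf_val (cov_local f y a) = lf_val a *+ e.
  by move=> y; have [e e0 ve] := cov_local_val f y; exists e.
have e0 y : (0 < e y)%N by have [] := he y.
have ye (y : point F) a : y (cov_fun f j a) = phi y a *+ e y.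
  rewrite -(cp_val (local_at Y y)) -(cp_val (local_at X (phi y))) -cov_local_in.
  by have [_ ->] := he y.
have [piE [DE hE]] := curve_uniformizing (cov_comp f j).
have [piF [DF hF]] := curve_uniformizing j.
have DE_unif p : uniformizing p (piE p) (DE p) by have [] := hE p.
have DF_unif p : uniformizing p (piF p) (DF p) by have [] := hF p.
pose rho (y : point F) : int := y (DF y (cov_fun f j (piE (phi y)))).
have jc := cov_cst f j; have jsep : separable_ext (cov_fun f j) by exact: cov_separable.
have [[SR hSR] RH] := riemann_hurwitz jc jn jsep e0 ye DE_unif DF_unif.
have rho0 y : DF y (cov_fun f j (piE (phi y))) != 0 by exact: (ramification_neq0 jc jsep phi DE_unif DF_unif).
have ramE y : ramification_divisor f y =
    branch_term y + (rho y)%:~R - branch_term (phi y) * (e y)%:R.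
  have [delta [dP d1 dc]] := exists_der_unif (@lf_dval _) (@lf_complete (local_at Y y))
    (@completion_residue _ _ y _) (@completion_cst _ Y j y)
    (etrans (cp_val (local_at Y y) (piF y)) (let: And5 h _ _ _ _ := DF_unif y in h)).
  have dE a : delta (cp_in (local_at Y y) a) = cp_in (local_at Y y) (DF y a).
    by have [_ h] := hF y; apply: h.
  have tE : delta (cov_local f y (cp_in (local_at X (phi y)) (piE (phi y)))) =
      cp_in (local_at Y y) (DF y (cov_fun f j (piE (phi y)))).
    by rewrite cov_local_in dE.
  rewrite /ramification_divisor /branch_term /rho -(cp_val (local_at Y y)) -tE.
  apply: (tower_different (@completion_cst _ X _ (phi y)) (@completion_cst _ Y j y)
    (@completion_residue _ _ (phi y) _) (@completion_residue _ _ y _)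
    _ (@orb_embP _ _ _ f j y) (e0 y) (proj2 (he y)) _ _ dP d1 dc) => //.
  - by move=> c; rewrite /= cov_local_in jc.
  - by rewrite cp_val; have [] := DE_unif (phi y).
  - by rewrite cp_val; have [] := DF_unif y.
  by rewrite tE fmorph_eq0 rho0.
have [SY [uSY hSY]] := branch_term_finite j.
have [SX [uSX hSX]] := branch_term_finite (cov_comp f j).
have [Z [uZ memZ sumZ]] := fiber_sum jc jn e0 ye uSX hSX.
(* One finite list containing all supports, so that the sums can be combined term by term. *)
pose T := undup (SY ++ SR ++ Z); have uT : uniq T by apply: undup_uniq.
have TY y : branch_term y != 0 -> y \in T.
  by move=> /hSY h; rewrite mem_undup mem_cat h.
have TR y : rho y != 0 -> y \in T.
  by move=> /hSR h; rewrite mem_undup !mem_cat h orbT.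
have TX y : branch_term (phi y) * (e y)%:R != 0 -> y \in T.
  rewrite mem_undup !mem_cat memZ => h; rewrite hSX ?orbT //.
  by apply: contra_neq h => ->; rewrite mul0r.
have TD y : ramification_divisor f y != 0 -> y \in T.
  apply: contraNT => yT; have out (z : rat) : (z != 0 -> y \in T) -> z = 0.
    by move=> h; apply/eqP/negPn/negP => /h; apply/negP.
  rewrite ramE (out _ (TX y)) (out _ (TY y)) (out (rho y)%:~R) ?addr0 ?subr0 //.
  by rewrite intr_eq0; apply: TR.
rewrite RH rmorphD rmorphM /= mulrDr -!addrA; congr (_ + _).
rewrite (@fsbig_list _ _ (fun x : point E => branch_term x) SX) // -sumZ.
rewrite -(@fsbig_list _ _ (fun y : point F => branch_term (phi y) * (e y)%:R) Z) //; last first.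
  by move=> y h; rewrite memZ hSX //; apply: contra_neq h => ->; rewrite mul0r.
rewrite !(@fsbig_list _ _ _ T) // rmorph_sum -!big_split /=; apply: eq_bigr => y _.
by rewrite ramE; ring.
Qed.

End Morphism.

Theorem theorem2p20 (k : closedFieldType) (X Y : formalOrbifold k)
    (f : orbMorphism Y X) (d : nat) (hd : covering_of_degree f d) :
  2%:R * orb_genus Y - 2%:R =
    d%:R * (2%:R * orb_genus X - 2%:R) + div_degree (@ramification_divisor _ _ _ f) :> rat.
Proof.
rewrite !orb_genusE /div_degree (eq_bigr _ (fun j _ => component_riemann_hurwitz f j)).
rewrite big_split /=; congr (_ + _).
(* The components of [Y] are grouped by their images; over each component of [X] the degrees add up
   to [d]. *)
rewrite (partition_big (cov_comp f) xpredT) //= mulr_sumr; apply: eq_bigr => i _.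
rewrite -(hd i) natr_sum mulr_suml; apply: eq_bigr => j /eqP ji.
(* The function field depends on the component, so the equality of components is eliminated rather
   than rewritten. *)
by case: i / ji.
Qed.
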